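(* Let $\Phi=\begin{pmatrix}\Phi_{11}&\Phi_{12}\\ \Phi_{21}&\Phi_{22}\end{pmatrix}$ be a bounded block matrix function on $\mathbb T$ ($\Phi_{11}$ of size $m_1\times n_1$, $\Phi_{22}$ of size $m_2\times n_2$) such that $\|\Gamma_\Phi\|_{\rm e}<\|\Gamma_\Phi\|$, and let $\Phi^{(1)}=\begin{pmatrix}\Phi^{(1)}_{11}&\Phi^{(1)}_{12}\\ \Phi^{(1)}_{21}&\Phi^{(1)}_{22}\end{pmatrix}$ (with $\Phi^{(1)}_{11}$ of size $(m_1-1)\times(n_1-1)$ and $\Phi^{(1)}_{22}$ of size $m_2\times n_2$) be the block matrix function associated with $\Phi$ as in the context. Then $$\|\Gamma_{\Phi^{(1)}}\|_{\rm e}\le\|\Gamma_\Phi\|_{\rm e}.$$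
   Context: $\mathbb T$ is the unit circle, $z$ the identity function on $\mathbb T$; $H^2_-=L^2\ominus H^2$; $M_{k,l}$ is the space of $k\times l$ matrices; $\|F\|_\infty=\operatorname{ess\,sup}_{\zeta\in\mathbb T}\|F(\zeta)\|$; $\|T\|_{\rm e}$ is the essential norm (distance to the compact operators). Put $m=m_1+m_2$, $n=n_1+n_2$. Blocks with zero rows or columns are treated as empty. For a block function $\Phi$ with $\Phi_{11}$ of size $m_1\times n_1$ and $\Phi_{22}$ of size $m_2\times n_2$, $\Gamma_\Phi:H^2(\mathbb C^{n_1})\oplus L^2(\mathbb C^{n_2})\to H^2_-(\mathbb C^{m_1})\oplus L^2(\mathbb C^{m_2})$ is $\Gamma_\Phi f=\mathbb P^-\Phi f$, with $\mathbb P^-$ the orthogonal projection of $L^2(\mathbb C^{m_1})\oplus L^2(\mathbb C^{m_2})$ onto $H^2_-(\mathbb C^{m_1})\oplus L^2(\mathbb C^{m_2})$. $\Gamma_{\Phi^{(1)}}$ is defined likewise with $m_1,n_1$ replaced by $m_1-1,n_1-1$. An optimal solution of the four block problem for $\Phi$ is a $Q\in H^\infty(M_{m_1,n_1})$ minimizing $\left\|\begin{pmatrix}\Phi_{11}-Q&\Phi_{12}\\ \Phi_{21}&\Phi_{22}\end{pmatrix}\right\|_\infty$; the minimum equals $\|\Gamma_\Phi\|$. Inner/outer: $\Theta\in H^\infty$ is inner if $\Theta(\zeta)$ is isometric a.e. on $\mathbb T$; $F\in H^\infty(M_{k,l})$ is outer if $FH^2(\mathbb C^l)$ is dense in $H^2(\mathbb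 C^k)$, and co-outer if $F^t$ is outer. Construction of $V,W,u_0,\Phi^{(1)}$ (when $\|\Gamma_\Phi\|_{\rm e}<\|\Gamma_\Phi\|=:t_0$): fix a maximizing vector $f=f_1\oplus f_2$ of $\Gamma_\Phi$ ($f\ne0$, $\|\Gamma_\Phi f\|=\|\Gamma_\Phi\|\,\|f\|$; it exists), $f_1\in H^2(\mathbb C^{n_1})$, $f_2\in L^2(\mathbb C^{n_2})$, and put $g=g_1\oplus g_2=t_0^{-1}\Gamma_\Phi f$. Then $f_1\neq0$, $g_1\ne0$ and $\|g(\zeta)\|=\|f(\zeta)\|$ a.e. Let $h\in H^2$ be scalar outer with $|h(\zeta)|=\|f(\zeta)\|$ a.e.; let $\vartheta$ be a greatest common inner divisor of the entries of $f_1$ and $\tau$ one of the entries of $\bar z\bar g_1$ (bar = entrywise conjugation). Put $v=v_1\oplus v_2=\bar\vartheta f/h$, $w=w_1\oplus w_2=\bar z\bar\tau\bar g/h$, so $v_1\in H^\infty(\mathbb C^{n_1})$, $w_1\in H^\infty(\mathbb C^{m_1})$, and $u_0=\bar z\bar\vartheta\bar\tau\bar h/h$. Write $v_1=v_{(o)}v_{(i)}$, $w_1=w_{(o)}w_{(i)}$ with $v_{(o)},w_{(o)}$ scalar outer and $v_{(i)},w_{(i)}$ inner columns. Choose inner co-outer $V_c\in H^\infty(M_{n_1,n_1-1})$, $W_c\in H^\infty(M_{m_1,m_1-1})$ such that $(v_{(i)}\ \ \overline{V_c})$ and $(w_{(i)}\ \ \overline{W_c})$ are unitary-valued. $V$ ($n\times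 n$) and $W$ ($m\times m$) are unitary-valued measurable functions of the form $$V=\begin{pmatrix}v_1&\overline{V_c}&\star\\ v_2&0&\star\end{pmatrix},\qquad W^t=\begin{pmatrix}w_1&\overline{W_c}&\star\\ w_2&0&\star\end{pmatrix}.$$ For an optimal solution $Q_0$ of the four block problem for $\Phi$ one has $$\begin{pmatrix}\Phi_{11}-Q_0&\Phi_{12}\\ \Phi_{21}&\Phi_{22}\end{pmatrix}=W^*\begin{pmatrix}t_0u_0&0&0\\ 0&\Phi^{(1)}_{11}&\Phi^{(1)}_{12}\\ 0&\Phi^{(1)}_{21}&\Phi^{(1)}_{22}\end{pmatrix}V^*,$$ and this defines $\Phi^{(1)}$ (the operator $\Gamma_{\Phi^{(1)}}$ does not depend on the choice of $Q_0$). *)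

(* Defs.v *)
From HB Require Import structures.
From mathcomp Require Import all_boot all_order all_algebra.
From mathcomp Require Import all_classical all_reals all_analysis.
From mathcomp Require Import ess_sup_inf complex.

Set Implicit Arguments.
Unset Strict Implicit.
Unset Printing Implicit Defensive.

Import Order.TTheory GRing.Theory Num.Theory.
Local Open Scope classical_set_scope.
Local Open Scope ring_scope.
Local Open Scope sesquilinear_scope.

(* The unit circle is parametrized by t |-> exp(2 i pi t), t in [0, 1]: a
   function on the circle is (a representative of the a.e. class of) a function
   of t : R, only its restriction to [0, 1] being relevant, and normalized
   arc length becomes Lebesgue measure on [0, 1].  Equality of functions on the
   circle is equality [circle R]-almost everywhere. *)
Definition circle (R : realType) : {measure set (measurableTypeR R) -> \bar R} :=
  mrestr (@lebesgue_measure R) (measurable_itv `[0%R, 1%R]).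

Definition zT (R : realType) (t : R) : R[i] :=
  Complex (cos (2 * pi * t)) (sin (2 * pi * t)).

Definition vnorm (R : realType) (n : nat) (x : 'cV[R[i]]_n) : R :=
  Num.sqrt (\sum_i Normc.normc (x i 0) ^+ 2).

Definition mxnorm (R : realType) (k l : nat) (A : 'M[R[i]]_(k, l)) : \bar R :=
  ereal_sup [set (vnorm (A *m x))%:E | x in [set x | vnorm x <= 1]].

Section Spaces.
Variable R : realType.
Local Notation C := R[i].
Local Notation mu := (circle R).

Definition cintegral (f : R -> C) : C :=
  Complex (Rintegral mu setT (fun t => complex.Re (f t)))
          (Rintegral mu setT (fun t => complex.Im (f t))).

Definition fcoef (f : R -> C) (j : int) : C :=
  cintegral (fun t => f t * (zT t) ^ (- j)).

Definition mxmeasurable (k l : nat) (F : R -> 'M[C]_(k, l)) : Prop :=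
  forall i j, measurable_fun [set: measurableTypeR R] (fun t => complex.Re (F t i j))
           /\ measurable_fun [set: measurableTypeR R] (fun t => complex.Im (F t i j)).

Definition norm2 (n : nat) (f : R -> 'cV[C]_n) : \bar R :=
  Lnorm mu 2%:E (fun t => (vnorm (f t))%:E).

Definition norminfty (k l : nat) (F : R -> 'M[C]_(k, l)) : \bar R :=
  ess_sup mu (fun t => mxnorm (F t)).

Definition L2 (n : nat) : set (R -> 'cV[C]_n) :=
  [set f | mxmeasurable f /\ (norm2 f < +oo)%E].

Definition Linfty (k l : nat) : set (R -> 'M[C]_(k, l)) :=
  [set F | mxmeasurable F /\ (norminfty F < +oo)%E].

Definition analytic (k l : nat) (F : R -> 'M[C]_(k, l)) : Prop :=
  forall i j (p : int), p < 0 -> fcoef (fun t => F t i j) p = 0.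

Definition H2 (n : nat) : set (R -> 'cV[C]_n) := [set f | L2 f /\ analytic f].

Definition Hinfty (k l : nat) : set (R -> 'M[C]_(k, l)) :=
  [set F | Linfty F /\ analytic F].

Definition inner2 (n : nat) (f g : R -> 'cV[C]_n) : C :=
  cintegral (fun t => \sum_i f t i 0 * (g t i 0)^*).

Definition H2minus (n : nat) : set (R -> 'cV[C]_n) :=
  [set f | L2 f /\ forall g, H2 g -> inner2 f g = 0].

Definition scal (a : R -> C) : R -> 'M[C]_1 := fun t => (a t)%:M.

Definition is_inner (k l : nat) (F : R -> 'M[C]_(k, l)) : Prop :=
  Hinfty F /\ \forall t \ae mu, (F t) ^t* *m F t = 1%:M.

Definition is_outer (k l : nat) (F : R -> 'M[C]_(k, l)) : Prop :=
  Hinfty F /\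
  forall g : R -> 'cV[C]_k, H2 g -> forall e : R, 0 < e ->
    exists2 f : R -> 'cV[C]_l, H2 f &
      (norm2 (fun t => (g t - F t *m f t)%R) < e%:E)%E.

Definition is_coouter (k l : nat) (F : R -> 'M[C]_(k, l)) : Prop :=
  is_outer (fun t => (F t)^T).

(* A scalar outer function of class H^2 need not be bounded, so that
   multiplication by h need not preserve H^2; outerness is then density in H^2
   of the products of h with the analytic polynomials. *)
Definition is_outerH2 (h : R -> C) : Prop :=
  H2 (scal h) /\
  forall g : R -> 'cV[C]_1, H2 g -> forall e : R, 0 < e ->
    exists p : {poly C},
      (norm2 (fun t => (g t - scal (fun s => h s * p.[zT s]) t)%R) < e%:E)%E.

Definition idivides (theta a : R -> C) : Prop :=
  exists2 b : R -> C, H2 (scal b) & \forall t \ae mu, a t = theta t * b t.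

Definition is_gcid (n : nat) (theta : R -> C) (f : R -> 'cV[C]_n) : Prop :=
  [/\ is_inner (scal theta),
      forall i, idivides theta (fun t => f t i 0) &
      forall phi, is_inner (scal phi) ->
        (forall i, idivides phi (fun t => f t i 0)) -> idivides phi theta].

Definition unitary_valued (n : nat) (F : R -> 'M[C]_n) : Prop :=
  \forall t \ae mu, F t \is unitarymx.

Definition oproj (n : nat) (S : set (R -> 'cV[C]_n)) (f : R -> 'cV[C]_n) :
    R -> 'cV[C]_n :=
  xget (fun=> 0) [set g | S g /\
    forall k, S k -> inner2 (fun t => f t - g t) k = 0].

Definition H2_L2 (n1 n2 : nat) : set (R -> 'cV[C]_(n1 + n2)) :=
  [set f | H2 (fun t => usubmx (f t)) /\ L2 (fun t => dsubmx (f t))].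

Definition H2minus_L2 (m1 m2 : nat) : set (R -> 'cV[C]_(m1 + m2)) :=
  [set g | H2minus (fun t => usubmx (g t)) /\ L2 (fun t => dsubmx (g t))].

Definition Gamma (m1 m2 n1 n2 : nat) (Phi : R -> 'M[C]_(m1 + m2, n1 + n2)) :
    (R -> 'cV[C]_(n1 + n2)) -> (R -> 'cV[C]_(m1 + m2)) :=
  fun f => oproj (@H2minus_L2 m1 m2) (fun t => Phi t *m f t).

Section Operators.
Variables (n m : nat).
Implicit Types (D : set (R -> 'cV[C]_n)) (E : set (R -> 'cV[C]_m))
  (T K : (R -> 'cV[C]_n) -> (R -> 'cV[C]_m)).

Definition opnorm D T : \bar R :=
  ereal_sup [set norm2 (T f) | f in [set f | D f /\ (norm2 f <= 1)%E]].

(* Operators act on representatives; the last clause below forces K to be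
   bounded, hence compatible with a.e. equality. *)
Definition compact_op D E K : Prop :=
  [/\ forall f, D f -> E (K f),
      forall (a : C) f g, D f -> D g ->
        \forall t \ae mu,
          K (fun s => a *: f s + g s) t = a *: K f t + K g t &
      forall f_ : nat -> R -> 'cV[C]_n,
        (forall j, D (f_ j) /\ (norm2 (f_ j) <= 1)%E) ->
        exists s : nat -> nat, exists g,
          [/\ {homo s : i j / (i < j)%N}, E g &
              norm2 (fun t => K (f_ (s j)) t - g t) @[j --> \oo] --> 0%E]].

Definition essnorm D E T : \bar R :=
  ereal_inf [set opnorm D (fun f t => T f t - K f t) | K in compact_op D E].

End Operators.

Section FourBlock.
Variables (m1 m2 n1 n2 : nat).
Implicit Type Phi : R -> 'M[C]_(m1 + m2, n1 + n2).

Definition Gamma_norm Phi : \bar R := opnorm (@H2_L2 n1 n2) (Gamma Phi).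

Definition Gamma_essnorm Phi : \bar R :=
  essnorm (@H2_L2 n1 n2) (@H2minus_L2 m1 m2) (Gamma Phi).

Definition maximizing_vector Phi (f : R -> 'cV[C]_(n1 + n2)) : Prop :=
  [/\ H2_L2 f, ~ (\forall t \ae mu, f t = 0) &
      norm2 (Gamma Phi f) = (Gamma_norm Phi * norm2 f)%E].

Definition four_block_error Phi (Q : R -> 'M[C]_(m1, n1)) :
    R -> 'M[C]_(m1 + m2, n1 + n2) :=
  fun t => block_mx (ulsubmx (Phi t) - Q t) (ursubmx (Phi t))
                    (dlsubmx (Phi t)) (drsubmx (Phi t)).

Definition optimal_solution Phi (Q : R -> 'M[C]_(m1, n1)) : Prop :=
  Hinfty Q /\
  forall Q', Hinfty Q' ->
    (norminfty (four_block_error Phi Q) <= norminfty (four_block_error Phi Q'))%E.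

End FourBlock.

(* [B] has the block form
     x_1  conj X_c  *
     x_2     0      *
   of the matrix functions V and W^t, where x = x_1 (+) x_2.  Its size
   (n1 + 1) + n2 is convertible to 1 + (n1 + n2). *)
Definition completion_form (n1 n2 : nat) (x : R -> 'cV[C]_(n1.+1 + n2))
    (Xc : R -> 'M[C]_(n1.+1, n1)) (B : R -> 'M[C]_(n1.+1 + n2)) : Prop :=
  exists (S1 : R -> 'M[C]_(n1.+1, n2)) (S2 : R -> 'M[C]_n2),
  \forall t \ae mu,
    B t = block_mx (usubmx (x t)) (row_mx (map_mx Num.conj (Xc t)) (S1 t))
                   (dsubmx (x t)) (row_mx 0 (S2 t)) :> 'M[C]_(n1.+1 + n2, 1 + (n1 + n2)).

(* [x = xo xi] is the inner-outer factorization of the column function [x], and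
   the inner and co-outer function [Xc] completes [xi] to the unitary-valued
   function (xi  conj Xc). *)
Definition column_completion (n : nat) (x : R -> 'cV[C]_n.+1) (xo : R -> C)
    (xi : R -> 'cV[C]_n.+1) (Xc : R -> 'M[C]_(n.+1, n)) : Prop :=
  [/\ is_outer (scal xo) /\ is_inner xi,
      \forall t \ae mu, x t = xo t *: xi t,
      is_inner Xc /\ is_coouter Xc &
      unitary_valued (fun t => row_mx (xi t) (map_mx Num.conj (Xc t)) : 'M[C]_n.+1)].

End Spaces.

(* Main.v *)
(* If ||Gamma_Phi||_e < s0 < s < min(||Gamma_Phi1||_e, t0), then Gamma_Phi is
   bounded by s0 on a subspace of finite codimension, while there are arbitrarily
   many orthogonal F_i in the unit ball with orthogonal images of norm > s under
   Gamma_Phi1.  The functions F in (Xc^T xo H^2) (+) L^2, with the second component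
   supported where |xo| is bounded below, are dense, and each of them is the lower
   part of some X = (c + eta) (+) F with V X in H^2 (+) L^2, where eta is an
   arbitrary function in H^2; likewise W^* Y is in H^2_- (+) L^2 for suitable
   Y = conj(z (b + eta')) (+) L with L close to Gamma_Phi1 F.  As u0 H^2 + conj(z H^2)
   is dense in L^2, eta and eta' can be chosen so that Y is close to
   t0 u0 (c + eta) (+) Gamma_Phi1 F, and then the representation of the four block
   error gives <Gamma_Phi V X, W^* Y> ~ ||Y||^2.  A combination of the V X_i in the
   subspace of finite codimension contradicts the bound s0, because s0 < s < t0. *)
Require Import Defs.
From mathcomp Require Import all_boot all_order all_algebra.
From mathcomp Require Import all_classical all_reals all_analysis.
From mathcomp Require Import ess_sup_inf measurable_realfun complex ring lra.

Set Implicit Arguments.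
Unset Strict Implicit.
Unset Printing Implicit Defensive.

Import Order.TTheory GRing.Theory Num.Theory.
Import numFieldNormedType.Exports.
Local Open Scope classical_set_scope.
Local Open Scope ring_scope.

(** No bound is available for the first coordinate c + eta of the lifted vector X, because eta comes
    from a density statement. None is needed: this coordinate is only multiplied by t0 u0 with u0
    unimodular, and s < t0. If F has norm at most 1 and Gamma_Phi1 F has norm at least s, then t0^2
    |c + eta|^2 + |Gamma_Phi1 F|^2 is at least s^2 (|c + eta|^2 + 1), hence at least s^2 |X|^2,
    however large c + eta is. The error in the pairing is harmless for the same reason: it is a
    small multiple of the norm of Y.

    The lifts are approximate because 1/xo may be unbounded and because the Toeplitz operator with
    symbol u0 is only known to have dense range. Their errors must therefore be small compared with
    the number of the F_i, which is fixed beforehand as one more than the number of linear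
    conditions. Those conditions concern the V X_i, so the combination is selected only after the
    lifting; the bound s must hold for every normalized combination of the F_i, and this is what the
    orthogonality of the images provides. *)

Section ComplexModulus.
Variable R : realType.
Local Notation C := R[i].
Implicit Types a b z : C.

Lemma normcE2 z : Normc.normc z ^+ 2 = complex.Re z ^+ 2 + complex.Im z ^+ 2.
Proof. by case: z => a b /=; rewrite sqr_sqrtr // addr_ge0 ?sqr_ge0. Qed.

Lemma normc_ge0 z : 0 <= Normc.normc z.
Proof. by case: z => a b; exact: sqrtr_ge0. Qed.

Lemma mulcconj z : z * z^* = ((Normc.normc z ^+ 2)%:C)%C.
Proof.
rewrite normcE2; case: z => a b; apply/eqP; rewrite eq_complex /=.
by apply/andP; split; apply/eqP; ring.
Qed.

Lemma normc_conj z : Normc.normc z^* = Normc.normc z.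
Proof. by case: z => a b /=; rewrite sqrrN. Qed.

Lemma Re_le_normc z : `|complex.Re z| <= Normc.normc z.
Proof.
rewrite -ler_sqr ?nnegrE ?normc_ge0 ?normr_ge0 // normcE2 real_normK ?num_real //.
by rewrite lerDl sqr_ge0.
Qed.

Lemma Im_le_normc z : `|complex.Im z| <= Normc.normc z.
Proof.
rewrite -ler_sqr ?nnegrE ?normc_ge0 ?normr_ge0 // normcE2 real_normK ?num_real //.
by rewrite lerDr sqr_ge0.
Qed.

Lemma normc_le_ReIm z :
  Normc.normc z <= `|complex.Re z| + `|complex.Im z|.
Proof.
rewrite -ler_sqr ?nnegrE ?normc_ge0 ?addr_ge0 ?normr_ge0 // normcE2 sqrrD.
rewrite !real_normK ?num_real // addrAC lerDl.
by rewrite mulrn_wge0 // mulr_ge0 ?normr_ge0.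
Qed.

Lemma cReD a b : complex.Re (a + b) = complex.Re a + complex.Re b.
Proof. by case: a; case: b. Qed.
Lemma cImD a b : complex.Im (a + b) = complex.Im a + complex.Im b.
Proof. by case: a; case: b. Qed.
Lemma cReN a : complex.Re (- a) = - complex.Re a.
Proof. by case: a. Qed.
Lemma cImN a : complex.Im (- a) = - complex.Im a.
Proof. by case: a. Qed.
Lemma cReM a b : complex.Re (a * b) =
  complex.Re a * complex.Re b - complex.Im a * complex.Im b.
Proof. by case: a; case: b. Qed.
Lemma cImM a b : complex.Im (a * b) =
  complex.Re a * complex.Im b + complex.Im a * complex.Re b.
Proof. by case: a => x y; case: b => u v /=; rewrite [y * u]mulrC. Qed.
Lemma cReconj a : complex.Re a^* = complex.Re a.
Proof. by case: a. Qed.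
Lemma cImconj a : complex.Im a^* = - complex.Im a.
Proof. by case: a. Qed.

Lemma complex_ext a b :
  complex.Re a = complex.Re b -> complex.Im a = complex.Im b -> a = b.
Proof. by case: a => ? ?; case: b => ? ? /= -> ->. Qed.

End ComplexModulus.

(** * Semi-inner product spaces *)

(** Only semidefinite, and only on a subset [S] of the space: functions are representatives, so the
    ambient space consists of all functions, [S] of the square-integrable ones, and a nonzero
    function that vanishes almost everywhere has norm 0. *)
Record semi_ip (R : realType) (V : lmodType R[i]) (S : V -> Prop)
    (ip : V -> V -> R[i]) : Prop := SemiIp {
  sip0 : S 0;
  sipP : forall a x y, S x -> S y -> S (a *: x + y);
  sip_lin : forall a x y z, S x -> S y -> S z ->
    ip (a *: x + y) z = a * ip x z + ip y z;
  sipC : forall x y, S x -> S y -> ip y x = (ip x y)^*;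
  sip_ge0 : forall x, S x -> 0 <= complex.Re (ip x x) }.

Section SemiInner.
Variables (R : realType) (V : lmodType R[i]) (S : V -> Prop) (ip : V -> V -> R[i]).
Hypothesis H : semi_ip S ip.
Local Notation C := R[i].
Local Notation normc := (@Normc.normc R).

Definition sqn (x : V) : R := complex.Re (ip x x).
Definition nrm (x : V) : R := Num.sqrt (sqn x).

Lemma sipD x y : S x -> S y -> S (x + y).
Proof. by move=> Sx Sy; rewrite -[x]scale1r; apply: (sipP H). Qed.
Lemma sipZ a x : S x -> S (a *: x).
Proof. by move=> Sx; rewrite -[X in S X]addr0; apply: (sipP H) => //; exact: (sip0 H). Qed.
Lemma sipN x : S x -> S (- x).
Proof. by rewrite -scaleN1r; apply: sipZ. Qed.
Lemma sipB x y : S x -> S y -> S (x - y).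
Proof. by move=> Sx Sy; apply/sipD/sipN. Qed.
Lemma sip_sum (I : Type) (r : seq I) (P : pred I) (F : I -> V) :
  (forall i, P i -> S (F i)) -> S (\sum_(i <- r | P i) F i).
Proof. by move=> SF; apply: big_ind => //; [exact: (sip0 H) | exact: sipD]. Qed.

Lemma ip0l z : S z -> ip 0 z = 0.
Proof.
move=> Sz; have := sip_lin H 1 (sip0 H) (sip0 H) Sz.
by rewrite scale1r addr0 mul1r => /eqP; rewrite -subr_eq subrr => /eqP <-.
Qed.
Lemma ipDl x y z : S x -> S y -> S z -> ip (x + y) z = ip x z + ip y z.
Proof. by move=> Sx Sy Sz; rewrite -{1}[x]scale1r (sip_lin H) // mul1r. Qed.
Lemma ipZl a x z : S x -> S z -> ip (a *: x) z = a * ip x z.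
Proof. by move=> Sx Sz; rewrite -[X in ip X]addr0 (sip_lin H) ?ip0l ?addr0//; apply: (sip0 H). Qed.
Lemma ipNl x z : S x -> S z -> ip (- x) z = - ip x z.
Proof. by move=> Sx Sz; rewrite -scaleN1r ipZl // mulN1r. Qed.
Lemma ipBl x y z : S x -> S y -> S z -> ip (x - y) z = ip x z - ip y z.
Proof. by move=> Sx Sy Sz; rewrite ipDl ?ipNl//; apply: sipN. Qed.
Lemma ipDr x y z : S x -> S y -> S z -> ip z (x + y) = ip z x + ip z y.
Proof.
move=> Sx Sy Sz; rewrite (sipC H) ?ipDl ?rmorphD //; last exact: sipD.
by rewrite (sipC H Sx Sz) (sipC H Sy Sz).
Qed.
Lemma ipZr a x z : S x -> S z -> ip z (a *: x) = a^* * ip z x.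
Proof.
move=> Sx Sz; rewrite (sipC H) ?ipZl ?rmorphM //; last exact: sipZ.
by rewrite (sipC H Sx Sz).
Qed.
Lemma ipNr x z : S x -> S z -> ip z (- x) = - ip z x.
Proof. by move=> Sx Sz; rewrite -scaleN1r ipZr // rmorphN1 mulN1r. Qed.
Lemma ipBr x y z : S x -> S y -> S z -> ip z (x - y) = ip z x - ip z y.
Proof. by move=> Sx Sy Sz; rewrite ipDr ?ipNr//; apply: sipN. Qed.
Lemma ip_suml (I : Type) (r : seq I) (P : pred I) (F : I -> V) z :
  (forall i, P i -> S (F i)) -> S z ->
  ip (\sum_(i <- r | P i) F i) z = \sum_(i <- r | P i) ip (F i) z.
Proof.
move=> SF Sz.
suff [_ //] : S (\sum_(i <- r | P i) F i) /\
  ip (\sum_(i <- r | P i) F i) z = \sum_(i <- r | P i) ip (F i) z.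
elim/big_rec2: _ => [|i y1 y2 Pi [Sy IH]].
  by split; [exact: (sip0 H)|exact: ip0l].
by split; [apply: sipD => //; exact: SF|rewrite ipDl ?IH//; exact: SF].
Qed.

Lemma sqn_ge0 x : S x -> 0 <= sqn x. Proof. exact: (sip_ge0 H). Qed.

Lemma ipxx x : S x -> ip x x = ((sqn x)%:C)%C.
Proof.
move=> Sx; apply: complex_ext => //=.
have := sipC H Sx Sx; move/(congr1 (@complex.Im R)); rewrite cImconj => h.
lra.
Qed.

Lemma sqn0 : sqn 0 = 0.
Proof. by rewrite /sqn ip0l //; apply: (sip0 H). Qed.

Lemma sqnZ a x : S x -> sqn (a *: x) = normc a ^+ 2 * sqn x.
Proof.
move=> Sx; rewrite /sqn ipZl ?ipZr ?mulrA ?mulcconj ?ipxx //; last exact: sipZ.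
by rewrite cReM /= mul0r subr0.
Qed.

Lemma sqnN x : S x -> sqn (- x) = sqn x.
Proof. by move=> Sx; rewrite /sqn ipNl ?ipNr ?opprK //; apply: sipN. Qed.

Lemma sqnD x y : S x -> S y ->
  sqn (x + y) = sqn x + sqn y + 2 * complex.Re (ip x y).
Proof.
move=> Sx Sy; rewrite /sqn ipDl ?ipDr ?cReD //; last exact: sipD.
rewrite [ip y x](sipC H) // cReconj; ring.
Qed.

Lemma sqnB x y : S x -> S y ->
  sqn (x - y) = sqn x + sqn y - 2 * complex.Re (ip x y).
Proof.
move=> Sx Sy; rewrite sqnD ?ipNr ?cReN ?sqnN //; last exact: sipN.
by rewrite mulrN.
Qed.

Lemma CS2 x y : S x -> S y -> normc (ip x y) ^+ 2 <= sqn x * sqn y.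
Proof.
move=> Sx Sy; set c := normc _ ^+ 2.
have c0 : 0 <= c by apply: sqr_ge0.
have Nx := sqn_ge0 Sx; have Ny := sqn_ge0 Sy.
(* This is the square of the norm of x - t <x, y> y, for real t. *)
have key (t : R) : 0 <= sqn x + t ^+ 2 * c * sqn y - 2 * (t * c).
  have := sqn_ge0 (sipB Sx (sipZ (t%:C%C * ip x y) Sy)).
  rewrite sqnB ?sqnZ ?ipZr //; last exact: sipZ.
  rewrite rmorphM /= -mulrA [(ip x y)^* * _]mulrC mulcconj -/c.
  rewrite Normc.normcM exprMn -/c.
  have -> : normc (t%:C)%C ^+ 2 = t ^+ 2 by rewrite normcE2 /= expr0n addr0.
  by rewrite cReM /= oppr0 mul0r subr0.
have [Ny0|Ny0] := eqVneq (sqn y) 0.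
  rewrite Ny0 mulr0; have [->//|cn0] := eqVneq c 0.
  (* For a null y the inequality is linear in t, and this t makes its right side equal to -1. *)
  have := key ((sqn x + 1) / (2 * c)); rewrite Ny0 mulr0 addr0.
  have -> : 2 * ((sqn x + 1) / (2 * c) * c) = sqn x + 1 by field.
  by lra.
(* The minimizing value of t. *)
have := key (sqn y)^-1.
have -> : sqn x + (sqn y)^-1 ^+ 2 * c * sqn y - 2 * ((sqn y)^-1 * c) =
  sqn x - c / sqn y by field.
by rewrite subr_ge0 ler_pdivrMr // lt_neqAle eq_sym Ny0.
Qed.

Lemma nrm_ge0 x : 0 <= nrm x. Proof. exact: sqrtr_ge0. Qed.
Lemma nrmK x : S x -> nrm x ^+ 2 = sqn x.
Proof. by move=> Sx; rewrite sqr_sqrtr // sqn_ge0. Qed.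

Lemma CS x y : S x -> S y -> normc (ip x y) <= nrm x * nrm y.
Proof.
move=> Sx Sy; rewrite -ler_sqr ?nnegrE ?normc_ge0 ?mulr_ge0 ?nrm_ge0 //.
by rewrite exprMn !nrmK //; apply: CS2.
Qed.

Lemma nrmZ a x : S x -> nrm (a *: x) = normc a * nrm x.
Proof.
move=> Sx; rewrite /nrm sqnZ // sqrtrM ?sqr_ge0 // sqrtr_sqr ger0_norm //.
exact: normc_ge0.
Qed.
Lemma nrmN x : S x -> nrm (- x) = nrm x.
Proof. by move=> Sx; rewrite /nrm sqnN. Qed.
Lemma nrm0 : nrm 0 = 0. Proof. by rewrite /nrm sqn0 sqrtr0. Qed.

Lemma nrmD x y : S x -> S y -> nrm (x + y) <= nrm x + nrm y.
Proof.
move=> Sx Sy; rewrite -ler_sqr ?nnegrE ?addr_ge0 ?nrm_ge0 //.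
rewrite nrmK ?sqnD ?sqrrD ?nrmK //; last exact: sipD.
have := le_trans (le_trans (ler_norm _) (Re_le_normc _)) (CS Sx Sy).
by rewrite -[_ *+ 2]mulr_natl; lra.
Qed.

Lemma nrmB x y : S x -> S y -> nrm (x - y) <= nrm x + nrm y.
Proof. by move=> Sx Sy; rewrite -[nrm y]nrmN //; apply/nrmD/sipN. Qed.
Lemma nrm_distC x y : S x -> S y -> nrm (x - y) = nrm (y - x).
Proof. by move=> Sx Sy; rewrite -nrmN ?opprB //; apply: sipB. Qed.
Lemma nrm_triB x y z : S x -> S y -> S z -> nrm (x - z) <= nrm (x - y) + nrm (y - z).
Proof.
move=> Sx Sy Sz; apply: le_trans (nrmD _ _); rewrite ?addrA ?subrK //; exact: sipB.
Qed.
Lemma nrm_lB x y : S x -> S y -> nrm x <= nrm y + nrm (x - y).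
Proof. by move=> Sx Sy; apply: le_trans (nrmD _ _); rewrite ?subrKC //; apply: sipB. Qed.

Lemma nrm_sum (I : finType) (F : I -> V) : (forall i, S (F i)) ->
  nrm (\sum_i F i) <= \sum_i nrm (F i).
Proof.
move=> SF; suff [_ //] : S (\sum_i F i) /\ nrm (\sum_i F i) <= \sum_i nrm (F i).
elim/big_rec2: _ => [|i y1 y2 _ [Sy IH]]; first by split; [exact: (sip0 H)|rewrite nrm0].
by split; [exact: sipD|apply: le_trans (nrmD _ _) _ => //; rewrite lerD2l].
Qed.

Lemma ip_eq0 x y : S x -> S y -> sqn y = 0 -> ip x y = 0.
Proof.
move=> Sx Sy y0; apply: Normc.eq0_normc; apply/eqP.
by rewrite -sqrf_eq0 eq_le sqr_ge0 andbT; have := CS2 Sx Sy; rewrite y0 mulr0.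
Qed.

Lemma sqn_sum_orth m (F : 'I_m -> V) : (forall i, S (F i)) ->
  (forall i j, i != j -> ip (F i) (F j) = 0) ->
  forall c : 'I_m -> C,
  sqn (\sum_i c i *: F i) = \sum_i normc (c i) ^+ 2 * sqn (F i).
Proof.
move=> SF oF c; have ScF i : S (c i *: F i) by apply: sipZ.
rewrite {1}/sqn ip_suml //; last exact: sip_sum.
rewrite (@big_morph _ _ _ 0 _ 0 _ (@cReD R)) //; apply: eq_bigr => i _.
rewrite (sipC H) //; last exact: sip_sum.
rewrite ip_suml // (bigD1 i) //= big1 => [|j ji]; last first.
  by rewrite ipZl ?ipZr ?oF ?mulr0 //.
by rewrite addr0 -(sipC H) // -/(sqn _) sqnZ.
Qed.

Lemma quarter_pow_small (e : R) : 0 < e ->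
  exists K : nat, forall k, (K <= k)%N -> 4^-1 ^+ k <= e.
Proof.
move=> e0; have /cvgrPdist_le /(_ e e0) [K _ hK] : (fun k => 4^-1 ^+ k : R) @ \oo --> (0 : R).
  by apply: cvg_expr; rewrite ger0_norm ?invr_ge0 // invf_lt1 // ltr1n.
exists K => k /hK /=; rewrite sub0r normrN; apply: le_trans; exact: ler_norm.
Qed.

(* The projection theorem asks for completeness only along sequences that
   converge geometrically. *)
Definition fast_complete (P : V -> Prop) :=
  forall x_ : nat -> V, (forall k, P (x_ k)) ->
    (forall k, sqn (x_ k.+1 - x_ k) <= 4^-1 ^+ k) ->
    exists2 l, P l & forall e, 0 < e ->
      exists K : nat, forall k, (K <= k)%N -> nrm (x_ k - l) < e.

Lemma projection (P : V -> Prop) x :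
  (forall y, P y -> S y) -> P 0 ->
  (forall a y z, P y -> P z -> P (a *: y + z)) -> fast_complete P -> S x ->
  exists2 y, P y & forall z, P z -> ip (x - y) z = 0.
Proof.
move=> PS P0 PL cP Sx.
pose D := [set nrm (x - y) | y in [set y | P y]].
have D0 : D !=set0 by exists (nrm (x - 0)); exists 0.
have Dlb : has_lbound D by exists 0 => _ [y _ <-]; exact: nrm_ge0.
pose d := inf D.
have dle y : P y -> d <= nrm (x - y) by move=> Py; apply: ge_inf => //; exists y.
have d0 : 0 <= d by apply: lb_le_inf => // _ [y _ <-]; exact: nrm_ge0.
have ex (e : R) : 0 < e -> exists y, P y /\ sqn (x - y) < d ^+ 2 + e.
  move=> e0; have : d < Num.sqrt (d ^+ 2 + e).
    by rewrite -[X in X < _]ger0_norm // -sqrtr_sqr ltr_sqrt ?ltrDl //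
       (lt_le_trans e0) // lerDr sqr_ge0.
  case/inf_lt => // _ [y Py <-]; rewrite /nrm ltr_sqrt ?(lt_le_trans e0) ?lerDr ?sqr_ge0 //.
  by exists y.
(* With excess 4^-(k+1) over the squared distance, the parallelogram law bounds the squared norm of
   x_(k+1) - x_k by (5/8) 4^-k, which is what [fast_complete] asks for. *)
pose dl (k : nat) : R := 4^-1 * 4^-1 ^+ k.
have dl0 k : 0 < dl k by rewrite mulr_gt0 ?exprn_gt0 ?invr_gt0 ?ltr0n.
pose x_ k := projT1 (cid (ex (dl k) (dl0 k))).
have Px k : P (x_ k) by rewrite /x_; case: cid => y [].
have xd k : sqn (x - x_ k) < d ^+ 2 + dl k by rewrite /x_; case: cid => y [].
have Sx_ k : S (x_ k) := PS _ (Px k).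
have par y z : P y -> P z ->
    sqn (y - z) <= 2 * sqn (x - y) + 2 * sqn (x - z) - 4 * d ^+ 2.
  move=> Py Pz; have Sy := PS _ Py; have Sz := PS _ Pz.
  have Pm : P (2^-1 *: y + 2^-1 *: z).
    by apply: (PL) => //; rewrite -[_ *: z]addr0; apply: PL.
  have Sm := PS _ Pm.
  have Sxy := sipB Sx Sy; have Sxz := sipB Sx Sz.
  have -> : y - z = (x - z) - (x - y) by rewrite opprB [RHS]addrC addrA subrK.
  have E1 := sqnB Sxz Sxy; have E2 := sqnD Sxz Sxy.
  have E3 : (x - z) + (x - y) = 2 *: (x - (2^-1 *: y + 2^-1 *: z)).
    rewrite scalerBr scalerDr !scalerA mulfV ?pnatr_eq0 // !scale1r.
    by rewrite scaler_nat mulr2n opprD addrACA [- z - y]addrC.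
  rewrite E3 sqnZ in E2; last exact: sipB.
  have n2 : normc (2 : C) ^+ 2 = 4.
    by rewrite normcE2 /= addr0 expr0n addr0; ring.
  have := dle _ Pm; rewrite -ler_sqr ?nnegrE ?nrm_ge0 // nrmK; last exact: sipB.
  move: E1 E2; rewrite n2 => -> ; set q := sqn _ => E2 h; lra.
have [k|l Pl xl] := cP x_ Px.
  have := par _ _ (Px k.+1) (Px k); have := xd k; have := xd k.+1.
  have -> : dl k.+1 = 4^-1 * dl k by rewrite /dl exprS.
  have -> : dl k = 4^-1 * 4^-1 ^+ k by [].
  have : 0 < 4^-1 ^+ k :> R by rewrite exprn_gt0 // invr_gt0 ltr0n.
  by move: (4^-1 ^+ k) => u; set w1 := sqn _; set w2 := sqn _; set w3 := sqn _; lra.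
have Sl := PS _ Pl.
have xld : nrm (x - l) <= d.
  apply/ler_addgt0Pr => e e0; pose e2 := e / 2.
  have e20 : 0 < e2 by rewrite divr_gt0.
  have [K1 hK1] := xl _ e20.
  have [K2 hK2] := quarter_pow_small (exprn_gt0 2 e20).
  pose k := maxn K1 K2.
  apply: le_trans (nrm_triB Sx (Sx_ k) Sl) _.
  have h1 : nrm (x_ k - l) < e2 by apply: hK1; exact: leq_maxl.
  have h2 : nrm (x - x_ k) <= d + e2.
    rewrite -ler_sqr ?nnegrE ?nrm_ge0 ?addr_ge0 ?(ltW e20) // nrmK; last exact: sipB.
    apply: le_trans (ltW (xd k)) _; rewrite sqrrD -addrA lerD2l.
    apply: le_trans (_ : e2 ^+ 2 <= _); last first.
      by rewrite lerDr mulrn_wge0 // mulr_ge0 // ltW.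
    apply: le_trans (hK2 k (leq_maxr _ _)).
    rewrite ler_piMl ?exprn_ge0 ?invr_ge0 ?ler0n // invf_le1 ?ler1n ?ltr0n //.
  have := ltW h1; rewrite /e2 in h2 *; lra.
have xlE : sqn (x - l) <= d ^+ 2.
  by rewrite -nrmK ?ler_sqr ?nnegrE ?nrm_ge0 //; exact: sipB.
exists l => // z Pz; have Sz := PS _ Pz; have Sxl := sipB Sx Sl.
set c := ip _ _; apply: Normc.eq0_normc; apply/eqP; rewrite -sqrf_eq0.
have Nz := sqn_ge0 Sz.
(* Comparing l with the competitor l + t c z gives 2 t |c|^2 <= t^2 |c|^2 |z|^2. Since t |z|^2 <= 1,
   this forces c = 0; the summand 1 keeps t defined for a null z. *)
pose t := (sqn z + 1)^-1.
have := dle _ (PL (t%:C%C * c) _ _ Pz Pl).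
rewrite -ler_sqr ?nnegrE ?nrm_ge0 // nrmK; last first.
  by apply: sipB => //; apply: (sipP H).
have -> : x - ((t%:C)%C * c *: z + l) = (x - l) - ((t%:C)%C * c) *: z.
  by rewrite opprD addrA addrAC.
rewrite sqnB ?sqnZ ?ipZr //; last exact: sipZ.
rewrite -/c rmorphM /= -mulrA [c^* * _]mulrC mulcconj Normc.normcM exprMn.
have -> : normc (t%:C)%C ^+ 2 = t ^+ 2 by rewrite normcE2 /= expr0n addr0.
rewrite cReM /= oppr0 mul0r subr0; set q := normc c ^+ 2 => h.
have q0 : 0 <= q by apply: sqr_ge0.
have t0 : 0 < t by rewrite invr_gt0 ltr_wpDl.
have tz : t * sqn z <= 1.
  by rewrite mulrC ler_pdivrMr ?mul1r ?ler_wpDr // ltr_wpDl.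
have hh : t * q * (t * sqn z) <= t * q * 1 by rewrite ler_wpM2l // mulr_ge0 // ltW.
have : t * q <= 0 by lra.
by rewrite pmulr_rle0 // => q1; rewrite eq_le q1.
Qed.

Fixpoint orthonormal (e : seq V) : Prop :=
  if e is a :: e' then
    [/\ S a, sqn a = 1, (forall b, b \in e' -> ip a b = 0) & orthonormal e']
  else True.

Definition fproj (e : seq V) (x : V) : V := \sum_(a <- e) ip x a *: a.

Lemma orthonormalS e : orthonormal e -> forall a, a \in e -> S a.
Proof.
elim: e => // a e IH /= [Sa _ _ oe] b; rewrite inE => /predU1P[->//|]; exact: IH.
Qed.

Lemma fprojS e x : orthonormal e -> S x -> S (fproj e x).
Proof.
move=> oe Sx; rewrite /fproj big_seq; apply: sip_sum => a ae.
by apply: sipZ; apply: orthonormalS ae.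
Qed.

Lemma fproj_orth e x : orthonormal e -> S x -> forall a, a \in e ->
  ip (x - fproj e x) a = 0.
Proof.
elim: e x => // b e IH x obe Sx a; have /= [Sb b1 be oe] := obe.
have Sfx := fprojS oe Sx.
rewrite /fproj big_cons -/(fproj e x) inE => /predU1P[->|ae].
  rewrite ipBl //; last by apply: sipD => //; apply: sipZ.
  rewrite ipDl ?ipZl ?ipxx // ?b1 ?mulr1; last exact: sipZ.
  suff -> : ip (fproj e x) b = 0 by rewrite addr0 subrr.
  rewrite /fproj big_seq ip_suml //; last first.
    by move=> a' ae; apply: sipZ; apply: orthonormalS ae.
  apply: big1 => c ce; have Sc := orthonormalS oe ce.
  by rewrite ipZl // (sipC H Sb Sc) // be // rmorph0 mulr0.
have Sa := orthonormalS oe ae.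
rewrite opprD addrA addrAC ipBl //; last first.
- by apply: sipZ.
- exact: sipB.
by rewrite IH // ipZl // be // mulr0 subrr.
Qed.

Lemma fproj_orth2 e x y : orthonormal e -> S x -> S y ->
  (forall a, a \in e -> ip y a = 0) -> ip y (fproj e x) = 0.
Proof.
move=> oe Sx Sy ye; rewrite (sipC H) //; last exact: fprojS.
rewrite /fproj big_seq ip_suml //; last first.
  by move=> a ae; apply: sipZ; apply: orthonormalS ae.
rewrite big1 ?rmorph0 // => a ae; have Sa := orthonormalS oe ae.
by rewrite ipZl // (sipC H Sy Sa) // ye // rmorph0 mulr0.
Qed.

Lemma sqn_fprojB e x : orthonormal e -> S x -> sqn (x - fproj e x) <= sqn x.
Proof.
move=> oe Sx; have Sf := fprojS oe Sx; have Sd := sipB Sx Sf.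
rewrite -[in X in _ <= X](subrK (fproj e x) x) [X in _ <= X]sqnD //.
rewrite fproj_orth2 //; last exact: fproj_orth.
by rewrite mulr0 addr0 lerDl sqn_ge0.
Qed.

(** [Y] may be linearly dependent or contain null vectors, so no statement about spans is made; what
    survives is that orthogonality to [e] implies orthogonality to [Y]. *)
Lemma gram_schmidt (P : V -> Prop) (Y : seq V) :
  (forall y, P y -> S y) -> P 0 ->
  (forall a y z, P y -> P z -> P (a *: y + z)) ->
  (forall y, y \in Y -> P y) ->
  exists e : seq V, [/\ orthonormal e, (forall a, a \in e -> P a) &
   forall x, S x -> (forall a, a \in e -> ip x a = 0) -> forall y, y \in Y -> ip x y = 0].
Proof.
move=> PS P0 PL; elim: Y => [_|y Y IH PY]; first by exists [::].
have [e [oe Pe eY]] : exists e : seq V, [/\ orthonormal e, (forall a, a \in e -> P a) &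
   forall x, S x -> (forall a, a \in e -> ip x a = 0) -> forall y, y \in Y -> ip x y = 0].
  by apply: IH => z zY; apply: PY; rewrite inE zY orbT.
have Py : P y by apply: PY; rewrite mem_head.
have PZ a z : P z -> P (a *: z) by move=> Pz; rewrite -[_ *: _]addr0; apply: PL.
have PD u z : P u -> P z -> P (u + z) by rewrite -{2}[u]scale1r; apply: PL.
have Pf : P (fproj e y).
  by rewrite /fproj big_seq; apply: big_ind => // a /Pe; apply: PZ.
have Pd : P (y - fproj e y) by rewrite -scaleN1r; apply/PD/PZ.
have Sy := PS _ Py; have Sf := PS _ Pf; have Sd := PS _ Pd.
have yE x : S x -> (forall a, a \in e -> ip x a = 0) -> ip x y = ip x (y - fproj e y).
  by move=> Sx xe; rewrite ipBr // fproj_orth2 // subr0.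
(* A null residual adds no vector to [e]: it is orthogonal to everything by Cauchy-Schwarz. *)
have [d0|d0] := eqVneq (sqn (y - fproj e y)) 0.
  exists e; split=> // x Sx xe z; rewrite inE => /predU1P[->|]; last exact: eY.
  by rewrite yE // ip_eq0.
have dp : 0 < nrm (y - fproj e y) by rewrite sqrtr_gt0 lt_neqAle eq_sym d0 sqn_ge0.
pose b := (((nrm (y - fproj e y))^-1)%:C)%C *: (y - fproj e y).
have Sb : S b by apply: sipZ.
exists (b :: e); split=> /=.
- split=> // [|a ae].
    rewrite sqnZ // -nrmK // normcE2 /= expr0n addr0 -exprMn mulVf ?expr1n //.
    by rewrite gt_eqF.
  by rewrite ipZl ?fproj_orth ?mulr0 //; apply: orthonormalS ae.
- by move=> a; rewrite inE => /predU1P[->|/Pe//]; apply: PZ.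
- move=> x Sx xe z.
  have xe' a : a \in e -> ip x a = 0 by move=> ae; apply: xe; rewrite inE ae orbT.
  rewrite inE => /predU1P[->|]; last exact: eY.
  rewrite yE //; have := xe b (mem_head _ _).
  rewrite ipZr // => /eqP; rewrite mulf_eq0 => /orP[|/eqP//].
  rewrite conjC_eq0 => /eqP [] /eqP; rewrite invr_eq0 => /eqP h.
  by rewrite h ltxx in dp.
Qed.

End SemiInner.

(** Each term is chosen from the list of all earlier ones. Only membership in that list is recorded,
    which suffices for conditions such as orthogonality to every earlier term. *)
Lemma dependent_choice_seq (T : eqType) (P : seq T -> T -> Prop) :
  (forall l, exists x, P l x) ->
  exists x_ : nat -> T, forall k, exists2 l : seq T,
    (forall y, y \in l <-> exists2 i, (i < k)%N & y = x_ i) & P l (x_ k).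
Proof.
move=> ex; pose c l := projT1 (cid (ex l)).
have cP l : P l (c l) by rewrite /c; case: cid.
pose L := fix L k := if k is k'.+1 then rcons (L k') (c (L k')) else [::].
have LE k : L k = [seq c (L i) | i <- iota 0 k].
  by elim: k => // k IH; rewrite -[k.+1]addn1 iotaD map_cat /= -IH cats1 addn1 /= add0n.
exists (fun k => c (L k)) => k; exists (L k); last exact: cP.
move=> y; rewrite LE; split=> [h|[i ik ->]].
  by have [j] := elimT mapP h; rewrite mem_iota => /andP[_ jk] ->; exists j.
by apply: map_f; rewrite mem_iota.
Qed.

(** * Integration on the circle *)

#[global] Instance circle_ae_filter (R : realType) :
  Filter (nbhs (almost_everywhere (circle R))).
Proof. exact: ae_filter_ringOfSetsType. Qed.

Section CircleIntegral.
Variable R : realType.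
Local Notation mu := (circle R).
Local Notation TR := (measurableTypeR R).
Local Notation meas := (measurable_fun [set: TR]).
Implicit Types (u v : TR -> R).

Definition rint u := mu.-integrable setT (EFin \o u).
Local Notation I := (Rintegral mu setT).

Lemma circle_setT : mu setT = 1%E.
Proof.
rewrite /circle /= /mrestr /= setTI lebesgue_measure_itv /= lte_fin ltr01.
by rewrite oppr0 adde0.
Qed.

Lemma rint_meas u : rint u -> meas u.
Proof. by move=> /measurable_int/measurable_EFinP. Qed.

Lemma rint_cst (c : R) : rint (fun=> c).
Proof.
apply/integrableP; split; first exact/measurable_EFinP.
by rewrite /= integral_cst // circle_setT mule1 ltry.
Qed.

Lemma rint_le u v : meas u -> rint v -> (forall t, `|u t| <= `|v t|) -> rint u.
Proof.
move=> mu_ iv uv; apply: (le_integrable measurableT _ _ iv).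
  exact/measurable_EFinP.
by move=> t _; rewrite /= lee_fin uv.
Qed.

Lemma rintD u v : rint u -> rint v -> rint (fun t => u t + v t).
Proof. exact: integrableD. Qed.
Lemma rintZ (c : R) u : rint u -> rint (fun t => c * u t).
Proof. exact: (integrableZl measurableT). Qed.
Lemma rintN u : rint u -> rint (fun t => - u t).
Proof. by under [X in _ -> rint X]eq_fun do rewrite -mulN1r; apply: rintZ. Qed.
Lemma rintB u v : rint u -> rint v -> rint (fun t => u t - v t).
Proof. by move=> iu iv; apply: rintD (rintN iv). Qed.
Lemma rint_norm u : rint u -> rint (fun t => `|u t|).
Proof. exact: integrable_norm. Qed.
Lemma rint_sum (J : Type) (r : seq J) (F : J -> TR -> R) :
  (forall j, rint (F j)) -> rint (fun t => \sum_(j <- r) F j t).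
Proof.
move=> iF; elim: r => [|j r IH].
  by under eq_fun do rewrite big_nil; exact: rint_cst.
by under eq_fun do rewrite big_cons; exact: rintD.
Qed.

Lemma rI_cst (c : R) : I (fun=> c) = c.
Proof. by rewrite Rintegral_cst // circle_setT mulr1. Qed.
Lemma rI_D u v : rint u -> rint v -> I (fun t => u t + v t) = I u + I v.
Proof. exact: RintegralD. Qed.
Lemma rI_Z (c : R) u : rint u -> I (fun t => c * u t) = c * I u.
Proof. exact: RintegralZl. Qed.
Lemma rI_N u : rint u -> I (fun t => - u t) = - I u.
Proof.
move=> iu; rewrite -mulN1r -rI_Z //; apply: eq_Rintegral => t _.
by rewrite mulN1r.
Qed.
Lemma rI_B u v : rint u -> rint v -> I (fun t => u t - v t) = I u - I v.
Proof. exact: RintegralB. Qed.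
Lemma rI_sum (J : Type) (r : seq J) (F : J -> TR -> R) :
  (forall j, rint (F j)) -> I (fun t => \sum_(j <- r) F j t) = \sum_(j <- r) I (F j).
Proof.
move=> iF; elim: r => [|j r IH].
  by under eq_Rintegral do rewrite big_nil; rewrite rI_cst big_nil.
under eq_Rintegral do rewrite big_cons.
by rewrite rI_D ?big_cons ?IH //; exact: rint_sum.
Qed.
Lemma rI_ge0 u : (forall t, 0 <= u t) -> 0 <= I u.
Proof. by move=> u0; apply: Rintegral_ge0. Qed.
Lemma rI_le u v : rint u -> rint v -> (forall t, u t <= v t) -> I u <= I v.
Proof. by move=> iu iv uv; apply: le_Rintegral. Qed.
Lemma EFin_rI u : rint u -> (I u)%:E = (\int[mu]_t (u t)%:E)%E.
Proof. by move=> iu; rewrite fineK //; exact: integrable_fin_num. Qed.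

Lemma rI_ae u v : meas u -> meas v -> (\forall t \ae mu, u t = v t) -> I u = I v.
Proof.
move=> mu_ mv uv; congr fine; apply: ae_eq_integral => //.
- exact/measurable_EFinP.
- exact/measurable_EFinP.
- by apply: filterS uv => t /= ->.
Qed.

Lemma rint_ae u v : meas v -> rint u -> (\forall t \ae mu, u t = v t) -> rint v.
Proof.
move=> mv /integrableP[mu_ iu] uv; apply/integrableP; split.
  exact/measurable_EFinP.
have <- : (\int[mu]_t `|(EFin \o u) t| = \int[mu]_t `|(EFin \o v) t|)%E.
  apply: ae_eq_integral => //.
  - exact: measurableT_comp.
  - by apply: measurableT_comp => //; exact/measurable_EFinP.
  - by apply: filterS uv => t /= ->.
exact: iu.
Qed.

Lemma rI_eq0 u : (forall t, 0 <= u t) -> rint u -> I u = 0 -> \forall t \ae mu, u t = 0.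
Proof.
move=> u0 iu Iu; have := integrableP _ _ _ iu => -[mu_ _].
have /(ae_eq_integral_abs mu measurableT mu_) : (\int[mu]_(x in setT) `|(EFin \o u) x| = 0)%E.
  under eq_integral do rewrite /= ger0_norm //.
  by rewrite -EFin_rI // Iu.
by apply: filterS => t /= /(_ Logic.I) [].
Qed.

Lemma rI_eq0_le (u : TR -> R) (e : R) : 0 <= e -> meas u -> (forall t, 0 <= u t) ->
  (\int[mu]_t (u t)%:E <= e%:E)%E -> rint u /\ I u <= e.
Proof.
move=> e0 mu_ u0 ule.
have iu : rint u.
  apply/integrableP; split; first exact/measurable_EFinP.
  under eq_integral do rewrite /= ger0_norm //.
  exact: le_lt_trans ule (ltry _).
by split => //; rewrite -lee_fin EFin_rI.
Qed.

End CircleIntegral.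

(** * Complex integrals; square-integrable and essentially bounded functions *)

Section ComplexCircle.
Variable R : realType.
Local Notation C := R[i].
Local Notation mu := (circle R).
Local Notation TR := (measurableTypeR R).
Local Notation meas := (measurable_fun [set: TR]).
Local Notation rI := (Rintegral mu setT).
Local Notation normc := (@Normc.normc R).
Implicit Types (f g : TR -> C).

Definition cmeas f :=
  meas (fun t => complex.Re (f t)) /\ meas (fun t => complex.Im (f t)).
Definition cint f :=
  rint (fun t => complex.Re (f t)) /\ rint (fun t => complex.Im (f t)).
Definition sqint f := cmeas f /\ rint (fun t => normc (f t) ^+ 2).
Definition bdd f := cmeas f /\ exists2 M : R, 0 <= M & \forall t \ae mu, normc (f t) <= M.

Lemma cint_meas f : cint f -> cmeas f.
Proof. by case=> /rint_meas ? /rint_meas. Qed.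

Lemma cmeas_cst c : cmeas (fun=> c). Proof. by []. Qed.
Lemma cmeasD f g : cmeas f -> cmeas g -> cmeas (fun t => f t + g t).
Proof.
move=> [f1 f2] [g1 g2]; split.
  by under eq_fun do rewrite cReD; exact: measurable_funD.
by under eq_fun do rewrite cImD; exact: measurable_funD.
Qed.
Lemma cmeasM f g : cmeas f -> cmeas g -> cmeas (fun t => f t * g t).
Proof.
move=> [f1 f2] [g1 g2]; split.
  by under eq_fun do rewrite cReM; apply: measurable_funB; exact: measurable_funM.
by under eq_fun do rewrite cImM; apply: measurable_funD; exact: measurable_funM.
Qed.
Lemma cmeas_conj f : cmeas f -> cmeas (fun t => (f t)^*).
Proof.
move=> [f1 f2]; split; first by under eq_fun do rewrite cReconj.
by under eq_fun do rewrite cImconj; exact: measurableT_comp.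
Qed.
Lemma cmeasZ c f : cmeas f -> cmeas (fun t => c * f t).
Proof. by apply: cmeasM; exact: cmeas_cst. Qed.
Lemma cmeasN f : cmeas f -> cmeas (fun t => - f t).
Proof. by move=> mf; under eq_fun do rewrite -mulN1r; exact: cmeasZ. Qed.
Lemma meas_normc f : cmeas f -> meas (fun t => normc (f t)).
Proof.
move=> [f1 f2].
have -> : (fun t => normc (f t)) =
    Num.sqrt \o (fun t => complex.Re (f t) ^+ 2 + complex.Im (f t) ^+ 2).
  apply/funext => t /=; rewrite -normcE2 sqrtr_sqr ger0_norm //; exact: normc_ge0.
apply: measurableT_comp => //; first exact: continuous_measurable_fun (@sqrt_continuous _).
by apply: measurable_funD; apply: measurable_funX.
Qed.
Lemma meas_normc2 f : cmeas f -> meas (fun t => normc (f t) ^+ 2).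
Proof. by move=> mf; apply: measurable_funX; exact: meas_normc. Qed.

Lemma cint_normP f : cmeas f -> cint f <-> rint (fun t => normc (f t)).
Proof.
move=> mf; split=> [[i1 i2]|iN].
  apply: rint_le (rintD (rint_norm i1) (rint_norm i2)) _; first exact: meas_normc.
  move=> t; rewrite ger0_norm ?normc_ge0 // [X in _ <= X]ger0_norm ?addr_ge0 //.
  exact: normc_le_ReIm.
split; apply: rint_le iN _; try by case: mf.
  by move=> t; rewrite [X in _ <= X]ger0_norm ?Re_le_normc //; exact: normc_ge0.
by move=> t; rewrite [X in _ <= X]ger0_norm ?Im_le_normc //; exact: normc_ge0.
Qed.

Lemma cint_le f (u : TR -> R) : cmeas f -> rint u -> (forall t, normc (f t) <= u t) -> cint f.
Proof.
move=> mf iu fu; apply/cint_normP => //; apply: rint_le iu _; first exact: meas_normc.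
by move=> t; rewrite !ger0_norm ?(le_trans _ (fu t)) //; exact: normc_ge0.
Qed.

Lemma cint_cst c : cint (fun=> c).
Proof. by split; exact: rint_cst. Qed.
Lemma cintD f g : cint f -> cint g -> cint (fun t => f t + g t).
Proof.
move=> [f1 f2] [g1 g2]; split.
  by under eq_fun do rewrite cReD; exact: rintD.
by under eq_fun do rewrite cImD; exact: rintD.
Qed.
Lemma cintZ c f : cint f -> cint (fun t => c * f t).
Proof.
move=> [f1 f2]; split.
  by under eq_fun do rewrite cReM; apply: rintB; apply: rintZ.
by under eq_fun do rewrite cImM; apply: rintD; apply: rintZ.
Qed.
Lemma cint_conj f : cint f -> cint (fun t => (f t)^*).
Proof.
move=> [f1 f2]; split; first by under eq_fun do rewrite cReconj.
by under eq_fun do rewrite cImconj; exact: rintN.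
Qed.
Lemma cint_sum (J : Type) (r : seq J) (F : J -> TR -> C) :
  (forall j, cint (F j)) -> cint (fun t => \sum_(j <- r) F j t).
Proof.
move=> iF; elim: r => [|j r IH].
  by under eq_fun do rewrite big_nil; exact: cint_cst.
by under eq_fun do rewrite big_cons; exact: cintD.
Qed.

Lemma cI_cst (c : C) : cintegral (fun=> c) = c.
Proof. by rewrite /cintegral !rI_cst; case: c. Qed.
Lemma cI_D f g : cint f -> cint g ->
  cintegral (fun t => f t + g t) = cintegral f + cintegral g.
Proof.
move=> [f1 f2] [g1 g2]; apply: complex_ext; rewrite ?cReD ?cImD /=.
  by rewrite -rI_D //; apply: eq_Rintegral => t _; rewrite cReD.
by rewrite -rI_D //; apply: eq_Rintegral => t _; rewrite cImD.
Qed.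
Lemma cI_Z (c : C) f : cint f -> cintegral (fun t => c * f t) = c * cintegral f.
Proof.
move=> [f1 f2]; apply: complex_ext; rewrite ?cReM ?cImM /=.
  by rewrite -!rI_Z // -rI_B; [apply: eq_Rintegral => t _; rewrite cReM|exact: rintZ|exact: rintZ].
by rewrite -!rI_Z // -rI_D; [apply: eq_Rintegral => t _; rewrite cImM|exact: rintZ|exact: rintZ].
Qed.
Lemma cI_conj f : cint f -> cintegral (fun t => (f t)^*) = (cintegral f)^*.
Proof.
move=> [f1 f2]; apply: complex_ext; rewrite ?cReconj ?cImconj /=.
  by apply: eq_Rintegral => t _; rewrite cReconj.
by rewrite -rI_N //; apply: eq_Rintegral => t _; rewrite cImconj.
Qed.
Lemma cI_sum (J : Type) (r : seq J) (F : J -> TR -> C) :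
  (forall j, cint (F j)) ->
  cintegral (fun t => \sum_(j <- r) F j t) = \sum_(j <- r) cintegral (F j).
Proof.
move=> iF; elim: r => [|j r IH].
  by rewrite big_nil -[RHS]cI_cst; congr (@cintegral R _); apply/funext => t; rewrite big_nil.
rewrite big_cons -IH -cI_D //; last exact: cint_sum.
by congr (@cintegral R _); apply/funext => t; rewrite big_cons.
Qed.
Lemma cI_ae f g : cmeas f -> cmeas g -> (\forall t \ae mu, f t = g t) ->
  cintegral f = cintegral g.
Proof.
move=> [f1 f2] [g1 g2] fg; congr Complex; apply: rI_ae => //;
  by apply: filterS fg => t ->.
Qed.
Lemma cint_ae f g : cmeas g -> cint f -> (\forall t \ae mu, f t = g t) -> cint g.
Proof.
move=> [g1 g2] [f1 f2] fg; split; [apply: rint_ae f1 _ | apply: rint_ae f2 _] => //;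
  by apply: filterS fg => t ->.
Qed.

Lemma le_mul_sq (a b : R) : 0 <= a -> 0 <= b -> a * b <= a ^+ 2 + b ^+ 2.
Proof. by move=> a0 b0; have := sqr_ge0 (a - b); nra. Qed.

Lemma sqintM f g : sqint f -> sqint g -> cint (fun t => f t * g t).
Proof.
move=> [mf f2] [mg g2]; apply: cint_le (rintD f2 g2) _; first exact: cmeasM.
by move=> t; rewrite Normc.normcM le_mul_sq //; exact: normc_ge0.
Qed.
Lemma sqint_conj f : sqint f -> sqint (fun t => (f t)^*).
Proof.
move=> [mf f2]; split; first exact: cmeas_conj.
by under eq_fun do rewrite normc_conj.
Qed.
Lemma sqintMc f g : sqint f -> sqint g -> cint (fun t => f t * (g t)^*).
Proof. by move=> hf hg; apply: (sqintM hf); exact: sqint_conj. Qed.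
Lemma sqintZ c f : sqint f -> sqint (fun t => c * f t).
Proof.
move=> [mf f2]; split; first exact: cmeasZ.
by under eq_fun do rewrite Normc.normcM exprMn; exact: rintZ.
Qed.
Lemma normcD2 (a b : C) : normc (a + b) ^+ 2 <= 2 * (normc a ^+ 2 + normc b ^+ 2).
Proof.
rewrite !normcE2 cReD cImD.
have := sqr_ge0 (complex.Re a - complex.Re b).
have := sqr_ge0 (complex.Im a - complex.Im b).
by move: (complex.Re a) (complex.Im a) (complex.Re b) (complex.Im b) => x y u v; nra.
Qed.
Lemma sqintD f g : sqint f -> sqint g -> sqint (fun t => f t + g t).
Proof.
move=> [mf f2] [mg g2]; have mfg := cmeasD mf mg; split => //.
apply: rint_le (rintZ 2 (rintD f2 g2)) _; first exact: meas_normc2.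
move=> t; rewrite !ger0_norm ?normcD2 ?sqr_ge0 //.
by rewrite mulr_ge0 ?addr_ge0 ?sqr_ge0.
Qed.
Lemma sqintN f : sqint f -> sqint (fun t => - f t).
Proof. by move=> hf; under eq_fun do rewrite -mulN1r; exact: sqintZ. Qed.
Lemma sqintB f g : sqint f -> sqint g -> sqint (fun t => f t - g t).
Proof. by move=> hf hg; apply: sqintD (sqintN hg). Qed.
Lemma sqint_cst c : sqint (fun=> c).
Proof. by split; [exact: cmeas_cst|exact: rint_cst]. Qed.
Lemma sqint_sum (J : Type) (r : seq J) (F : J -> TR -> C) :
  (forall j, sqint (F j)) -> sqint (fun t => \sum_(j <- r) F j t).
Proof.
move=> iF; elim: r => [|j r IH].
  by under eq_fun do rewrite big_nil; exact: sqint_cst.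
by under eq_fun do rewrite big_cons; exact: sqintD.
Qed.
Lemma sqint_cint f : sqint f -> cint f.
Proof.
move=> hf; have := sqintM (sqint_cst 1) hf.
by congr (cint _); apply/funext => t; rewrite mul1r.
Qed.
Lemma sqint_ae f g : cmeas g -> sqint f -> (\forall t \ae mu, f t = g t) -> sqint g.
Proof.
move=> mg [mf f2] fg; split => //; apply: rint_ae f2 _; first exact: meas_normc2.
by apply: filterS fg => t ->.
Qed.

Lemma bdd_le f M : cmeas f -> (forall t, normc (f t) <= M) -> bdd f.
Proof.
move=> mf fM; split => //; exists M; last exact/nearW.
exact: le_trans (normc_ge0 _) (fM point).
Qed.
Lemma bdd_cst c : bdd (fun=> c). Proof. exact: (@bdd_le _ (normc c)). Qed.
Lemma bddM f g : bdd f -> bdd g -> bdd (fun t => f t * g t).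
Proof.
move=> [mf [M M0 fM]] [mg [N N0 gN]]; split; first exact: cmeasM.
exists (M * N); first exact: mulr_ge0.
apply: filterS2 fM gN => t fM gN.
by rewrite Normc.normcM ler_pM // normc_ge0.
Qed.
Lemma bddD f g : bdd f -> bdd g -> bdd (fun t => f t + g t).
Proof.
move=> [mf [M M0 fM]] [mg [N N0 gN]]; split; first exact: cmeasD.
exists (M + N); first exact: addr_ge0.
apply: filterS2 fM gN => t fM gN.
by rewrite (le_trans (le_normcD _ _)) // lerD.
Qed.
Lemma bdd_conj f : bdd f -> bdd (fun t => (f t)^*).
Proof.
move=> [mf [M M0 fM]]; split; first exact: cmeas_conj.
by exists M => //; apply: filterS fM => t; rewrite normc_conj.
Qed.
Lemma bdd_sum (J : Type) (r : seq J) (F : J -> TR -> C) :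
  (forall j, bdd (F j)) -> bdd (fun t => \sum_(j <- r) F j t).
Proof.
move=> iF; elim: r => [|j r IH].
  by under eq_fun do rewrite big_nil; exact: bdd_cst.
by under eq_fun do rewrite big_cons; exact: bddD.
Qed.
Lemma bdd_ae f g : cmeas g -> bdd f -> (\forall t \ae mu, f t = g t) -> bdd g.
Proof.
move=> mg [mf [M M0 fM]] fg; split => //; exists M => //.
by apply: filterS2 fM fg => t + <-.
Qed.

(** The comparison lemmas for integrability need a bound at every point, whereas [bdd] gives one
    almost everywhere; cutting off where the bound fails reconciles the two. *)
Lemma bdd_trunc f : bdd f -> exists M : R, exists2 f' : TR -> C,
  cmeas f' /\ (forall t, normc (f' t) <= M) & \forall t \ae mu, f t = f' t.
Proof.
move=> [mf [M M0 fM]]; exists M.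
pose chi : TR -> R := \1_[set t | normc (f t) <= M].
have mA : measurable [set t : TR | normc (f t) <= M].
  rewrite -[X in measurable X]setTI; apply: measurable_fun_le => //; exact: meas_normc.
have mchi : cmeas (fun t => (chi t)%:C%C).
  by split => /=; [exact: measurable_indic|].
exists (fun t => (chi t)%:C%C * f t); last first.
  by apply: filterS fM => t ft; rewrite /chi indicE mem_set // mul1r.
split; first exact: cmeasM.
move=> t; rewrite /chi indicE; have [/set_mem ft|_] := boolP (t \in _).
  by rewrite mul1r.
by rewrite mul0r Normc.normc0.
Qed.

Lemma bdd_sqintM f g : bdd f -> sqint g -> sqint (fun t => f t * g t).
Proof.
move=> bf [mg g2]; have [M [f' [mf' fM] ff']] := bdd_trunc bf.
apply: (@sqint_ae (fun t => f' t * g t)); first by apply: cmeasM => //; case: bf.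
  split; first exact: cmeasM.
  apply: rint_le (rintZ (M ^+ 2) g2) _; first by apply: (@meas_normc2 (fun t => f' t * g t)); exact: cmeasM.
  move=> t; have M0 := le_trans (normc_ge0 _) (fM t).
  rewrite ger0_norm ?sqr_ge0 // ger0_norm; last by rewrite mulr_ge0 ?sqr_ge0.
  rewrite Normc.normcM exprMn ler_wpM2r ?sqr_ge0 //.
  by rewrite ler_sqr ?nnegrE ?normc_ge0.
by apply: filterS ff' => t ->.
Qed.
Lemma bdd_sqint f : bdd f -> sqint f.
Proof.
move=> bf; have := bdd_sqintM bf (sqint_cst 1).
by congr (sqint _); apply/funext => t; rewrite mulr1.
Qed.
Lemma bdd_cintM f g : bdd f -> cint g -> cint (fun t => f t * g t).
Proof.
move=> bf ig; have mg := cint_meas ig; have [M [f' [mf' fM] ff']] := bdd_trunc bf.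
apply: (@cint_ae (fun t => f' t * g t)); first by apply: cmeasM => //; case: bf.
  apply: cint_le (rintZ M ((cint_normP mg).1 ig)) _; first exact: cmeasM.
  by move=> t; rewrite Normc.normcM ler_wpM2r // normc_ge0.
by apply: filterS ff' => t ->.
Qed.
Lemma bdd_norm1 f : cmeas f -> (\forall t \ae mu, f t * (f t)^* = 1) -> bdd f.
Proof.
move=> mf f1; split => //; exists 1 => //; apply: filterS f1 => t.
rewrite mulcconj => /(congr1 (@complex.Re R)) /= /eqP.
by rewrite sqrf_eq1 => /orP[/eqP->|/eqP ->]; rewrite ?lerN10 ?ler01 //; lra.
Qed.

Lemma normc_zT (t : R) : normc (zT t) = 1.
Proof. by rewrite /zT /= cos2Dsin2 sqrtr1. Qed.
Lemma zT_neq0 (t : R) : zT t != 0.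
Proof.
apply/eqP => h; have := normc_zT t; rewrite h Normc.normc0 => /eqP.
by rewrite eq_sym oner_eq0.
Qed.
Lemma zT_conjM (t : R) : zT t * (zT t)^* = 1.
Proof. by rewrite mulcconj normc_zT expr1n. Qed.
Lemma zT_conj (t : R) : (zT t)^* = (zT t)^-1.
Proof. by apply: (mulfI (zT_neq0 t)); rewrite zT_conjM mulfV ?zT_neq0. Qed.
Lemma cmeas_zT : cmeas (@zT R).
Proof.
split => /=; apply: continuous_measurable_fun.
  move=> t; apply: continuous_comp; last exact: continuous_cos.
  by apply: (@mulrl_continuous R); exact: cvg_id.
move=> t; apply: continuous_comp; last exact: continuous_sin.
by apply: (@mulrl_continuous R); exact: cvg_id.
Qed.
Lemma cmeasX f (k : nat) : cmeas f -> cmeas (fun t => f t ^+ k).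
Proof.
move=> mf; elim: k => [|k IH]; first by under eq_fun do rewrite expr0; exact: cmeas_cst.
by under eq_fun do rewrite exprS; exact: cmeasM.
Qed.
Lemma normc_zTX (t : R) (j : int) : normc (zT t ^ j) = 1.
Proof.
have n (k : nat) : normc (zT t ^+ k) = 1.
  by elim: k => [|k IH]; rewrite ?Normc.normc1 // exprS Normc.normcM normc_zT IH mulr1.
by case: j => k; rewrite ?NegzE -?exprnP // ?exprnN Normc.normcV n invr1.
Qed.
Lemma bdd_zTX (j : int) : bdd (fun t => zT t ^ j).
Proof.
apply: (@bdd_le _ 1); last by move=> t; rewrite normc_zTX.
case: j => k; first by apply: cmeasX; exact: cmeas_zT.
under eq_fun do rewrite NegzE -exprnN -exprVn -zT_conj.
by apply/cmeasX/cmeas_conj/cmeas_zT.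
Qed.
Lemma bdd_zT : bdd (@zT R). Proof. exact: (bdd_zTX 1). Qed.

End ComplexCircle.

(** * Completeness of L^2 *)

Section RieszFischer.
Variable R : realType.
Local Notation C := R[i].
Local Notation mu := (circle R).
Local Notation TR := (measurableTypeR R).
Local Notation meas := (measurable_fun [set: TR]).
Local Notation rI := (Rintegral mu setT).
Local Notation normc := (@Normc.normc R).

(** Integrate 2 |u| <= 2^k u^2 + 2^-k; this weight turns the bound 4^-k for the integral of u^2 into
    2^-k for that of |u|. *)
Lemma rI_norm_half_pow (u : TR -> R) (k : nat) : meas u ->
  rint (fun t => u t ^+ 2) -> rI (fun t => u t ^+ 2) <= 4^-1 ^+ k ->
  rint u /\ rI (fun t => `|u t|) <= 2^-1 ^+ k.
Proof.
move=> mu_ iu uk.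
pose v (t : TR) := 2^-1 * (2 ^+ k * u t ^+ 2 + 2^-1 ^+ k).
have p2 : 0 < 2 ^+ k :> R by rewrite exprn_gt0.
have iv : rint v.
  apply: rintZ; apply: (rintD (rintZ _ iu)); exact: rint_cst.
have uv t : `|u t| <= v t.
  rewrite /v exprVn; have := sqr_ge0 (2 ^+ k * `|u t| - 1).
  have -> : u t ^+ 2 = `|u t| ^+ 2 by rewrite real_normK ?num_real.
  move: (2 ^+ k) p2 (`|u t|) => a a0 b h.
  rewrite -subr_ge0; have -> : 2^-1 * (a * b ^+ 2 + a^-1) - b = 2^-1 * a^-1 * (a * b - 1) ^+ 2.
    by field; rewrite gt_eqF.
  by apply: mulr_ge0; [apply: mulr_ge0; rewrite invr_ge0 ?(ltW a0)|exact: sqr_ge0].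
have iu1 : rint u.
  by apply: rint_le iv _ => // t; rewrite [X in _ <= X]ger0_norm // (le_trans _ (uv t)).
split => //; apply: le_trans (rI_le (rint_norm iu1) iv uv) _.
rewrite /v rI_Z; last by apply: (rintD (rintZ _ iu)); exact: rint_cst.
rewrite rI_D; [|exact: rintZ|exact: rint_cst].
rewrite rI_Z // rI_cst.
have h : 2 ^+ k * rI (fun t => u t ^+ 2) <= 2^-1 ^+ k.
  apply: le_trans (ler_wpM2l (ltW p2) uk) _.
  rewrite !exprVn (_ : 4 = 2 * 2 :> R); last by ring.
  by rewrite exprMn; move: (2 ^+ k) p2 => a a0; rewrite le_eqVlt; apply/orP; left;
    apply/eqP; field; rewrite gt_eqF.
lra.
Qed.

(** The increments have summable L^1 norms, so the sum of their absolute values has a finite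
    integral and is finite almost everywhere; there the telescoping series converges. *)
Lemma fast_cauchy_ae_cvg (u : nat -> TR -> R) : (forall k, meas (u k)) ->
  (forall k, rint (fun t => (u k.+1 t - u k t) ^+ 2)) ->
  (forall k, rI (fun t => (u k.+1 t - u k t) ^+ 2) <= 4^-1 ^+ k) ->
  exists2 l : TR -> R, meas l & \forall t \ae mu, u k t @[k --> \oo] --> l t.
Proof.
move=> mu_ iu uk.
pose w (k : nat) (t : TR) := `|u k.+1 t - u k t|.
have md k : meas (fun t => u k.+1 t - u k t) by exact: measurable_funB.
have iw k : rint (w k) /\ rI (w k) <= 2^-1 ^+ k.
  have [i1 h] := rI_norm_half_pow (md k) (iu k) (uk k).
  by split => //; exact: rint_norm.
have mw k : meas (w k) by apply: rint_meas; case: (iw k).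
pose W (t : TR) := (\sum_(k <oo) (w k t)%:E)%E.
have w0 k t : (0 <= (w k t)%:E)%E by rewrite lee_fin /w.
have mW : measurable_fun setT W.
  by apply: ge0_emeasurable_sum => // k _; exact/measurable_EFinP.
have W0 t : (0 <= W t)%E by apply: nneseries_ge0 => k _ _.
have iW : (\int[mu]_t W t < +oo)%E.
  rewrite integral_nneseries //; last by move=> k; exact/measurable_EFinP.
  (* The value 2 is the sum of the 2^-k, read as 2 / 2^(k+1) to match [epsilon_trick0]. *)
  apply: (@le_lt_trans _ _ (2%:E)%E); last exact: ltry.
  apply: (le_trans _ (epsilon_trick0 xpredT (ler0n R 2))).
  apply: lee_nneseries => [k _ _|k _]; first exact: integral_ge0.
  have [i1 h] := iw k; rewrite -EFin_rI // lee_fin (le_trans h) //.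
  rewrite natrX exprS exprVn invfM mulrA mulfV ?pnatr_eq0 // mul1r.
  exact: lexx.
have finW : \forall t \ae mu, W t \is a fin_num.
  have IW : mu.-integrable setT W.
    apply/integrableP; split => //.
    by under eq_integral do rewrite gee0_abs //.
  by have := integrable_ae measurableT IW; apply: filterS => t /(_ Logic.I).
(* The upper limit is measurable without knowing where the sequence converges, and agrees with the
   limit wherever that exists. *)
pose v (t : TR) := fine (limn_esup (fun k => (u k t)%:E)).
exists v.
  apply: measurableT_comp => //; apply: measurable_fun_limn_esup => k.
  exact/measurable_EFinP.
apply: filterS finW => t Wt.
have cw : cvgn (series (fun k => w k t)).
  apply: nondecreasing_is_cvgn.
    by apply: nondecreasing_series => k _ _; rewrite /w.
  exists (fine (W t)) => _ [n _ <-].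
  rewrite -lee_fin fineK // /series /= -sumEFin.
  exact: (nneseries_lim_ge n (fun k _ _ => w0 k t)).
have cd : cvgn (series (fun k => u k.+1 t - u k t)).
  by apply: (@normed_cvg R R^o); exact: cw.
have cu : cvgn (fun k => u k t).
  have -> : (fun k => u k t) = (fun k => u 0%N t + series (fun k => u k.+1 t - u k t) k).
    apply/funext => k; rewrite /series /= telescope_sumr // subrKC //.
  by apply: is_cvgD => //; exact: is_cvg_cst.
have cE : (fun k => (u k t)%:E) @ \oo --> (limn (fun k => u k t))%:E.
  by apply/fine_cvgP; split; [exact: nearW|exact: cu].
suff -> : v t = limn (fun k => u k t) by [].
by rewrite /v is_cvg_limn_esupE ?(cvg_lim _ cE) //; apply/cvg_ex; eexists; exact: cE.
Qed.

End RieszFischer.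

Lemma lexx_eq (R : realType) (a b : R) : a = b -> a <= b.
Proof. by move->. Qed.

Lemma ae_ord d (T : measurableType d) (R : realType) (mu : {measure set T -> \bar R})
  (n : nat) (P : 'I_n -> T -> Prop) :
  (forall i, \forall t \ae mu, P i t) -> \forall t \ae mu, forall i, P i t.
Proof.
move=> h; have : \forall t \ae mu, forall k (kn : (k < n)%N), P (Ordinal kn) t.
  apply/ae_foralln => k; have [kn|kn] : (n <= k)%N \/ (k < n)%N by case: leqP; [left|right].
    by apply/nearW => t kn'; exfalso; move: (kn'); rewrite ltnNge kn.
  by apply: filterS (h (Ordinal kn)) => t ht kn'; rewrite (bool_irrelevance kn' kn).
by apply: filterS => t ht [k kn]; apply: ht.
Qed.

Lemma limn_einf_le (R : realType) (u : (\bar R)^nat) (B : \bar R) :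
  (forall k, (u k <= B)%E) -> (limn_einf u <= B)%E.
Proof.
move=> uB; rewrite limn_einf_lim; apply: lime_le; first exact: is_cvg_einfs.
apply: nearW => k; apply: le_trans (uB k).
by apply: ereal_inf_lbound; exists k => //=.
Qed.

Lemma cvg_sum_seq (R : realType) (I : Type) (r : seq I) (F : I -> nat -> R) (a : I -> R) :
  (forall i, F i @ \oo --> a i) ->
  (\sum_(i <- r) F i k) @[k --> \oo] --> \sum_(i <- r) a i.
Proof.
move=> Fa; elim: r => [|i r IH].
  by rewrite big_nil; under eq_fun do rewrite big_nil; exact: cvg_cst.
by rewrite big_cons; under eq_fun do rewrite big_cons; exact: (cvgD (Fa i) IH).
Qed.

(** * Vector-valued L^2 and its completeness *)

Section VectorL2.
Variable R : realType.
Local Notation C := R[i].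
Local Notation mu := (circle R).
Local Notation TR := (measurableTypeR R).
Local Notation meas := (measurable_fun [set: TR]).
Local Notation rI := (Rintegral mu setT).
Local Notation normc := (@Normc.normc R).

Lemma vnorm_ge0 n (x : 'cV[C]_n) : 0 <= vnorm x.
Proof. exact: sqrtr_ge0. Qed.

Lemma vnorm2E n (x : 'cV[C]_n) : vnorm x ^+ 2 = \sum_i normc (x i 0) ^+ 2.
Proof. by rewrite sqr_sqrtr // sumr_ge0 // => i _; exact: sqr_ge0. Qed.

Lemma normc_le_vnorm n (x : 'cV[C]_n) i : normc (x i 0) <= vnorm x.
Proof.
rewrite -ler_sqr ?nnegrE ?normc_ge0 ?vnorm_ge0 // vnorm2E (bigD1 i) //= lerDl.
by rewrite sumr_ge0 // => j _; exact: sqr_ge0.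
Qed.

Lemma meas_vnorm2 n (f : TR -> 'cV[C]_n) : mxmeasurable f ->
  meas (fun t => vnorm (f t) ^+ 2).
Proof.
move=> mf; under eq_fun do rewrite vnorm2E.
by apply: measurable_sum => i; apply: (@meas_normc2 _ (fun t => f t i 0)); exact: mf.
Qed.

Lemma norm2_pow n (f : TR -> 'cV[C]_n) :
  norm2 f = ((\int[mu]_t (vnorm (f t) ^+ 2)%:E) `^ 2^-1)%E.
Proof.
rewrite /norm2 unlock; congr (_ `^ _)%E; apply: eq_integral => t _ /=.
by rewrite ger0_norm ?vnorm_ge0 // powR_mulrn ?vnorm_ge0.
Qed.

Lemma norm2E n (f : TR -> 'cV[C]_n) : rint (fun t => vnorm (f t) ^+ 2) ->
  norm2 f = (Num.sqrt (rI (fun t => vnorm (f t) ^+ 2)))%:E.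
Proof.
move=> fi; rewrite norm2_pow -EFin_rI // poweR_EFin powR12_sqrt //.
by apply: rI_ge0 => t; exact: sqr_ge0.
Qed.

Lemma L2P n (f : TR -> 'cV[C]_n) : L2 f <-> forall i, sqint (fun t => f t i 0).
Proof.
split=> [[mf nf] i|fi].
  have mi : cmeas (fun t => f t i 0) by exact: mf.
  split => //.
  have : rint (fun t => vnorm (f t) ^+ 2).
    apply/integrableP; split; first by apply/measurable_EFinP; exact: meas_vnorm2.
    under eq_integral do rewrite /= ger0_norm ?sqr_ge0 //.
    rewrite ltey; apply: contraTneq nf => h.
    by rewrite norm2_pow h poweRyr ?ltxx // invr_neq0 // pnatr_eq0.
  move/rint_le; apply; first exact: meas_normc2.
  move=> t; rewrite !ger0_norm ?sqr_ge0 //.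
  by rewrite ler_sqr ?nnegrE ?normc_ge0 ?vnorm_ge0 // normc_le_vnorm.
have mf : mxmeasurable f by move=> i j; rewrite ord1; case: (fi i).
split => //; rewrite norm2E ?ltry //.
by under eq_fun do rewrite vnorm2E; apply: rint_sum => i; case: (fi i).
Qed.

Lemma L2_rint n (f : TR -> 'cV[C]_n) : L2 f -> rint (fun t => vnorm (f t) ^+ 2).
Proof.
move=> /L2P fi; under eq_fun do rewrite vnorm2E.
by apply: rint_sum => i; case: (fi i).
Qed.

Lemma L2_meas n (f : TR -> 'cV[C]_n) : L2 f -> mxmeasurable f. Proof. by case. Qed.

Lemma inner2_int n (f g : TR -> 'cV[C]_n) : L2 f -> L2 g ->
  cint (fun t => \sum_i f t i 0 * (g t i 0)^*).
Proof.
by move=> /L2P hf /L2P hg; apply: cint_sum => i; exact: sqintMc.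
Qed.

Lemma sum_conj_vnorm n (x : 'cV[C]_n) :
  \sum_i x i 0 * (x i 0)^* = ((vnorm x ^+ 2)%:C)%C.
Proof.
rewrite vnorm2E rmorph_sum; apply: eq_bigr => i _; exact: mulcconj.
Qed.

Lemma L2_0 n : L2 (0 : R -> 'cV[C]_n).
Proof.
apply/L2P => i; have := sqint_cst (0 : C); congr (sqint _).
by apply/funext => t; rewrite mxE.
Qed.
Lemma L2_lin n (a : C) (f g : R -> 'cV[C]_n) : L2 f -> L2 g -> L2 (a *: f + g).
Proof.
move=> /L2P hf /L2P hg; apply/L2P => i.
have := sqintD (sqintZ a (hf i)) (hg i); congr (sqint _).
by apply/funext => t; rewrite !mxE.
Qed.

Lemma L2_semi_ip n : semi_ip (@L2 R n) (@inner2 R n).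
Proof.
split.
- exact: L2_0.
- exact: L2_lin.
- move=> a f g h hf hg hh; rewrite /inner2 -cI_Z; last exact: inner2_int.
  rewrite -cI_D; [|exact/cintZ/inner2_int|exact: inner2_int].
  congr (cintegral _); apply/funext => t; rewrite mulr_sumr -big_split /=.
  by apply: eq_bigr => i _; rewrite !mxE mulrDl mulrA.
- move=> f g hf hg; rewrite /inner2 -cI_conj; last exact: inner2_int.
  congr (cintegral _); apply/funext => t; rewrite rmorph_sum.
  by apply: eq_bigr => i _; rewrite rmorphM /= conjCK mulrC.
- move=> f hf; rewrite /inner2 /=; apply: rI_ge0 => t.
  by rewrite sum_conj_vnorm /= sqr_ge0.
Qed.

Local Notation N := (sqn (@inner2 R _)).
Local Notation nr := (nrm (@inner2 R _)).

Lemma sqnE n (f : R -> 'cV[C]_n) : N f = rI (fun t => vnorm (f t) ^+ 2).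
Proof.
by rewrite /sqn /inner2 /=; apply: eq_Rintegral => t _; rewrite sum_conj_vnorm.
Qed.

Lemma norm2_nrm n (f : R -> 'cV[C]_n) : L2 f -> norm2 f = (nr f)%:E.
Proof. by move=> hf; rewrite norm2E ?sqnE ?/nrm ?sqnE //; exact: L2_rint. Qed.

Lemma sqn_eq0 n (f : R -> 'cV[C]_n) : L2 f -> N f = 0 -> \forall t \ae mu, f t = 0.
Proof.
move=> hf; rewrite sqnE => h.
have := rI_eq0 (fun t => sqr_ge0 _) (L2_rint hf) h.
apply: filterS => t /eqP; rewrite sqrf_eq0 => /eqP ft.
apply/matrixP => i j; rewrite ord1 mxE; apply: Normc.eq0_normc.
by apply/eqP; rewrite eq_le normc_ge0 andbT -ft normc_le_vnorm.
Qed.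

Lemma inner2_ae n (f g f' g' : R -> 'cV[C]_n) : L2 f -> L2 g -> L2 f' -> L2 g' ->
  (\forall t \ae mu, f t = f' t) -> (\forall t \ae mu, g t = g' t) ->
  inner2 f g = inner2 f' g'.
Proof.
move=> hf hg hf' hg' ff gg; apply: cI_ae.
- exact/cint_meas/inner2_int.
- exact/cint_meas/inner2_int.
- by apply: filterS2 ff gg => t -> ->.
Qed.

Lemma sqn_ae n (f f' : R -> 'cV[C]_n) : L2 f -> L2 f' ->
  (\forall t \ae mu, f t = f' t) -> N f = N f'.
Proof. by move=> hf hf' ff; rewrite /sqn (inner2_ae hf hf hf' hf' ff ff). Qed.

(** The real and imaginary parts of each entry converge almost everywhere by [fast_cauchy_ae_cvg];
    Fatou's lemma then carries the geometric bound on the tails to the limit. The second hypothesis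
    says that [P] is closed in L^2. *)
Lemma L2_fast_complete n (P : (R -> 'cV[C]_n) -> Prop) :
  (forall f, P f -> L2 f) ->
  (forall f_ l, (forall k, P (f_ k)) -> L2 l ->
     (forall e, 0 < e -> exists k : nat, nr (f_ k - l) < e) -> P l) ->
  fast_complete (@inner2 R n) P.
Proof.
move=> PL2 Pcl x_ Px fx.
have H := @L2_semi_ip n.
have Lx k := PL2 _ (Px k).
have hx k i : sqint (fun t => x_ k t i 0) by have /L2P := Lx k.
have hd k i : sqint (fun t => x_ k.+1 t i 0 - x_ k t i 0) by exact: sqintB.
have hdk k i : rI (fun t => normc (x_ k.+1 t i 0 - x_ k t i 0) ^+ 2) <= 4^-1 ^+ k.
  apply: le_trans (fx k); rewrite sqnE; apply: rI_le.
  - by case: (hd k i).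
  - exact/L2_rint/(sipB H).
  - move=> t; have := normc_le_vnorm ((x_ k.+1 - x_ k) t) i.
    by rewrite !mxE => h; rewrite ler_sqr ?nnegrE ?normc_ge0 // vnorm_ge0.
have exRe i : exists2 l : TR -> R, meas l &
    \forall t \ae mu, complex.Re (x_ k t i 0) @[k --> \oo] --> l t.
  have h k t : `|(complex.Re (x_ k.+1 t i 0) - complex.Re (x_ k t i 0)) ^+ 2| <=
       `|normc (x_ k.+1 t i 0 - x_ k t i 0) ^+ 2|.
    by rewrite !ger0_norm ?sqr_ge0 // normcE2 cReD cReN lerDl sqr_ge0.
  have m k : meas (fun t => complex.Re (x_ k t i 0)) by case: (hx k i) => -[].
  have ir k : rint (fun t => (complex.Re (x_ k.+1 t i 0) - complex.Re (x_ k t i 0)) ^+ 2).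
    apply: rint_le (hd k i).2 (h k); apply: measurable_funX; exact: measurable_funB.
  apply: fast_cauchy_ae_cvg => // k; apply: le_trans (hdk k i).
  apply: rI_le => //; first by case: (hd k i).
  by move=> t; have := h k t; rewrite !ger0_norm ?sqr_ge0.
have exIm i : exists2 l : TR -> R, meas l &
    \forall t \ae mu, complex.Im (x_ k t i 0) @[k --> \oo] --> l t.
  have h k t : `|(complex.Im (x_ k.+1 t i 0) - complex.Im (x_ k t i 0)) ^+ 2| <=
       `|normc (x_ k.+1 t i 0 - x_ k t i 0) ^+ 2|.
    by rewrite !ger0_norm ?sqr_ge0 // normcE2 cImD cImN lerDr sqr_ge0.
  have m k : meas (fun t => complex.Im (x_ k t i 0)) by case: (hx k i) => -[].
  have ir k : rint (fun t => (complex.Im (x_ k.+1 t i 0) - complex.Im (x_ k t i 0)) ^+ 2).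
    apply: rint_le (hd k i).2 (h k); apply: measurable_funX; exact: measurable_funB.
  apply: fast_cauchy_ae_cvg => // k; apply: le_trans (hdk k i).
  apply: rI_le => //; first by case: (hd k i).
  by move=> t; have := h k t; rewrite !ger0_norm ?sqr_ge0.
pose lr i := projT1 (cid2 (exRe i)); pose li i := projT1 (cid2 (exIm i)).
pose l (t : R) : 'cV[C]_n := \col_i Complex (lr i t) (li i t).
have ml : mxmeasurable l.
  move=> i j; split; under eq_fun do rewrite mxE /=.
    by rewrite /lr; case: cid2.
  by rewrite /li; case: cid2.
have cvgl : \forall t \ae mu, forall i,
    complex.Re (x_ k t i 0) @[k --> \oo] --> lr i t /\
    complex.Im (x_ k t i 0) @[k --> \oo] --> li i t.
  apply: ae_ord => i.
  have h1 : \forall t \ae mu, complex.Re (x_ k t i 0) @[k --> \oo] --> lr i t.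
    by rewrite /lr; case: cid2.
  have h2 : \forall t \ae mu, complex.Im (x_ k t i 0) @[k --> \oo] --> li i t.
    by rewrite /li; case: cid2.
  by apply: filterS2 h1 h2.
have p0 j : 0 <= 2^-1 ^+ j :> R by rewrite exprn_ge0 // invr_ge0 ler0n.
have p20 j : 0 <= 2 * 2^-1 ^+ j :> R by rewrite mulr_ge0.
have tail k m : nr (x_ (k + m)%N - x_ k) <= 2 * 2^-1 ^+ k * (1 - 2^-1 ^+ m).
  elim: m => [|m IH]; first by rewrite addn0 !subrr (nrm0 H) mulr0.
  rewrite addnS; apply: le_trans (nrm_triB H (Lx _) (Lx (k + m)%N) (Lx _)) _.
  have h : nr (x_ (k + m).+1 - x_ (k + m)%N) <= 2^-1 ^+ (k + m).
    rewrite -ler_sqr ?nnegrE ?nrm_ge0 ?p0 // (nrmK H); last exact: (sipB H).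
    apply: le_trans (fx _) _; rewrite -exprM mulnC exprM; apply: lexx_eq.
    by congr (_ ^+ _); rewrite exprVn -natrX.
  apply: le_trans (lerD h IH) _; rewrite exprS exprD.
  by move: (2^-1 ^+ k) (2^-1 ^+ m) => a b; apply: lexx_eq; field.
have tail2 k m : nr (x_ (k + m)%N - x_ k) <= 2 * 2^-1 ^+ k.
  apply: le_trans (tail k m) _.
  by rewrite ler_piMr ?mulr_ge0 ?p0 // lerBlDr lerDl.
have fat k : rint (fun t => vnorm (l t - x_ k t) ^+ 2) /\
    rI (fun t => vnorm (l t - x_ k t) ^+ 2) <= (2 * 2^-1 ^+ k) ^+ 2.
  have md : mxmeasurable (fun t => l t - x_ k t).
    move=> i j; rewrite ord1.
    have [m1 m2] : cmeas (fun t => l t i 0 - x_ k t i 0).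
      apply: cmeasD; first exact: ml.
      by apply: (@cmeasN _ (fun t => x_ k t i 0)); case: (hx k i).
    by split; [move: m1|move: m2]; congr (measurable_fun _ _); apply/funext => t; rewrite !mxE.
  have mm := meas_vnorm2 md.
  apply: rI_eq0_le => //; first by move=> t; exact: sqr_ge0.
  (* Fatou's lemma is applied in m with k fixed: pointwise, F m tends to the squared norm of l -
     x_k, and the integral of each F m is at most (2 * 2^-k)^2. *)
  pose F m t := (vnorm (x_ (k + m)%N t - x_ k t) ^+ 2)%:E.
  have mF m : measurable_fun setT (F m).
    by apply/measurable_EFinP; apply: (@meas_vnorm2 _ (x_ (k + m)%N - x_ k)); apply/L2_meas/(sipB H).
  have -> : (\int[mu]_t (vnorm (l t - x_ k t) ^+ 2)%:E =
             \int[mu]_t limn_einf (fun m => F m t))%E.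
    apply: ae_eq_integral => //.
    - exact/measurable_EFinP.
    - rewrite /limn_einf; apply: measurableT_comp => //.
      apply: measurable_fun_limn_esup => m; exact: (measurableT_comp _ (mF m)).
    - apply: filterS cvgl => t ht _.
      have cF : F m t @[m --> \oo] --> (vnorm (l t - x_ k t) ^+ 2)%:E.
        apply/fine_cvgP; split; first exact: nearW.
        rewrite /F /=; under eq_fun do rewrite /= vnorm2E.
        rewrite vnorm2E; apply: cvg_sum_seq => i.
        under eq_fun do rewrite !mxE normcE2 !cReD !cImD !cReN !cImN.
        rewrite !mxE normcE2 !cReD !cImD !cReN !cImN /=.
        have [hr hi] := ht i.
        have sub (u : nat -> R) (a b : R) : u @ \oo --> a ->
            (u (k + m)%N - b) ^+ 2 @[m --> \oo] --> (a - b) ^+ 2.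
          move=> ua; have h : (u (k + m)%N - b) @[m --> \oo] --> a - b.
            apply: cvgB; last exact: cvg_cst.
            suff -> : (fun m => u (k + m)%N) = [sequence u (m + k)%N]_m by rewrite cvg_shiftn.
            by apply/funext => m; rewrite /= addnC.
          by rewrite expr2; under eq_fun do rewrite expr2; exact: (cvgM h h).
        exact: (cvgD (sub _ _ (complex.Re (x_ k t i 0)) hr)
                     (sub _ _ (complex.Im (x_ k t i 0)) hi)).
      by rewrite is_cvg_limn_einfE ?(cvg_lim _ cF) //; apply/cvg_ex; eexists; exact: cF.
  apply: le_trans (fatou mu measurableT mF _) _.
    by move=> m t _; rewrite lee_fin sqr_ge0.
  apply: limn_einf_le => m; rewrite /F -EFin_rI; last exact: L2_rint (sipB H _ _).
  rewrite lee_fin; have := tail2 k m.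
  move=> h; apply: le_trans (_ : nr (x_ (k + m)%N - x_ k) ^+ 2 <= _).
    by rewrite (nrmK H) ?sqnE //; exact: (sipB H).
  by rewrite ler_sqr ?nnegrE ?nrm_ge0 ?p20.
have Ll : L2 l.
  have h0 : L2 (l - x_ 0%N).
    split; last by rewrite norm2E ?ltry //; case: (fat 0%N).
    move=> i j; rewrite ord1.
    have [m1 m2] : cmeas (fun t => l t i 0 - x_ 0%N t i 0).
      apply: cmeasD; first exact: ml.
      by apply: (@cmeasN _ (fun t => x_ 0%N t i 0)); case: (hx 0%N i).
    by split; [move: m1|move: m2]; congr (measurable_fun _ _); apply/funext => t; rewrite !mxE.
  by rewrite -[l](subrK (x_ 0%N)); exact: (sipD H).
have cl (e : R) : 0 < e -> exists K : nat, forall k, (K <= k)%N -> nr (x_ k - l) < e.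
  move=> e0; have e4 : 0 < (e / 4) ^+ 2 by rewrite exprn_gt0 // divr_gt0.
  have [K hK] := quarter_pow_small e4; exists K => k /hK h.
  apply: (@le_lt_trans _ _ (2 * 2^-1 ^+ k)).
    rewrite (nrm_distC H) // -ler_sqr ?nnegrE ?nrm_ge0 ?p20 //.
    by rewrite (nrmK H) ?sqnE; [case: (fat k)|exact: (sipB H)].
  have : 2^-1 ^+ k <= e / 4.
    rewrite -ler_sqr ?nnegrE ?p0 ?divr_ge0 ?(ltW e0) //.
    apply: le_trans h; rewrite -exprM mulnC exprM; apply: lexx_eq.
    by congr (_ ^+ _); rewrite exprVn -natrX.
  lra.
exists l => //; apply: Pcl Px Ll _ => e /cl [K hK]; exists K; exact: hK.
Qed.

End VectorL2.

(** * Uniqueness of Fourier coefficients *)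

Section FourierUniqueness.
Variable R : realType.
Local Notation C := R[i].
Local Notation mu := (circle R).
Local Notation leb := (@lebesgue_measure R).
Local Notation TR := (measurableTypeR R).
Local Notation meas := (measurable_fun [set: TR]).
Local Notation rI := (Rintegral mu setT).
Local Notation normc := (@Normc.normc R).
Local Notation D01 := (`[0%R, 1%R]%classic : set TR).

Lemma circleE (A : set TR) : A `<=` D01 -> mu A = leb A.
Proof.
move=> AD; rewrite /circle /= /mrestr /=; congr (leb _).
by apply/setIidPl.
Qed.

Lemma ae_circle_itv : \forall t \ae mu, D01 t.
Proof.
exists (~` D01); split => //.
  by apply: measurableC; exact: measurable_itv.
rewrite /circle /= /mrestr /=.
by rewrite (_ : ~` D01 `&` D01 = set0) ?measure0 // setICl.
Qed.

Lemma ae_circle_lebesgue (P : TR -> Prop) :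
  (\forall t \ae leb, D01 t -> P t) -> \forall t \ae mu, P t.
Proof.
move=> [A [mA A0 PA]]; suff : \forall t \ae mu, D01 t -> P t.
  by apply: filterS2 ae_circle_itv => t h; apply.
exists A; split => //; apply/eqP; rewrite eq_le measure_ge0 andbT -A0.
rewrite /circle /= /mrestr /=; apply: le_measure; rewrite ?inE //.
by apply: measurableI => //; exact: measurable_itv.
Qed.

Lemma ae_circle_neq (a : R) : \forall t \ae mu, t != a.
Proof.
apply: ae_circle_lebesgue; exists [set a]; split => //.
  by rewrite lebesgue_measure_set1.
by move=> t /= /not_implyP[_ /negP]; rewrite negbK => /eqP ->.
Qed.

Lemma integral_circle (v : TR -> \bar R) : measurable_fun setT v ->
  (\int[mu]_t v t = \int[leb]_(t in D01) v t)%E.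
Proof.
move=> mv; have mD : measurable D01 by exact: measurable_itv.
transitivity (\int[mu]_(t in D01) v t)%E.
  rewrite [RHS]integral_mkcond; apply: ae_eq_integral => //.
    by apply/(measurable_restrictT _ mD); exact: measurable_funS mv.
  apply: filterS ae_circle_itv => t Dt _.
  by rewrite patchE mem_set.
by apply: eq_measure_integral => A mA AD; exact: circleE.
Qed.

(** The indefinite integral of u, extended by 0 outside [0, 1], vanishes identically, and its
    derivative is u almost everywhere by Lebesgue differentiation. *)
Lemma eq0_of_initial_integrals (u : TR -> R) : rint u ->
  (forall y : R, rI (fun t => u t * (t <= y)%R%:R) = 0) -> \forall t \ae mu, u t = 0.
Proof.
move=> iu hu; have mu_ := rint_meas iu.
have mD : measurable D01 by exact: measurable_itv.
pose g := u \_ D01.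
have ig : leb.-integrable setT (EFin \o g).
  rewrite /g -restrict_EFin; apply/(integrable_mkcond _ mD).
  have /integrableP[m1 h] := iu; apply/integrableP; split.
    by apply: measurable_funS m1.
  rewrite -integral_circle //; exact: measurableT_comp.
have gy y : leb.-integrable `]-oo, y] (EFin \o g).
  by apply: integrableS ig.
have lg : locally_integrable setT g by exact: open_integrable_locally openT ig.
have F0 y : (\int[leb]_(t in `]-oo, y]) g t) = 0.
  rewrite -[RHS](hu y) Rintegral_mkcond /Rintegral; congr fine.
  rewrite integral_circle; last first.
    apply/measurable_EFinP; apply: measurable_funM => //.
    apply: measurableT_comp => //.
    by apply: measurable_fun_ler.
  rewrite [RHS]integral_mkcond; apply: eq_integral => t _.
  have e1 : (t \in (`]-oo, y]%classic : set TR)) = (t <= y).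
    by apply/idP/idP; rewrite inE /= in_itv.
  rewrite /g !patchE e1.
  by case: (t <= y); case: (t \in D01); rewrite ?mulr1 ?mulr0.
have := FTC1Ny gy lg; rewrite /= => h.
have LF : Filter (nbhs (almost_everywhere leb)) by exact: ae_filter_ringOfSetsType.
apply: ae_circle_lebesgue; move: h; apply: filterS => t [_].
rewrite (_ : (fun x => _) = cst 0); last by apply/funext => y; exact: F0.
rewrite derive1_cst => gt Dt; have : g t = 0 by [].
by rewrite /g patchE mem_set.
Qed.

End FourierUniqueness.

(** * Trigonometric polynomials approximating the indicators of arcs *)

Section TrigKernel.
Variable R : realType.
Local Notation C := R[i].
Local Notation mu := (circle R).
Local Notation TR := (measurableTypeR R).
Local Notation meas := (measurable_fun [set: TR]).
Local Notation rI := (Rintegral mu setT).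
Local Notation normc := (@Normc.normc R).

(** A trigonometric polynomial written as z^-k p(z), so that products and sums reduce to polynomial
    arithmetic. *)
Definition trigc (T : TR -> C) :=
  exists (k : nat) (p : {poly C}), forall t, T t = (zT t ^+ k)^-1 * p.[zT t].

Lemma trigc_cst c : trigc (fun=> c).
Proof. by exists 0%N, c%:P => t; rewrite expr0 invr1 mul1r hornerC. Qed.

Lemma trigcM S T : trigc S -> trigc T -> trigc (fun t => S t * T t).
Proof.
move=> [k [p hp]] [l [q hq]]; exists (k + l)%N, (p * q) => t.
by rewrite hp hq hornerM exprD invfM mulrACA.
Qed.

Lemma trigcD S T : trigc S -> trigc T -> trigc (fun t => S t + T t).
Proof.
move=> [k [p hp]] [l [q hq]]; exists (k + l)%N, ('X^l * p + 'X^k * q) => t.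
rewrite hp hq hornerD !hornerM !hornerXn exprD mulrDr; congr (_ + _).
  by field; rewrite !expf_neq0 ?zT_neq0.
by field; rewrite !expf_neq0 ?zT_neq0.
Qed.

Lemma trigcX S (k : nat) : trigc S -> trigc (fun t => S t ^+ k).
Proof.
move=> hS; elim: k => [|k IH]; first exact: (trigc_cst 1).
by under eq_fun do rewrite exprS; exact: trigcM.
Qed.

Lemma trigc_ext S T : S =1 T -> trigc S -> trigc T.
Proof. by move=> ST [k [p hp]]; exists k, p => t; rewrite -ST hp. Qed.

Lemma cintegral_trigc (f T : TR -> C) : cint f -> (forall j, fcoef f j = 0) ->
  trigc T -> cintegral (fun t => f t * T t) = 0.
Proof.
move=> fi f0 [k [p hT]].
pose F (i : 'I_(size p)) t := p`_i * (f t * zT t ^ (- (k%:Z - i%:Z))).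
have Fi i : cint (F i).
  apply: cintZ; under eq_fun do rewrite mulrC; apply: bdd_cintM => //; exact: bdd_zTX.
have -> : (fun t => f t * T t) = (fun t => \sum_i F i t).
  apply/funext => t; rewrite hT horner_coef mulrCA !mulr_sumr; apply: eq_bigr => i _.
  rewrite /F opprB expfzDr ?zT_neq0 // -exprnP exprnN; ring.
rewrite cI_sum // big1 // => i _; rewrite cI_Z; first by rewrite [cintegral _]f0 mulr0.
under eq_fun do rewrite mulrC; apply: bdd_cintM => //; exact: bdd_zTX.
Qed.

Definition rtrig (r : TR -> R) := trigc (fun t => (r t)%:C%C).

Lemma rtrig_cst c : rtrig (fun=> c). Proof. exact: trigc_cst. Qed.
Lemma rtrigD r s : rtrig r -> rtrig s -> rtrig (fun t => r t + s t).
Proof. by move=> hr hs; apply: trigc_ext (trigcD hr hs) => t; rewrite rmorphD. Qed.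
Lemma rtrigM r s : rtrig r -> rtrig s -> rtrig (fun t => r t * s t).
Proof. by move=> hr hs; apply: trigc_ext (trigcM hr hs) => t; rewrite rmorphM. Qed.
Lemma rtrigX r k : rtrig r -> rtrig (fun t => r t ^+ k).
Proof. by move=> hr; apply: trigc_ext (trigcX k hr) => t; rewrite rmorphXn. Qed.
Lemma rtrigZ c r : rtrig r -> rtrig (fun t => c * r t).
Proof. by move=> hr; apply: rtrigM => //; exact: rtrig_cst. Qed.

Lemma rtrig_cos : rtrig (fun t => cos (2 * pi * t)).
Proof.
exists 1%N, (2^-1 *: ('X^2 + 1%:P)) => t.
rewrite hornerZ hornerD hornerXn hornerC expr1; apply: (@mulfI _ (2 : C)); first by rewrite pnatr_eq0.
transitivity (zT t + (zT t)^-1); first by rewrite -zT_conj; exact/esym/addcJ.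
by field; rewrite zT_neq0.
Qed.

Lemma rtrig_sin : rtrig (fun t => sin (2 * pi * t)).
Proof.
exists 1%N, ((2 * 'i%C)^-1 *: ('X^2 + (-1)%:P)) => t.
have i0 : 'i%C != 0 :> C by rewrite eq_complex /= oner_eq0 andbF.
rewrite hornerZ hornerD hornerXn hornerC expr1.
apply: (@mulfI _ (2 * 'i%C : C)); first by rewrite mulf_neq0 // pnatr_eq0.
transitivity (zT t - (zT t)^-1); last by field; rewrite zT_neq0 i0.
rewrite -zT_conj subcJ mulrAC; apply: complex_ext => /=; ring.
Qed.

(** A trigonometric polynomial of degree one, since the product of the two sines of half frequency
    is a difference of cosines. Its values lie in [0, 1]; they exceed 1/2 for 0 < t < x and are
    below 1/2 for x < t < 1. *)
Definition bump_arc (x t : R) := 2^-1 + 2^-1 * (sin (pi * t) * sin (pi * (x - t))).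

Lemma sinMsin (a b : R) : sin a * sin b = 2^-1 * (cos (a - b) - cos (a + b)).
Proof. by rewrite cosB cosD; field. Qed.

Lemma rtrig_bump x : rtrig (bump_arc x).
Proof.
have e t : bump_arc x t = (2^-1 - 4^-1 * cos (pi * x)) + 
   (4^-1 * cos (pi * x)) * cos (2 * pi * t) + (4^-1 * sin (pi * x)) * sin (2 * pi * t).
  rewrite /bump_arc sinMsin.
  have -> : pi * t + pi * (x - t) = pi * x by ring.
  have -> : pi * t - pi * (x - t) = 2 * pi * t - pi * x by ring.
  by rewrite cosB; field.
apply: trigc_ext (_ : rtrig _) => [t|]; first by rewrite e.
apply: rtrigD; last exact/rtrigZ/rtrig_sin.
by apply: rtrigD; [exact: rtrig_cst|exact/rtrigZ/rtrig_cos].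
Qed.

Lemma bump_ge0 x t : 0 <= bump_arc x t.
Proof.
rewrite /bump_arc; have := sin_max (pi * t); have := sin_max (pi * (x - t)).
rewrite !ler_norml => /andP[] h1 h2 /andP[] h3 h4; nra.
Qed.
Lemma bump_le1 x t : bump_arc x t <= 1.
Proof.
rewrite /bump_arc; have := sin_max (pi * t); have := sin_max (pi * (x - t)).
rewrite !ler_norml => /andP[] h1 h2 /andP[] h3 h4; nra.
Qed.

Lemma bump_in x t : 0 < t < 1 -> 0 < x < 1 -> t < x -> 2^-1 < bump_arc x t.
Proof.
move=> /andP[t0 t1] /andP[x0 x1] tx; rewrite /bump_arc ltrDl.
have p0 := pi_gt0 R.
by rewrite !mulr_gt0 ?invr_gt0 // sin_gt0_pi //; apply/andP; split; nra.
Qed.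
Lemma bump_out x t : 0 < t < 1 -> 0 < x < 1 -> x < t -> bump_arc x t < 2^-1.
Proof.
move=> /andP[t0 t1] /andP[x0 x1] tx; rewrite /bump_arc gtrDl.
have p0 := pi_gt0 R.
have -> : pi * (x - t) = - (pi * (t - x)) by ring.
rewrite sinN mulrN mulrN oppr_lt0.
by rewrite !mulr_gt0 ?invr_gt0 // sin_gt0_pi //; apply/andP; split; nra.
Qed.

(** The polynomials used in elementary proofs of the Stone-Weierstrass theorem: (1 - r^n)^(2^n)
    behaves like exp(-(2r)^n), so on [0, 1] they approach the step at r = 1/2. *)
Definition step_pow (n : nat) (r : R) := 1 - (1 - r ^+ n) ^+ (2 ^ n).

Lemma bernoulli (y : R) (n : nat) : -1 <= y -> 1 + n%:R * y <= (1 + y) ^+ n.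
Proof.
move=> y1; elim: n => [|n IH]; first by rewrite mul0r addr0 expr0.
rewrite exprS -natr1; have h : 0 <= 1 + y by lra.
have := ler_wpM2l h IH; have n0 : 0 <= n%:R :> R by [].
by move: (n%:R) n0 ((1 + y) ^+ n) => a a0 b; nra.
Qed.

Lemma step_pow_itv n r : 0 <= r <= 1 -> 0 <= step_pow n r <= 1.
Proof.
move=> /andP[r0 r1]; have h0 : 0 <= r ^+ n by rewrite exprn_ge0.
have h1 : r ^+ n <= 1 by rewrite exprn_ile1.
have a0 : 0 <= 1 - r ^+ n by rewrite subr_ge0.
have a1 : 1 - r ^+ n <= 1 by rewrite lerBlDr lerDl.
rewrite /step_pow subr_ge0 exprn_ile1 //= lerBlDr lerDl exprn_ge0 //.
Qed.

Lemma step_pow_small r : 0 <= r < 2^-1 -> step_pow n r @[n --> \oo] --> (0 : R).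
Proof.
move=> /andP[r0 r1]; apply: (@squeeze_cvgr _ _ _ _ (cst 0) (fun n => (2 * r) ^+ n)).
- apply: nearW => n; apply/andP; split.
    by have /andP[] : 0 <= step_pow n r <= 1 by apply: step_pow_itv; apply/andP; split; lra.
  rewrite /step_pow lerBlDr -lerBlDl; apply: le_trans (bernoulli _ _); last first.
    rewrite lerNl opprK exprn_ile1 //; lra.
  by rewrite mulrN natrX -exprMn.
- exact: cvg_cst.
- by apply: cvg_expr; rewrite ger0_norm; lra.
Qed.

Lemma step_pow_large r : 2^-1 < r <= 1 -> step_pow n r @[n --> \oo] --> (1 : R).
Proof.
move=> /andP[r0 r1].
apply: (@squeeze_cvgr _ _ _ _ (fun n => 1 - ((2 * r)^-1) ^+ n) (cst 1)).
- apply: nearW => n; apply/andP; split; last first.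
    by have /andP[] : 0 <= step_pow n r <= 1 by apply: step_pow_itv; apply/andP; split; lra.
  rewrite lerD2l lerN2.
  have y0 : 0 < r ^+ n by rewrite exprn_gt0 //; lra.
  have y1 : r ^+ n <= 1 by rewrite exprn_ile1 //; lra.
  have B : 1 + (2 ^ n)%:R * r ^+ n <= (1 + r ^+ n) ^+ (2 ^ n) by apply: bernoulli; lra.
  (* As (1 - y)(1 + y) <= 1, Bernoulli's inequality for 1 + y bounds (1 - y)^N by 1 / (N y), with y
     = r^n and N = 2^n. *)
  have p : (1 - r ^+ n) ^+ (2 ^ n) * (1 + r ^+ n) ^+ (2 ^ n) <= 1.
    rewrite -exprMn exprn_ile1 //; nra.
  have q : 0 <= (1 - r ^+ n) ^+ (2 ^ n) by rewrite exprn_ge0 // subr_ge0.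
  have s0 : 0 < (2 * r) ^+ n by rewrite exprn_gt0 //; lra.
  rewrite exprVn -[_^-1]mul1r ler_pdivlMr //; apply: le_trans p.
  rewrite ler_wpM2l //; apply: le_trans B; rewrite natrX -exprMn.
  by rewrite lerDr.
- rewrite -[X in _ --> X]subr0; apply: cvgB; first exact: cvg_cst.
  apply: cvg_expr; rewrite ger0_norm ?invr_ge0; last by lra.
  by rewrite invf_lt1; lra.
- exact: cvg_cst.
Qed.

(** Steps composed with [bump_arc] are trigonometric polynomials with values in [0, 1] that tend
    almost everywhere to the indicator of [0, y]; dominated convergence reduces the claim to initial
    integrals. *)
Lemma eq0_of_trig_integrals (u : TR -> R) : rint u ->
  (forall T, rtrig T -> rI (fun t => u t * T t) = 0) -> \forall t \ae mu, u t = 0.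
Proof.
move=> iu hu; apply: eq0_of_initial_integrals => // y.
have mu_ := rint_meas iu.
have mle (z : R) : meas (fun t => (t <= z)%R%:R : R).
  by apply: measurableT_comp => //; apply: measurable_fun_ler.
(* The bump requires 0 < y < 1. On the circle the indicator is 0 almost everywhere for y <= 0, and
   for y >= 1 it is the trigonometric polynomial 1. *)
have [y0|y0] := leP y 0.
  rewrite -(rI_cst 0); apply: rI_ae => //; first exact: measurable_funM.
  apply: filterS2 (@ae_circle_itv R) (ae_circle_neq 0) => t /= ht t0.
  have : t <= y = false.
    apply/negbTE; rewrite -ltNge (le_lt_trans y0) // lt_neqAle eq_sym t0.
    by move: ht; rewrite in_itv /= => /andP[].
  by move=> ->; rewrite mulr0.
have [y1|y1] := leP 1 y.
  rewrite -(hu _ (rtrig_cst 1)); apply: rI_ae; [exact: measurable_funM|exact: measurable_funM|].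
  apply: filterS (@ae_circle_itv R) => t /=; rewrite in_itv /= => /andP[_ ht].
  by rewrite (le_trans ht y1).
pose T n t := step_pow n (bump_arc y t).
have rT n : rtrig (T n).
  rewrite /T /step_pow; apply: rtrigD; first exact: rtrig_cst.
  apply: trigc_ext (_ : rtrig (fun t => -1 * (1 + (-1) * bump_arc y t ^+ n) ^+ (2 ^ n))) => [t|].
    by rewrite !mulN1r.
  apply: rtrigZ; apply: rtrigX; apply: rtrigD; first exact: rtrig_cst.
  by apply/rtrigZ/rtrigX/rtrig_bump.
have mT n : meas (T n).
  have mb : meas (bump_arc y).
    rewrite /bump_arc; apply: measurable_funD => //; apply: measurable_funM => //.
    apply: measurable_funM.
      apply: (measurableT_comp (f := @sin R)); first exact: continuous_measurable_fun (@continuous_sin R).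
      exact: measurable_funM.
    apply: (measurableT_comp (f := @sin R)); first exact: continuous_measurable_fun (@continuous_sin R).
    by apply: measurable_funM => //; exact: measurable_funB.
  rewrite /T /step_pow; apply: measurable_funB => //; apply: measurable_funX.
  by apply: measurable_funB => //; exact: measurable_funX.
have T01 n t : 0 <= T n t <= 1 by apply: step_pow_itv; rewrite bump_ge0 bump_le1.
have mg : measurable_fun setT (fun t => (u t * (t <= y)%R%:R)%:E).
  by apply/measurable_EFinP; exact: measurable_funM.
have [] := @dominated_convergence _ TR R mu setT measurableT
   (fun n t => (u t * T n t)%:E) (fun t => (u t * (t <= y)%R%:R)%:E)
   (fun t => `|u t|%:E) _ mg _ (rint_norm iu) _.
- by move=> n; apply/measurable_EFinP; exact: measurable_funM.
- have ae2 : \forall t \ae mu, [/\ (t : R) != 0, t != 1 & t != y].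
    have h01 : \forall t \ae mu, (t : R) != 0 /\ t != 1.
      by apply: filterS2 (@ae_circle_neq R 0) (@ae_circle_neq R 1) => t.
    by apply: filterS2 h01 (@ae_circle_neq R y) => t [].
  apply: filterS2 (@ae_circle_itv R) ae2 => t ht [t0 t1 ty] _.
  have t01 : 0 < t < 1.
    move: ht; rewrite /= in_itv /= => /andP[h0 h1].
    by rewrite !lt_neqAle h0 h1 eq_sym t0 t1.
  have y01 : 0 < y < 1 by rewrite y0.
  apply/fine_cvgP; split; first exact: nearW.
  apply: (@cvgM _ _ _ _ (fun _ => u t) (fun n => T n t)); first exact: cvg_cst.
  rewrite /T; have [lty|yt] := ltP t y.
    rewrite (ltW lty); apply: step_pow_large; rewrite bump_le1 andbT.
    exact: bump_in.
  have {}yt : y < t by rewrite lt_neqAle eq_sym ty.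
  rewrite leNgt yt; apply: step_pow_small; rewrite bump_ge0.
  exact: bump_out.
- apply: nearW => t n _ /=; rewrite lee_fin normrM ler_piMr //.
  by have /andP[h1 h2] := T01 n t; rewrite ger0_norm.
move=> ig _ lim; rewrite /Rintegral.
have e0 n : (\int[mu]_t (u t * T n t)%:E = 0)%E.
  have iuT : rint (fun t => u t * T n t).
    apply: rint_le iu _; first exact: measurable_funM.
    move=> t; rewrite normrM ler_piMr //.
    by have /andP[h1 h2] := T01 n t; rewrite ger0_norm.
  by rewrite -EFin_rI // hu.
move: lim; under eq_fun do rewrite /= e0; move=> lim.
have h0 : (fun=> 0%E : \bar R) @ \oo --> (0%E : \bar R) by exact: cvg_cst.
by rewrite (cvg_unique _ lim h0).
Qed.

Lemma cI_eq0_fcoef (f : TR -> C) : cint f -> (forall j, fcoef f j = 0) ->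
  \forall t \ae mu, f t = 0.
Proof.
move=> fi f0; have [f1 f2] := fi.
have key T : rtrig T -> cintegral (fun t => f t * (T t)%:C%C) = 0.
  exact: cintegral_trigc.
have h1 : \forall t \ae mu, complex.Re (f t) = 0.
  apply: eq0_of_trig_integrals => // T /key /(congr1 (@complex.Re R)) /= h.
  by rewrite -[RHS]h; apply: eq_Rintegral => t _; rewrite cReM /= mulr0 subr0.
have h2 : \forall t \ae mu, complex.Im (f t) = 0.
  apply: eq0_of_trig_integrals => // T /key /(congr1 (@complex.Im R)) /= h.
  by rewrite -[RHS]h; apply: eq_Rintegral => t _; rewrite cImM /= mulr0 add0r.
by apply: filterS2 h1 h2 => t h1 h2; apply: complex_ext.
Qed.

End TrigKernel.

(** * Vanishing means of the nontrivial exponentials *)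

Section Exponentials.
Variable R : realType.
Local Notation C := R[i].
Local Notation mu := (circle R).
Local Notation leb := (@lebesgue_measure R).
Local Notation TR := (measurableTypeR R).
Local Notation rI := (Rintegral mu setT).

Lemma zTX (t : R) (k : nat) :
  zT t ^+ k = Complex (cos (2 * pi * k%:R * t)) (sin (2 * pi * k%:R * t)).
Proof.
elim: k => [|k IH]; first by rewrite expr0 mulr0 mul0r cos0 sin0.
have -> : 2 * pi * k.+1%:R * t = 2 * pi * t + 2 * pi * k%:R * t by rewrite -natr1; ring.
rewrite exprS IH /zT cosD sinD.
apply: complex_ext; rewrite ?cReM ?cImM /=; ring.
Qed.

Lemma rI_deriv (F f : R -> R) : (forall t : R, is_derive t (1 : R) F (f t)) ->
  continuous f -> rI f = F 1 - F 0.
Proof.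
move=> dF cf; have cF : continuous F.
  by move=> t; apply: differentiable_continuous; apply/derivable1_diffP; case: (dF t).
rewrite /Rintegral integral_circle; last first.
  by apply/measurable_EFinP; exact: continuous_measurable_fun.
rewrite (@continuous_FTC2 _ f F) //=.
- by apply: continuous_subspaceT.
- split; first by move=> t _; case: (dF t).
    by apply: cvg_at_right_filter; exact: cF.
  by apply: cvg_at_left_filter; exact: cF.
- by move=> t _; rewrite derive1E; apply: derive_val.
Qed.

Lemma cI_zTX (k : nat) : (0 < k)%N -> cintegral (fun t : R => zT t ^+ k) = 0.
Proof.
move=> k0; pose w : R := 2 * pi * k%:R.
have w0 : w != 0 by rewrite /w !mulf_neq0 ?pnatr_eq0 // ?gt_eqF ?pi_gt0 // -lt0n.
have e1 : zT (1 : R) ^+ k = 1.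
  have -> : zT (1 : R) = 1 by rewrite /zT mulr1 [2 * _]mulrC mulr_natr cos2pi sin2pi.
  by rewrite expr1n.
have [cw sw] : cos w = 1 /\ sin w = 0.
  by move: e1; rewrite zTX mulr1 => -[].
have lin : continuous (fun t : R => w * t) by apply: mulrl_continuous.
apply: complex_ext => /=; rewrite /cintegral /=.
  transitivity (rI (fun t => cos (w * t))).
    by apply: eq_Rintegral => t _; rewrite zTX.
  have dF (t : R) : is_derive t (1 : R) (fun t => w^-1 * sin (w * t)) (cos (w * t)).
    by apply: is_derive_eq; rewrite /GRing.scale /=; field; exact: w0.
  rewrite (rI_deriv dF); first by rewrite mulr1 mulr0 sin0 sw subrr.
  by move=> t; apply: continuous_comp; [exact: lin|exact: continuous_cos].
transitivity (rI (fun t => sin (w * t))).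
  by apply: eq_Rintegral => t _; rewrite zTX.
have dF (t : R) : is_derive t (1 : R) (fun t => - w^-1 * cos (w * t)) (sin (w * t)).
  by apply: is_derive_eq; rewrite /GRing.scale /=; field; exact: w0.
rewrite (rI_deriv dF); first by rewrite mulr1 mulr0 cos0 cw subrr.
by move=> t; apply: continuous_comp; [exact: lin|exact: continuous_sin].
Qed.

Lemma cI_zTz (k : int) : k != 0 -> cintegral (fun t : R => zT t ^ k) = 0.
Proof.
case: k => k k0; first by rewrite (cI_zTX (k := k)) // lt0n.
transitivity ((cintegral (fun t : R => zT t ^+ k.+1))^*); last first.
  by rewrite cI_zTX // rmorph0.
rewrite -cI_conj; last exact/sqint_cint/bdd_sqint/(bdd_zTX _ k.+1).
by congr (cintegral _); apply/funext => t; rewrite rmorphXn /= zT_conj exprVn NegzE -exprnN.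
Qed.

End Exponentials.

(** * Hardy spaces *)

Section HardySpace.
Variable R : realType.
Local Notation C := R[i].
Local Notation mu := (circle R).
Local Notation TR := (measurableTypeR R).
Local Notation rI := (Rintegral mu setT).
Local Notation normc := (@Normc.normc R).
Local Notation N := (sqn (@inner2 R _)).
Local Notation nr := (nrm (@inner2 R _)).
Local Notation HS n := (@L2_semi_ip R n).

Definition inL2closure n (M : set (R -> 'cV[C]_n)) (y : R -> 'cV[C]_n) :=
  L2 y /\ forall e : R, 0 < e -> exists2 q, M q & nr (y - q) < e.

Lemma closure_projection n (M : set (R -> 'cV[C]_n)) (x : R -> 'cV[C]_n) :
  (forall m, M m -> L2 m) -> M 0 ->
  (forall a y z, M y -> M z -> M (a *: y + z)) -> L2 x ->
  exists2 y, inL2closure M y & forall m, M m -> inner2 (x - y) m = 0.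
Proof.
move=> ML M0 Mlin Lx; have H := HS n.
have Mcl m : M m -> inL2closure M m.
  move=> Mm; split; first exact: ML.
  by move=> e e0; exists m => //; rewrite subrr (nrm0 H).
have [||||y Py yM] := @projection R _ _ _ H (inL2closure M) x _ _ _ _ Lx.
- by move=> y [].
- exact: Mcl.
- move=> a y z [Ly cy] [Lz cz]; split; first exact: L2_lin.
  move=> e e0; have na : 0 <= normc a := normc_ge0 a.
  have d0 : 0 < e / (2 * (normc a + 1)) by rewrite divr_gt0 // mulr_gt0 // ltr_wpDl.
  have e2 : 0 < e / 2 by rewrite divr_gt0.
  have [q Mq hq] := cy _ d0; have [r Mr hr] := cz _ e2.
  exists (a *: q + r); first exact: Mlin.
  have -> : a *: y + z - (a *: q + r) = a *: (y - q) + (z - r).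
    by rewrite scalerBr opprD addrACA.
  have Lq := ML _ Mq; have Lr := ML _ Mr.
  apply: le_lt_trans (nrmD H _ _) _.
  - exact/(sipZ H)/(sipB H).
  - exact: (sipB H).
  rewrite (nrmZ H); last exact: (sipB H).
  have : normc a * nr (y - q) <= e / 2.
    apply: le_trans (ler_wpM2l na (ltW hq)) _.
    have : normc a / (normc a + 1) <= 1.
      by rewrite ler_pdivrMr ?mul1r ?lerDl // ltr_wpDl.
    have -> : normc a * (e / (2 * (normc a + 1))) = (e / 2) * (normc a / (normc a + 1)).
      by field; rewrite gt_eqF // ltr_wpDl.
    by move=> h; rewrite ler_piMr // ltW.
  by move=> h; rewrite [ltRHS]splitr; exact: ler_ltD.
- apply: L2_fast_complete => [y []//|f_ l Pf Ll cl]; split => // e e0.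
  have e2 : 0 < e / 2 by rewrite divr_gt0.
  have [k hk] := cl _ e2; have [Lf /(_ _ e2)[q Mq hq]] := Pf k.
  exists q => //; apply: le_lt_trans (nrm_triB H Ll Lf (ML _ Mq)) _.
  have h1 := hk; rewrite (nrm_distC H Lf Ll) in h1.
  by rewrite [ltRHS]splitr; exact: (ltrD h1 hq).
by exists y => // m /Mcl; exact: yM.
Qed.

Lemma closure_orth n (M : set (R -> 'cV[C]_n)) (y r : R -> 'cV[C]_n) :
  (forall m, M m -> L2 m) -> inL2closure M y -> L2 r ->
  (forall m, M m -> inner2 m r = 0) -> inner2 y r = 0.
Proof.
move=> ML [Ly cy] Lr rM; have H := HS n; apply: Normc.eq0_normc; apply/eqP.
rewrite eq_le normc_ge0 andbT; apply/ler_addgt0Pr => e e0; rewrite add0r.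
have nr0 : 0 <= nr r by exact: nrm_ge0.
have d0 : 0 < e / (nr r + 1) by rewrite divr_gt0 // ltr_wpDl.
have [q Mq hq] := cy _ d0; have Lq := ML _ Mq.
have -> : inner2 y r = inner2 (y - q) r by rewrite (ipBl H) // (rM _ Mq) subr0.
apply: le_trans (CS H _ Lr) _; first exact: (sipB H).
apply: le_trans (ler_wpM2r nr0 (ltW hq)) _.
rewrite mulrAC ler_pdivrMr ?ltr_wpDl // ler_wpM2l ?lerDl // ltW //.
Qed.

(** The residual of the projection of x onto the closure of [M] is orthogonal to [M], hence null. *)
Lemma dense_of_orth n (M : set (R -> 'cV[C]_n)) :
  (forall m, M m -> L2 m) -> M 0 ->
  (forall a y z, M y -> M z -> M (a *: y + z)) ->
  (forall r, L2 r -> (forall m, M m -> inner2 r m = 0) -> N r = 0) ->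
  forall x (e : R), L2 x -> 0 < e -> exists2 q, M q & nr (x - q) < e.
Proof.
move=> ML M0 Mlin Mo x e Lx e0; have H := HS n.
have [y [Ly cy] yM] := closure_projection ML M0 Mlin Lx.
have e2 : 0 < e / 2 by rewrite divr_gt0.
have [q Mq hq] := cy _ e2; exists q => //.
apply: le_lt_trans (nrm_triB H Lx Ly (ML _ Mq)) _.
rewrite {1}/nrm Mo //; last exact: (sipB H).
by rewrite sqrtr0 add0r (lt_trans hq) //; lra.
Qed.

Lemma scalE (f : R -> C) t i j : scal f t i j = f t.
Proof. by rewrite /scal !ord1 mxE eqxx mulr1n. Qed.

Lemma L2_scal (f : R -> C) : L2 (scal f) <-> sqint f.
Proof.
have e i : (fun t => scal f t i 0) = f by apply/funext => t; rewrite scalE.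
split => [/L2P/(_ 0)|hf]; first by rewrite e.
by apply/L2P => i; rewrite e.
Qed.

Lemma inner2_scal (f g : R -> C) :
  inner2 (scal f) (scal g) = cintegral (fun t => f t * (g t)^*).
Proof.
by congr (cintegral _); apply/funext => t; rewrite big_ord1 !scalE.
Qed.

(** Scalar H^2; [H2P] reduces the vector-valued space to it entry by entry, as [Hinfty_hinf] does
    for bounded matrix functions and [hinf]. *)
Definition hh (f : R -> C) := sqint f /\ forall p : int, p < 0 -> fcoef f p = 0.
Definition hinf (f : R -> C) := bdd f /\ forall p : int, p < 0 -> fcoef f p = 0.

Lemma H2P n (f : R -> 'cV[C]_n) : H2 f <-> forall i, hh (fun t => f t i 0).
Proof.
split=> [[/L2P Lf af] i|hf]; first by split => // p; exact: af.
split; first by apply/L2P => i; case: (hf i).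
by move=> i j p; rewrite ord1; case: (hf i) => _; exact.
Qed.

Lemma H2_scal (f : R -> C) : H2 (scal f) <-> hh f.
Proof.
have e i : (fun t => scal f t i 0) = f by apply/funext => t; rewrite scalE.
split => [/H2P/(_ 0)|hf]; first by rewrite e.
by apply/H2P => i; rewrite e.
Qed.

Lemma mxnorm_entry (k l : nat) (A : 'M[C]_(k, l)) i j :
  ((normc (A i j))%:E <= mxnorm A)%E.
Proof.
pose x : 'cV[C]_l := delta_mx j 0.
have nx : vnorm x <= 1.
  rewrite /vnorm (bigD1 j) //= big1 => [|a aj]; last first.
    by rewrite mxE (negbTE aj) Normc.normc0 expr0n.
  by rewrite mxE !eqxx Normc.normc1 expr1n addr0 sqrtr1.
have Ax : A *m x = col j A by rewrite /x -colE.
apply: (@le_trans _ _ (vnorm (A *m x))%:E).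
  rewrite lee_fin; have := normc_le_vnorm (A *m x) i.
  by rewrite Ax mxE.
by apply: ereal_sup_ubound; exists x.
Qed.

Lemma Linfty_bdd (k l : nat) (F : R -> 'M[C]_(k, l)) : Linfty F ->
  forall i j, bdd (fun t => F t i j).
Proof.
move=> [mF nF] i j; split; first exact: mF.
have [M M0 hM] : exists2 M : R, 0 <= M & (norminfty F <= M%:E)%E.
  move: nF; case: (norminfty F) => [r _|//|_].
    by exists `|r| => //; rewrite lee_fin ler_norm.
  by exists 0 => //; rewrite leNye.
exists M => //; have /ess_supP := hM; apply: filterS => t ht.
by rewrite -lee_fin (le_trans (mxnorm_entry _ _ _)).
Qed.

Lemma Hinfty_hinf (k l : nat) (F : R -> 'M[C]_(k, l)) : Hinfty F ->
  forall i j, hinf (fun t => F t i j).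
Proof. by move=> [LF aF] i j; split; [exact: Linfty_bdd|move=> p; exact: aF]. Qed.

Lemma hh_sqint f : hh f -> sqint f. Proof. by case. Qed.
Lemma sqint_zX (f : R -> C) (j : int) : sqint f -> sqint (fun t => f t * zT t ^ j).
Proof.
by move=> hf; under eq_fun do rewrite mulrC; apply: bdd_sqintM => //; exact: bdd_zTX.
Qed.

Lemma fcoefZD (a : C) f g p : sqint f -> sqint g ->
  fcoef (fun t => a * f t + g t) p = a * fcoef f p + fcoef g p.
Proof.
move=> hf hg; rewrite /fcoef -cI_Z; last exact/sqint_cint/sqint_zX.
rewrite -cI_D; [|exact/cintZ/sqint_cint/sqint_zX|exact/sqint_cint/sqint_zX].
by congr (cintegral _); apply/funext => t; rewrite mulrDl mulrA.
Qed.

Lemma hh_lin (a : C) f g : hh f -> hh g -> hh (fun t => a * f t + g t).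
Proof.
move=> [Lf f0] [Lg g0]; split; first exact/sqintD/Lg/sqintZ.
by move=> p p0; rewrite fcoefZD // f0 // g0 // mulr0 addr0.
Qed.

Lemma hh0 : hh (fun=> 0).
Proof.
split; first exact: sqint_cst.
move=> p _; rewrite /fcoef -[RHS](cI_cst 0); congr (cintegral _).
by apply/funext => t; rewrite mul0r.
Qed.

Lemma hhD f g : hh f -> hh g -> hh (fun t => f t + g t).
Proof.
by move=> hf hg; have := hh_lin 1 hf hg; congr hh; apply/funext => t; rewrite mul1r.
Qed.
Lemma hhZ a f : hh f -> hh (fun t => a * f t).
Proof.
by move=> hf; have := hh_lin a hf hh0; congr hh; apply/funext => t; rewrite addr0.
Qed.

Lemma hh_sum (J : Type) (r : seq J) (F : J -> R -> C) :
  (forall j, hh (F j)) -> hh (fun t => \sum_(j <- r) F j t).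
Proof.
move=> hF; elim: r => [|j r IH].
  by under eq_fun do rewrite big_nil; exact: hh0.
by under eq_fun do rewrite big_cons; exact: hhD.
Qed.

Lemma hh_ae f g : cmeas g -> hh f -> (\forall t \ae mu, f t = g t) -> hh g.
Proof.
move=> mg [Lf f0] fg; have Lg := sqint_ae mg Lf fg; split => // p p0.
rewrite -(f0 p p0); apply: cI_ae.
- by apply: cmeasM => //; case: (bdd_zTX R (- p)).
- by apply: cmeasM; [case: Lf|case: (bdd_zTX R (- p))].
- by apply: filterS fg => t ->.
Qed.

Lemma hh_zTX (k : nat) : hh (fun t => zT t ^+ k).
Proof.
split; first exact/bdd_sqint/(bdd_zTX R k).
move=> p p0; rewrite /fcoef.
have -> : (fun t => zT t ^+ k * zT t ^ (- p)) = (fun t : R => zT t ^ (k%:Z - p)).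
  by apply/funext => t; rewrite expfzDr ?zT_neq0.
by apply: cI_zTz; case: p p0 => // m _; rewrite NegzE opprK -PoszD addnS.
Qed.

Definition polyfun (p : {poly C}) (t : R) : C := p.[zT t].

Lemma polyfunE p t : polyfun p t = \sum_(i < size p) p`_i * zT t ^+ i.
Proof. exact: horner_coef. Qed.

Lemma bdd_polyfun p : bdd (polyfun p).
Proof.
rewrite (_ : polyfun p = fun t => \sum_(i < size p) p`_i * zT t ^+ i); last first.
  by apply/funext => t; rewrite polyfunE.
by apply: bdd_sum => i; apply: bddM; [exact: bdd_cst|exact: (bdd_zTX R i)].
Qed.

Lemma cI_polyfun0 (r : R -> C) p : cint r ->
  (forall i : nat, cintegral (fun t => zT t ^+ i * r t) = 0) ->
  cintegral (fun t => polyfun p t * r t) = 0.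
Proof.
move=> hr r0.
have hi (i : nat) : cint (fun t => zT t ^+ i * r t).
  by apply: bdd_cintM => //; exact: (bdd_zTX R i).
rewrite (_ : (fun t => _) = fun t => \sum_(i < size p) p`_i * (zT t ^+ i * r t)).
  rewrite cI_sum; last by move=> i; exact: cintZ.
  by rewrite big1 // => i _; rewrite cI_Z // r0 mulr0.
by apply/funext => t; rewrite polyfunE mulr_suml; apply: eq_bigr => i _; rewrite mulrA.
Qed.

(** Density of the analytic polynomials in H^2. The residual of the projection onto their closure is
    orthogonal to z^j for j >= 0 by construction, and for j < 0 because f and all polynomials have
    no negative coefficients; so all its Fourier coefficients vanish. *)
Lemma hh_closure f : hh f ->
  inL2closure [set q | exists p, q = scal (polyfun p)] (scal f).
Proof.
move=> [Lf f0]; set M := [set q | _].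
have ML m : M m -> L2 m.
  by move=> [p ->]; apply/L2_scal/bdd_sqint/bdd_polyfun.
have M0 : M 0.
  by exists 0; apply/funext => t; apply/matrixP => i j; rewrite scalE /polyfun horner0 mxE.
have Mlin a y z : M y -> M z -> M (a *: y + z).
  move=> [p ->] [q ->]; exists (a *: p + q); apply/funext => t.
  by apply/matrixP => i j; rewrite !mxE !ord1 eqxx !mulr1n /polyfun hornerD hornerZ.
have Lsf : L2 (scal f) by apply/L2_scal.
have [y cy yM] := closure_projection ML M0 Mlin Lsf.
have H := HS 1; have [Ly _] := cy.
pose r := scal f - y; have Lr : L2 r by exact: (sipB H).
have Lz (j : int) : sqint (fun t : R => zT t ^ j) by exact/bdd_sqint/bdd_zTX.
have r0 j : inner2 r (scal (fun t => zT t ^ j)) = 0.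
  case: j => j.
    apply: yM; exists 'X^j; congr scal; apply/funext => t.
    by rewrite /polyfun hornerXn.
  rewrite (ipBl H) //; last exact/L2_scal/Lz.
  rewrite [X in _ - X](_ : _ = 0) ?subr0.
    rewrite inner2_scal -[RHS](f0 (Negz j)) //; congr (cintegral _).
    apply/funext => t; rewrite NegzE opprK -exprnN -exprnP rmorphV /= ?unitfE ?expf_neq0 ?zT_neq0 //.
    by rewrite rmorphXn /= zT_conj exprVn invrK.
  apply: (closure_orth ML cy); first exact/L2_scal/Lz.
  move=> _ [p ->]; rewrite inner2_scal; apply: cI_polyfun0.
    exact/cint_conj/sqint_cint/Lz.
  move=> i; rewrite -[RHS](@cI_zTz R (i + j.+1)%:Z) //; last by rewrite addnS.
  congr (cintegral _); apply/funext => t.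
  rewrite NegzE -exprnN rmorphV /= ?unitfE ?expf_neq0 ?zT_neq0 //.
  by rewrite rmorphXn /= zT_conj exprVn invrK -exprnP exprD.
have Nr : N r = 0.
  have hr : sqint (fun t => r t 0 0) by have /L2P := Lr.
  have r1 : forall j, fcoef (fun t => r t 0 0) j = 0.
    move=> j; rewrite -(r0 j) /inner2 /fcoef; congr (cintegral _); apply/funext => t.
    rewrite big_ord1 scalE; congr (_ * _); case: j => k.
      by rewrite -exprnN -exprnP rmorphXn /= zT_conj exprVn.
    rewrite NegzE opprK -exprnP -exprnN rmorphV /= ?unitfE ?expf_neq0 ?zT_neq0 //.
    by rewrite rmorphXn /= zT_conj exprVn invrK.
  have := cI_eq0_fcoef (sqint_cint hr) r1 => r2.
  rewrite -(sqn0 H); apply: sqn_ae => //; first exact: L2_0.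
  by apply: filterS r2 => t h; apply/matrixP => i j; rewrite !ord1 h mxE.
split => // e e0; have [_ cy2] := cy; have [q Mq hq] := cy2 _ e0; exists q => //.
apply: le_lt_trans (nrm_triB H Lsf Ly (ML _ Mq)) _.
by rewrite {1}/nrm -/r Nr sqrtr0 add0r.
Qed.

(** The pairing is bilinear, without conjugation, so that it applies to products of analytic
    functions: the integral is continuous in f, which reduces the claim to polynomials. *)
Lemma hh_orth (f r : R -> C) : hh f -> sqint r ->
  (forall i : nat, cintegral (fun t => zT t ^+ i * r t) = 0) ->
  cintegral (fun t => f t * r t) = 0.
Proof.
move=> hf hr r0.
have -> : cintegral (fun t => f t * r t) = inner2 (scal f) (scal (fun t => (r t)^*)).
  by rewrite inner2_scal; congr (cintegral _); apply/funext => t; rewrite conjCK.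
apply: closure_orth (hh_closure hf) _ _.
- by move=> _ [p ->]; apply/L2_scal/bdd_sqint/bdd_polyfun.
- exact/L2_scal/sqint_conj.
- move=> _ [p ->]; rewrite inner2_scal.
  under [fun t => _]eq_fun do rewrite conjCK.
  by apply: cI_polyfun0 => //; exact: sqint_cint.
Qed.

Lemma fcoef_shift (f : R -> C) (i k : nat) : (forall p : int, p < 0 -> fcoef f p = 0) -> (0 < k)%N ->
  cintegral (fun t => zT t ^+ i * (f t * zT t ^+ k)) = 0.
Proof.
move=> f0 k0; have h : - (i + k)%:Z < 0 by rewrite oppr_lt0 ltz_nat addn_gt0 k0 orbT.
rewrite -[RHS](f0 _ h); congr (cintegral _); apply/funext => t.
by rewrite opprK -exprnP exprD mulrCA [zT t ^+ i * _]mulrC mulrA.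
Qed.

(** A negative coefficient of F f is the pairing of f with F z^(k+1), which annihilates every
    monomial z^i, i >= 0, because F is analytic. *)
Lemma hinf_hhM (F f : R -> C) : hinf F -> hh f -> hh (fun t => F t * f t).
Proof.
move=> [bF F0] hf; split; first exact/bdd_sqintM/(hh_sqint hf).
case=> // k _; rewrite /fcoef NegzE opprK.
rewrite -(@hh_orth f (fun t => F t * zT t ^+ k.+1)) //.
- by congr (cintegral _); apply/funext => t; rewrite -exprnP mulrA [f t * _]mulrC.
- by apply/bdd_sqint/bddM => //; exact: (bdd_zTX R k.+1).
- by move=> i; exact: fcoef_shift.
Qed.

(** The product of two H^2 functions is only integrable; this is the form in which its lack of
    negative coefficients is used. *)
Lemma hh_hh_int (f g : R -> C) (k : nat) : hh f -> hh g -> (0 < k)%N ->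
  cintegral (fun t => f t * g t * zT t ^+ k) = 0.
Proof.
move=> hf [Lg g0] k0; rewrite -(@hh_orth f (fun t => g t * zT t ^+ k)) //.
- by congr (cintegral _); apply/funext => t; rewrite mulrA.
- exact: (sqint_zX k).
- by move=> i; exact: fcoef_shift.
Qed.

Lemma hinf_z : hinf (@zT R).
Proof.
split; first exact: bdd_zT.
have [_ h] := hh_zTX 1; by move=> p /h; under [fun t => zT t ^+ 1]eq_fun do rewrite expr1.
Qed.

Lemma H2minus_conj n (f : R -> 'cV[C]_n) : H2 f ->
  H2minus (fun t => \col_i (zT t * f t i 0)^*).
Proof.
move=> /H2P hf.
have hz i : hh (fun t => zT t * f t i 0) by apply: hinf_hhM => //; exact: hinf_z.
have e i : (fun t => (\col_i (zT t * f t i 0)^* : 'cV[C]_n) i 0) = (fun t => (zT t * f t i 0)^*).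
  by apply/funext => t; rewrite mxE.
split; first by apply/L2P => i; rewrite e; exact/sqint_conj/hh_sqint.
move=> g /H2P hg; rewrite /inner2.
have ci i : cint (fun t => (zT t * f t i 0)^* * (g t i 0)^*).
  by apply: sqintMc; [exact/sqint_conj/hh_sqint|exact: hh_sqint].
rewrite (_ : (fun t => _) = fun t => \sum_i (zT t * f t i 0)^* * (g t i 0)^*); last first.
  by apply/funext => t; apply: eq_bigr => i _; rewrite mxE.
rewrite cI_sum // big1 // => i _.
rewrite (_ : (fun t => _) = fun t => (f t i 0 * g t i 0 * zT t ^+ 1)^*); last first.
  by apply/funext => t; rewrite -rmorphM /=; congr (_^*); ring.
rewrite cI_conj; last first.
  have := sqintM (hh_sqint (hz i)) (hh_sqint (hg i)); congr cint.
  by apply/funext => t; ring.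
by rewrite hh_hh_int // rmorph0.
Qed.

(** The coefficient of index -(k+1) of an entry of conj(z g) is the conjugate of the pairing of g
    with z^k times a basis vector. *)
Lemma conj_H2minus n (g : R -> 'cV[C]_n) : H2minus g ->
  H2 (fun t => \col_i (zT t * g t i 0)^*).
Proof.
move=> [/L2P Lg og]; apply/H2P => i.
rewrite (_ : (fun t => _) = fun t => (zT t * g t i 0)^*); last first.
  by apply/funext => t; rewrite mxE.
have Lz : sqint (fun t => zT t * g t i 0) by apply: bdd_sqintM => //; exact: bdd_zT.
split; first exact: sqint_conj.
case=> // k _; rewrite /fcoef NegzE opprK.
pose e (t : R) : 'cV[C]_n := \col_j (if j == i then zT t ^+ k else 0).
have He : H2 e.
  apply/H2P => j; rewrite (_ : (fun t => _) = fun t => if j == i then zT t ^+ k else 0).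
    by case: (j == i); [exact: hh_zTX|exact: hh0].
  by apply/funext => t; rewrite mxE.
transitivity ((inner2 g e)^*); last by rewrite og // rmorph0.
rewrite /inner2 -cI_conj; last first.
  by apply: inner2_int; [exact/L2P|case: He].
congr (cintegral _); apply/funext => t; rewrite (bigD1 i) //= big1 => [|j ji].
  rewrite mxE eqxx addr0.
  transitivity ((zT t * (zT t)^*) * ((g t i 0)^* * zT t ^+ k)).
    by rewrite rmorphM /= -exprnP exprS; ring.
  by rewrite zT_conjM mul1r rmorphM /= conjCK.
by rewrite mxE (negbTE ji) rmorph0 mulr0.
Qed.

End HardySpace.

(** * Outer and inner functions, and the dense range of a Toeplitz operator *)

Section OuterFunctions.
Variable R : realType.
Local Notation C := R[i].
Local Notation mu := (circle R).
Local Notation TR := (measurableTypeR R).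
Local Notation rI := (Rintegral mu setT).
Local Notation normc := (@Normc.normc R).
Local Notation N := (sqn (@inner2 R _)).
Local Notation nr := (nrm (@inner2 R _)).
Local Notation HS n := (@L2_semi_ip R n).

Lemma invc_conj (z : C) : z^-1 = z^* * (((normc z ^+ 2)^-1)%:C)%C.
Proof.
have [->|z0] := eqVneq z 0; first by rewrite invr0 rmorph0 mul0r.
apply: (mulfI z0); rewrite mulfV // mulrA mulcconj -rmorphM /= mulfV //.
by rewrite expf_neq0 //; apply: contra z0 => /eqP /Normc.eq0_normc ->.
Qed.

Lemma cmeas_inv (f : TR -> C) : cmeas f -> cmeas (fun t => (f t)^-1).
Proof.
move=> mf; under eq_fun do rewrite invc_conj.
apply: cmeasM; first exact: cmeas_conj.
split=> //=.
under eq_fun do rewrite -powR_inv1 ?sqr_ge0 //.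
exact: (measurableT_comp (measurable_powR (-1)) (meas_normc2 mf)).
Qed.

Lemma cmeas_indic (A : set TR) : measurable A -> cmeas (fun t => (\1_A t : R)%:C%C).
Proof. by move=> mA; split => //=; exact: measurable_indic. Qed.

Lemma bdd_indic (A : set TR) : measurable A -> bdd (fun t => (\1_A t : R)%:C%C).
Proof.
move=> mA; apply: (@bdd_le _ _ 1); first exact: cmeas_indic.
move=> t; rewrite indicE; case: (t \in A); rewrite ?Normc.normc1 //.
by rewrite Normc.normc0.
Qed.

Lemma cmeas_neq0 (f : TR -> C) : cmeas f -> measurable [set t | f t = 0].
Proof.
move=> mf; have h := meas_normc2 mf.
rewrite (_ : [set t | f t = 0] = (fun t => normc (f t) ^+ 2) @^-1` [set 0]).
  by rewrite -[X in measurable X]setTI; exact: h.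
apply/seteqP; split => t /=; first by move=> ->; rewrite Normc.normc0 expr0n.
by move/eqP; rewrite sqrf_eq0 => /eqP /Normc.eq0_normc.
Qed.

(** On the zero set of a, every product a b differs from the constant 1 by 1, so the measure of this
    set is at most the squared error of any approximation of 1 by such products. *)
Lemma neq0_of_dense (a : R -> C) : cmeas a ->
  (forall e : R, 0 < e -> exists2 b : R -> C, sqint (fun t => a t * b t) &
     (norm2 (fun t => (scal (fun=> 1) t - scal (fun t => a t * b t) t)%R) < e%:E)%E) ->
  \forall t \ae mu, a t != 0.
Proof.
move=> ma dense; pose A : set TR := [set t | a t = 0].
have mA : measurable A by exact: cmeas_neq0.
pose chi : R -> C := fun t => (\1_A t : R)%:C%C.
have Lchi : sqint chi by exact/bdd_sqint/bdd_indic.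
have H := HS 1.
have c0 : N (scal chi) = 0.
  apply/eqP; rewrite eq_le (sqn_ge0 H); last exact/L2_scal.
  rewrite andbT; apply/ler_addgt0Pr => e e0; rewrite add0r.
  have s0 : 0 < Num.sqrt e by rewrite sqrtr_gt0.
  have [b Lab] := dense _ s0.
  have L1 : L2 (scal (fun=> 1 : C)) by apply/L2_scal; exact: sqint_cst.
  have Lb : L2 (scal (fun t => a t * b t)) by apply/L2_scal.
  rewrite (norm2_nrm (sipB H L1 Lb)) lte_fin => h.
  have {}h : N (scal (fun=> 1) - scal (fun t => a t * b t)) <= e.
    rewrite -(nrmK H); last exact: (sipB H).
    rewrite -[leRHS]sqr_sqrtr ?(ltW e0) // ler_sqr ?nnegrE ?nrm_ge0 ?sqrtr_ge0 //.
    exact: ltW.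
  apply: le_trans h; rewrite !sqnE; apply: rI_le.
  - by apply: L2_rint; apply/L2_scal.
  - by apply: L2_rint; exact: (sipB H).
  - move=> t; rewrite !vnorm2E !big_ord1 scalE !mxE /= !mulr1n /chi indicE.
    have [/set_mem at0|_] := boolP (t \in A).
      by rewrite at0 mul0r subr0 lexx.
    by rewrite !(expr0n, addr0, sqrtr0) sqr_ge0.
have := sqn_eq0 (proj2 (L2_scal _) Lchi) c0.
apply: filterS => t /(congr1 (fun M : 'M[C]_1 => M 0 0)); rewrite scalE mxE /chi indicE => h.
apply/eqP => at0; move: h; rewrite mem_set //= => /eqP.
by rewrite eq_complex /= oner_eq0.
Qed.

Lemma outer_neq0 (a : R -> C) : is_outer (scal a) -> \forall t \ae mu, a t != 0.
Proof.
move=> [[Loo _] dense]; have ba : bdd a.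
  by have := Linfty_bdd Loo 0 0; under eq_fun do rewrite scalE.
apply: neq0_of_dense; first by case: ba.
have H1 : H2 (scal (fun=> 1 : C)) by apply/H2_scal; have := hh_zTX R 0.
move=> e e0; have [f /H2P/(_ 0) [Lf _] hf] := dense _ H1 e e0.
exists (fun t => f t 0 0); first exact: bdd_sqintM.
move: hf; congr (norm2 _ < _)%E; apply/funext => t; congr (_ - _).
by apply/matrixP => i j; rewrite !ord1 mxE big_ord1 !scalE.
Qed.

Lemma outerH2_neq0 (h : R -> C) : is_outerH2 h -> \forall t \ae mu, h t != 0.
Proof.
move=> [/H2_scal [Lh _] dense].
apply: neq0_of_dense; first by case: Lh.
have H1 : H2 (scal (fun=> 1 : C)) by apply/H2_scal; have := hh_zTX R 0.
move=> e e0; have [p hp] := dense _ H1 e e0; exists (polyfun p) => //.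
by under eq_fun do rewrite mulrC; apply: bdd_sqintM => //; exact: bdd_polyfun.
Qed.

Lemma inner_scal (theta : R -> C) : is_inner (scal theta) ->
  hinf theta /\ \forall t \ae mu, theta t * (theta t)^* = 1.
Proof.
move=> [Hi h]; split.
  by have := Hinfty_hinf Hi 0 0; under eq_fun do rewrite scalE.
apply: filterS h => t /(congr1 (fun M : 'M[C]_1 => M 0 0)).
by rewrite !mxE big_ord1 !mxE !eqxx !mulr1n mulrC.
Qed.

Lemma unimod_sqint (u f : R -> C) : cmeas u -> (\forall t \ae mu, u t * (u t)^* = 1) ->
  sqint f -> sqint (fun t => u t * f t).
Proof. by move=> mu_ u1; apply: bdd_sqintM; exact: bdd_norm1. Qed.

(* The Toeplitz operator with symbol u0 has dense range. *)
Lemma toeplitz_dense (h theta tau u0 : R -> C) (c : R -> C) (e : R) :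
  is_outerH2 h -> is_inner (scal theta) -> is_inner (scal tau) ->
  (forall t, u0 t = (zT t)^* * (theta t)^* * (tau t)^* * (h t)^* / h t) ->
  sqint c -> 0 < e ->
  [/\ cmeas u0, \forall t \ae mu, u0 t * (u0 t)^* = 1 &
  exists eta eta' : R -> C, [/\ hh eta, hh eta' &
    nr (scal c - scal (fun t => u0 t * eta t + (zT t * eta' t)^*)) < e]].
Proof.
move=> ho /inner_scal [th th1] /inner_scal [ta ta1] u0E Lc e0.
have h0 := outerH2_neq0 ho; have [/H2_scal hH _] := ho; have [[mh _] _] := hH.
have mth : cmeas theta by case: th => -[].
have mta : cmeas tau by case: ta => -[].
have mu0 : cmeas u0.
  rewrite (_ : u0 = fun t => (zT t)^* * (theta t)^* * (tau t)^* * (h t)^* / h t).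
    apply: cmeasM; last exact: cmeas_inv.
    apply: cmeasM; last exact: cmeas_conj.
    apply: cmeasM; last exact: cmeas_conj.
    by apply: cmeasM; apply: cmeas_conj => //; exact: cmeas_zT.
  exact/funext.
have u01 : \forall t \ae mu, u0 t * (u0 t)^* = 1.
  have tt : \forall t \ae mu, theta t * (theta t)^* = 1 /\ tau t * (tau t)^* = 1.
    by apply: filterS2 th1 ta1 => t.
  apply: filterS2 tt h0 => t [h1 h2] h3; rewrite u0E !rmorphM /= fmorphV /= !conjCK.
  transitivity ((zT t * (zT t)^*) * (theta t * (theta t)^*) * (tau t * (tau t)^*) *
     ((h t)^* / (h t)^*) * (h t / h t)); first by ring.
  by rewrite zT_conjM h1 h2 !mulfV ?conjC_eq0 // !mulr1.
split => //.
pose M : set (R -> 'cV[C]_1) := [set m | exists eta eta', [/\ hh eta, hh eta' &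
  m = scal (fun t => u0 t * eta t + (zT t * eta' t)^*)]].
have Lz f : sqint f -> sqint (fun t => (zT t * f t)^*).
  by move=> Lf; apply: sqint_conj; apply: bdd_sqintM => //; exact: bdd_zT.
have ML m : M m -> L2 m.
  move=> [eta [eta' [[Le _] [Le' _] ->]]]; apply/L2_scal/sqintD; last exact: Lz.
  exact: unimod_sqint.
have [||||_ [eta [eta' [he he' ->]]] lt_e] := @dense_of_orth R 1 M ML _ _ _ (scal c) e _ e0.
- exists (fun=> 0), (fun=> 0); split; try exact: hh0.
  by apply/funext => t; apply/matrixP => i j; rewrite scalE !mxE !mulr0 add0r rmorph0.
- move=> a _ _ [x [x' [hx hx' ->]]] [y [y' [hy hy' ->]]].
  exists (fun t => a * x t + y t), (fun t => a^* * x' t + y' t).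
  split; [exact: hh_lin|exact: hh_lin|apply/funext => t].
  apply/matrixP => i j; rewrite !mxE !ord1 !eqxx !mulr1n.
  by rewrite !rmorphM !rmorphD !rmorphM /= conjCK; ring.
- move=> r Lr rM; pose f t := r t 0 0.
  have rE : r = scal f.
    by apply/funext => t; apply/matrixP => i j; rewrite scalE /f !ord1.
  have Lf : sqint f by move/L2P: Lr => /(_ 0).
  have e1 (k : nat) : cintegral (fun t => f t * zT t ^+ k.+1) = 0.
    have := rM _ (ex_intro _ _ (ex_intro _ _ (And3 (hh0 R) (hh_zTX R k) erefl))).
    rewrite rE inner2_scal => <-; congr (cintegral _); apply/funext => t.
    by rewrite mulr0 add0r conjCK exprS.
  have hf : hh f by split => //; case=> // k _; rewrite /fcoef NegzE opprK; exact: e1.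
  pose F t := f t * (zT t * theta t * tau t * h t).
  have Lk : hh (fun t => theta t * (tau t * f t)).
    by apply: hinf_hhM => //; exact: hinf_hhM.
  have FE t : F t = zT t * (theta t * (tau t * f t) * h t) by rewrite /F; ring.
  have iF : cint F.
    rewrite (_ : F = fun t => zT t * (theta t * (tau t * f t) * h t)); last exact/funext.
    apply: bdd_cintM; first exact: bdd_zT.
    by apply: sqintM; [case: Lk|case: hH].
  have F0 j : fcoef F j = 0.
    case: j => j.
      have hhp : hh (fun t => h t * zT t ^+ j).
        have := hinf_hhM (conj (bdd_zTX R j) (hh_zTX R j).2) hH; congr hh.
        by apply/funext => t; rewrite mulrC.
      have := rM _ (ex_intro _ _ (ex_intro _ _ (And3 hhp (hh0 R) erefl))).
      rewrite rE inner2_scal => <-; apply: cI_ae.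
      + by apply: cmeasM; [exact: cint_meas|case: (bdd_zTX R (- j%:Z))].
      + apply: cmeasM; first by case: Lf.
        apply: cmeas_conj; apply: cmeasD; last by under eq_fun do rewrite mulr0 rmorph0; exact: cmeas_cst.
        by apply: cmeasM => //; case: hhp => -[].
      + apply: filterS h0 => t ht0.
        rewrite mulr0 rmorph0 addr0 /F -mulrA; congr (_ * _).
        rewrite u0E !rmorphM /= fmorphV /= !conjCK rmorphXn /= zT_conj exprVn -exprnN.
        transitivity ((zT t * theta t * tau t * h t * (zT t ^+ j)^-1) *
          ((h t)^* / (h t)^*)); last by ring.
        by rewrite mulfV ?conjC_eq0 // mulr1.
    rewrite -(@hh_hh_int _ (fun t => theta t * (tau t * f t)) h j.+2 Lk hH) //.
    congr (cintegral _); apply/funext => t.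
    by rewrite FE NegzE opprK -exprnP [zT t ^+ j.+2]exprS; ring.
  have Fz := cI_eq0_fcoef iF F0.
  rewrite -(sqn0 (HS 1)); apply: sqn_ae => //; first exact: L2_0.
  have tt : \forall t \ae mu, theta t * (theta t)^* = 1 /\ tau t * (tau t)^* = 1.
    by apply: filterS2 th1 ta1 => t.
  have tt2 : \forall t \ae mu, F t = 0 /\ h t != 0 by apply: filterS2 Fz h0 => t.
  apply: filterS2 tt tt2 => t [h1 h2] [/eqP Ft ht].
  apply/matrixP => i j; rewrite !ord1 !mxE.
  have n1 : theta t != 0 by apply/eqP => z0; move/eqP: h1; rewrite z0 mul0r eq_sym oner_eq0.
  have n2 : tau t != 0 by apply/eqP => z0; move/eqP: h2; rewrite z0 mul0r eq_sym oner_eq0.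
  move: Ft; rewrite /F !mulf_eq0 (negbTE n1) (negbTE n2) (negbTE ht) (negbTE (zT_neq0 t)).
  by rewrite !orbF => /eqP.
- exact/L2_scal.
by exists eta, eta'.
Qed.

End OuterFunctions.

(** * Compact operators *)

Section AbstractCompact.
Variables (R : realType) (V1 V2 : lmodType R[i]).
Variables (S1 : V1 -> Prop) (ip1 : V1 -> V1 -> R[i]) (S2 : V2 -> Prop) (ip2 : V2 -> V2 -> R[i]).
Hypotheses (H1 : semi_ip S1 ip1) (H2 : semi_ip S2 ip2).
Variables (D : V1 -> Prop) (K : V1 -> V2).
Hypotheses (DS : forall x, D x -> S1 x) (D0 : D 0)
  (Dlin : forall a x y, D x -> D y -> D (a *: x + y)).
Hypothesis KS : forall x, D x -> S2 (K x).
(** Linearity up to null vectors: operators act on representatives and are linear only almost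
    everywhere. *)
Hypothesis Klin : forall a x y, D x -> D y ->
  nrm ip2 (K (a *: x + y) - (a *: K x + K y)) = 0.
Hypothesis Kcpt : forall x_ : nat -> V1, (forall j, D (x_ j) /\ nrm ip1 (x_ j) <= 1) ->
  exists s : nat -> nat, exists2 g, S2 g &
   {homo s : i j / (i < j)%N} /\
   forall e : R, 0 < e -> exists J : nat, forall j, (J <= j)%N -> nrm ip2 (K (x_ (s j)) - g) < e.
Local Notation nr1 := (nrm ip1).
Local Notation nr2 := (nrm ip2).
Local Notation normc := (@Normc.normc R).

Lemma nrm_congr (x y : V2) : S2 x -> S2 y -> nr2 (x - y) = 0 -> nr2 x = nr2 y.
Proof.
move=> Sx Sy h; apply/eqP; rewrite eq_le.
have := nrm_lB H2 Sx Sy; have := nrm_lB H2 Sy Sx.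
by rewrite (nrm_distC H2 Sy Sx) h !addr0 => -> ->.
Qed.

Lemma nrm_congr_trans (x y z : V2) : S2 x -> S2 y -> S2 z ->
  nr2 (x - y) = 0 -> nr2 (y - z) = 0 -> nr2 (x - z) = 0.
Proof.
move=> Sx Sy Sz h1 h2; apply/eqP; rewrite eq_le nrm_ge0 andbT.
by have := nrm_triB H2 Sx Sy Sz; rewrite h1 h2 addr0.
Qed.

Lemma D_Z a x : D x -> D (a *: x).
Proof. by move=> Dx; rewrite -[_ *: _]addr0; apply: Dlin. Qed.
Lemma D_D x y : D x -> D y -> D (x + y).
Proof. by rewrite -{2}[x]scale1r; apply: Dlin. Qed.
Lemma D_sum (I : Type) (r : seq I) (F : I -> V1) : (forall i, D (F i)) -> D (\sum_(i <- r) F i).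
Proof. by move=> DF; apply: big_ind => //; exact: D_D. Qed.

Lemma K_0 : nr2 (K 0) = 0.
Proof.
have := Klin 1 D0 D0; rewrite scale1r addr0 scale1r opprD addrA subrr sub0r.
by rewrite (nrmN H2) //; exact: KS.
Qed.

Lemma K_Z a x : D x -> nr2 (K (a *: x) - a *: K x) = 0.
Proof.
move=> Dx; have := Klin a Dx D0; rewrite addr0 => h.
have SZ := sipZ H2 a (KS Dx); have SK0 := KS D0; have SKa := KS (D_Z a Dx).
apply: (nrm_congr_trans SKa (sipD H2 SZ SK0)) => //.
by rewrite addrAC subrr add0r K_0.
Qed.

Lemma nr_KZ a x : D x -> nr2 (K (a *: x)) = normc a * nr2 (K x).
Proof.
move=> Dx; have SKx := KS Dx; rewrite -(nrmZ H2) //; apply: nrm_congr => //.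
- exact/KS/D_Z.
- exact: (sipZ H2).
- exact: K_Z.
Qed.

Lemma K_sum n (F : nat -> V1) : (forall i, D (F i)) ->
  nr2 (K (\sum_(i < n) F i) - \sum_(i < n) K (F i)) = 0.
Proof.
move=> DF; elim: n => [|n IH]; first by rewrite !big_ord0 subr0 K_0.
have DS_ : D (\sum_(i < n) F i) by apply: D_sum => i; exact: DF.
have SS_ : S2 (\sum_(i < n) K (F i)) by apply: (sip_sum H2) => i _; exact/KS/DF.
have SKn := KS (DF n); have SKS := KS DS_.
have := Klin 1 DS_ (DF n); rewrite !scale1r => h.
rewrite !big_ord_recr /=; apply: (nrm_congr_trans _ (sipD H2 SKS SKn) _ h).
- exact/KS/D_D.
- exact: (sipD H2).
- by rewrite opprD addrACA subrr addr0.
Qed.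

Lemma homo_ge_id (s : nat -> nat) : {homo s : i j / (i < j)%N} -> forall i, (i <= s i)%N.
Proof. by move=> hs; elim=> // i /leq_ltn_trans; apply; apply: hs. Qed.

Lemma K_scale (B : R) : 0 <= B -> (forall x, D x -> nr1 x <= 1 -> nr2 (K x) <= B) ->
  forall x, D x -> nr2 (K x) <= B * nr1 x.
Proof.
move=> B0 hB x Dx; have [x0|x0] := eqVneq (nr1 x) 0.
  rewrite x0 mulr0 leNgt; apply/negP => Kx0.
  (* A null x stays in the unit ball under any scaling, and this one would give its image norm B +
     1. *)
  have := hB ((((B + 1) / nr2 (K x))%:C)%C *: x) (D_Z _ Dx).
  rewrite (nrmZ H1) ?x0 ?mulr0 ?ler01 ?nr_KZ //; last exact: DS.
  rewrite /= expr0n addr0 sqrtr_sqr ger0_norm; last by rewrite divr_ge0 ?nrm_ge0 ?addr_ge0.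
  by rewrite divfK ?gt_eqF // => /(_ isT); rewrite gerDl leNgt ltr01.
have xp : 0 < nr1 x by rewrite lt_neqAle eq_sym x0 nrm_ge0.
have := hB ((((nr1 x)^-1)%:C)%C *: x) (D_Z _ Dx).
rewrite (nrmZ H1) ?nr_KZ //; last exact: DS.
rewrite /= expr0n addr0 sqrtr_sqr ger0_norm ?invr_ge0 ?(ltW xp) // mulVf // => /(_ (lexx _)).
by rewrite mulrC ler_pdivrMr.
Qed.

(** Otherwise there are x_j in the unit ball with images of norm above j, and no subsequence of
    these images converges. *)
Lemma K_bounded : exists2 B : R, 0 <= B & forall x, D x -> nr2 (K x) <= B * nr1 x.
Proof.
suff [B B0 hB] : exists2 B : R, 0 <= B & forall x, D x -> nr1 x <= 1 -> nr2 (K x) <= B.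
  by exists B => //; exact: K_scale.
apply: contrapT => nB.
have ex (j : nat) : exists x, (D x /\ nr1 x <= 1) /\ j%:R < nr2 (K x).
  apply: contrapT => hj; apply: nB; exists j%:R => // x Dx x1.
  by rewrite leNgt; apply/negP => h; apply: hj; exists x.
have [x_ hx] := choice ex.
have [s [g Sg [hs cg]]] := Kcpt (fun j => (hx j).1).
have [J hJ] := cg 1 ltr01.
have [m hm] : exists m : nat, nr2 g + 1 < m%:R.
  exists (Num.trunc (nr2 g + 1)).+1; exact: truncnS_gt.
pose j := maxn J m; have := hJ j (leq_maxl _ _).
have [Dx _] := (hx (s j)).1; have := nrm_lB H2 (KS Dx) Sg; have := (hx (s j)).2.
have : (m%:R : R) <= (s j)%:R.
  by rewrite ler_nat (leq_trans (leq_maxr J m)) // homo_ge_id.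
lra.
Qed.

(* An orthonormal sequence along which K stays large would make K unbounded on
   normalized sums of its members. *)
Lemma compact_small (eps : R) : 0 < eps ->
  exists2 Y : seq V1, (forall y, y \in Y -> D y) &
    forall x, D x -> (forall y, y \in Y -> ip1 x y = 0) -> nr2 (K x) <= eps * nr1 x.
Proof.
move=> eps0; apply: contrapT => nY; have [B B0 hB] := K_bounded.
pose P (l : seq V1) x := (forall y, y \in l -> D y) ->
  [/\ D x, sqn ip1 x = 1, (forall y, y \in l -> ip1 x y = 0) & eps < nr2 (K x)].
have exP l : exists x, P l x.
  have [hl|hl] := pselect (forall y, y \in l -> D y); last by exists 0 => /hl.
  have [x [Dx xl hx]] : exists x, [/\ D x, (forall y, y \in l -> ip1 x y = 0) & eps * nr1 x < nr2 (K x)].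
    apply: contrapT => nx; apply: nY; exists l => // x Dx xl.
    by rewrite leNgt; apply/negP => h; apply: nx; exists x.
  have xp : 0 < nr1 x.
    rewrite lt_neqAle eq_sym nrm_ge0 andbT; apply/eqP => x0.
    have := hB x Dx; rewrite x0 mulr0 => h.
    by have := lt_le_trans hx h; rewrite x0 mulr0 ltxx.
  pose a := (((nr1 x)^-1)%:C)%C.
  have na : normc a = (nr1 x)^-1.
    by rewrite /= expr0n addr0 sqrtr_sqr ger0_norm // invr_ge0 ltW.
  exists (a *: x) => _; split.
  - exact: D_Z.
  - rewrite (sqnZ H1) ?na -?(nrmK H1) -?exprMn ?mulVf ?expr1n ?gt_eqF //; exact: DS.
  - by move=> y yl; rewrite (ipZl H1) ?xl ?mulr0 //; apply: DS => //; exact: hl.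
  - by rewrite nr_KZ // na mulrC ltr_pdivlMr.
have [x_ hx] := dependent_choice_seq exP.
have Dx k : D (x_ k).
  elim/ltn_ind: k => k IH; have [l lP hl] := hx k; have [|//] := hl.
  by move=> y /lP[i ik ->]; exact: IH.
have Px k : [/\ D (x_ k), sqn ip1 (x_ k) = 1,
     (forall i, (i < k)%N -> ip1 (x_ k) (x_ i) = 0) & eps < nr2 (K (x_ k))].
  have [l lP hl] := hx k; have [|h1 h2 h3 h4] := hl; first by move=> y /lP[i _ ->].
  by split => // i ik; apply: h3; apply/lP; exists i.
have ox i j : i != j -> ip1 (x_ i) (x_ j) = 0.
  rewrite neq_ltn => /orP[ij|ij]; last by case: (Px i) => _ _ h _; exact: h.
  by rewrite (sipC H1 (DS (Dx j)) (DS (Dx i))); case: (Px j) => _ _ -> // _; rewrite rmorph0.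
have n1 k : nr1 (x_ k) = 1 by rewrite /nrm; case: (Px k) => _ -> _ _; rewrite sqrtr1.
have [s [g Sg [hs cg]]] := Kcpt (fun j => conj (Dx j) (lexx_eq (n1 j))).
have e2 : 0 < eps / 2 by rewrite divr_gt0.
have [J hJ] := cg _ e2.
have ge : eps <= nr2 g.
  apply/ler_addgt0Pr => e e0; have [J' hJ'] := cg _ e0.
  have [_ _ _ h] := Px (s J').
  apply: ltW (lt_le_trans h _); apply: le_trans (nrm_lB H2 (KS (Dx _)) Sg) _.
  by rewrite lerD2l ltW // hJ'.
pose y_ i := x_ (s (J + i)%N).
have Dy i : D (y_ i) by exact: Dx.
(* The sum of n orthonormal vectors has norm sqrt n. Their images lie within eps/2 of g, whose norm
   is at least eps, so the image of the sum has norm at least n eps - n eps/2. *)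
have big n : n%:R * (eps / 2) <= B * Num.sqrt n%:R.
  pose z := \sum_(i < n) y_ i.
  have Dz : D z by apply: D_sum => i.
  have nz : nr1 z = Num.sqrt n%:R.
    rewrite /nrm; congr Num.sqrt.
    have -> : z = \sum_(i < n) (1 : R[i]) *: y_ i by apply: eq_bigr => i _; rewrite scale1r.
    rewrite (sqn_sum_orth H1 (F := fun i : 'I_n => y_ i)).
    - rewrite (eq_bigr (fun=> 1)); first by rewrite sumr_const card_ord.
      move=> i _; rewrite Normc.normc1 expr1n mul1r.
      by case: (Px (s (J + i)%N)).
    - by move=> i; exact/DS/Dy.
    - move=> i j ij; apply: ox; apply: contra ij => /eqP e.
      apply/eqP/val_inj/eqP; rewrite -(eqn_add2l J) eqn_leq.
      apply/andP; split; rewrite leqNgt; apply/negP => /hs; rewrite e ltnn //.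
  have Kz : nr2 (K z - \sum_(i < n) K (y_ i)) = 0 by exact: K_sum.
  have SK i : S2 (K (y_ i)) by exact/KS/Dy.
  have Ssum : S2 (\sum_(i < n) K (y_ i)) by apply: (sip_sum H2) => i _.
  have e1 : nr2 (K z) = nr2 (\sum_(i < n) K (y_ i)) by apply: nrm_congr => //; exact: KS.
  have Sng : S2 (n%:R *: g) by exact: (sipZ H2).
  have d : nr2 (n%:R *: g - \sum_(i < n) K (y_ i)) <= n%:R * (eps / 2).
    have -> : n%:R *: g - \sum_(i < n) K (y_ i) = \sum_(i < n) (g - K (y_ i)).
      by rewrite sumrB sumr_const card_ord scaler_nat.
    apply: le_trans (nrm_sum H2 _) _; first by move=> i; exact: (sipB H2).
    apply: le_trans (_ : \sum_(i < n) (eps / 2) <= _); last first.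
      by rewrite sumr_const card_ord mulr_natl.
    apply: ler_sum => i _; rewrite (nrm_distC H2) //; apply/ltW/hJ.
    by apply: leq_trans (leq_addr i J) _.
  have ng : nr2 (n%:R *: g) = n%:R * nr2 g.
    rewrite (nrmZ H2) //; congr (_ * _).
    have -> : (n%:R : R[i]) = (n%:R%:C)%C by rewrite rmorph_nat.
    by rewrite /= expr0n addr0 sqrtr_sqr ger0_norm.
  have := nrm_lB H2 Sng Ssum; have := hB z Dz; rewrite nz e1 ng.
  have : n%:R * eps <= n%:R * nr2 g by rewrite ler_wpM2l.
  by lra.
(* With n = m^2 the square root is m, and m > 2 B / eps contradicts m^2 eps/2 <= B m. *)
pose m := (Num.trunc (B / (eps / 2))).+1.
have := big (m ^ 2)%N; rewrite natrX sqrtr_sqr ger0_norm // expr2 -mulrA mulrCA.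
have m0 : 0 < (m%:R : R) by rewrite ltr0n.
rewrite [B * _]mulrC ler_pM2l // => h.
have : B / (eps / 2) < m%:R by exact: truncnS_gt.
by rewrite ltr_pdivrMr // ltNge h.
Qed.

End AbstractCompact.

(** * The operators Gamma *)

Section GammaOperator.
Variable R : realType.
Local Notation C := R[i].
Local Notation mu := (circle R).
Local Notation TR := (measurableTypeR R).
Local Notation rI := (Rintegral mu setT).
Local Notation normc := (@Normc.normc R).
Local Notation N := (sqn (@inner2 R _)).
Local Notation nr := (nrm (@inner2 R _)).
Local Notation HS n := (@L2_semi_ip R n).

(** Domain and range of Gamma are both of this form ([H2_L2E], [H2minus_L2E]), which yields their
    linearity and the orthogonal projections onto them at once. *)
Definition perp n (Q : set (R -> 'cV[C]_n)) : set (R -> 'cV[C]_n) :=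
  [set f | L2 f /\ forall r, Q r -> inner2 f r = 0].

Lemma perp_0 n (Q : set (R -> 'cV[C]_n)) : (forall r, Q r -> L2 r) -> perp Q 0.
Proof. by move=> QL; split => [|r Qr]; [exact: L2_0|rewrite (ip0l (HS n)) //; exact: QL]. Qed.

Lemma perp_lin n (Q : set (R -> 'cV[C]_n)) a f g : (forall r, Q r -> L2 r) ->
  perp Q f -> perp Q g -> perp Q (a *: f + g).
Proof.
move=> QL [Lf hf] [Lg hg]; split => [|r Qr]; first exact: L2_lin.
by rewrite (sip_lin (HS n)) ?hf ?hg ?mulr0 ?addr0 //; exact: QL.
Qed.

Lemma perp_projection n (Q : set (R -> 'cV[C]_n)) x : (forall r, Q r -> L2 r) -> L2 x ->
  exists2 y, perp Q y & forall k, perp Q k -> inner2 (x - y) k = 0.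
Proof.
move=> QL Lx; apply: (projection (HS n)) => //.
- by move=> y [].
- exact: perp_0.
- by move=> a y z; exact: perp_lin.
- apply: L2_fast_complete => [y []//|f_ l Pf Ll cl]; split => // r Qr.
  apply: (@closure_orth _ _ (perp Q)) => //.
  + by move=> m [].
  + split; [exact: Ll|move=> e /cl[k hk]; exists (f_ k); first exact: Pf].
    by rewrite (nrm_distC (HS n) Ll (Pf k).1).
  + exact: QL.
  + by move=> m [_]; exact.
Qed.

Lemma L2_col (a b : nat) (f : R -> 'cV[C]_(a + b)) :
  L2 f <-> L2 (fun t => usubmx (f t)) /\ L2 (fun t => dsubmx (f t)).
Proof.
have eu i : (fun t => usubmx (f t) i 0) = (fun t => f t (lshift b i) 0).
  by apply/funext => t; rewrite mxE.
have ed i : (fun t => dsubmx (f t) i 0) = (fun t => f t (rshift a i) 0).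
  by apply/funext => t; rewrite mxE.
split=> [/L2P Lf|[/L2P Lu /L2P Ld]].
  by split; apply/L2P => i; rewrite ?eu ?ed.
by apply/L2P => i; case: (split_ordP i) => j ->; rewrite -?eu -?ed.
Qed.

Lemma inner2_split (a b : nat) (f g : R -> 'cV[C]_(a + b)) : L2 f -> L2 g ->
  inner2 f g = inner2 (fun t => usubmx (f t)) (fun t => usubmx (g t)) +
               inner2 (fun t => dsubmx (f t)) (fun t => dsubmx (g t)).
Proof.
move=> /L2_col[fu fd] /L2_col[gu gd].
rewrite /inner2 -cI_D; [|exact: (inner2_int fu gu)|exact: (inner2_int fd gd)].
congr (cintegral _); apply/funext => t; rewrite big_split_ord /=.
by congr (_ + _); apply: eq_bigr => i _; rewrite !mxE.
Qed.

Lemma inner2_colu (a b : nat) (f : R -> 'cV[C]_(a + b)) (g : R -> 'cV[C]_a) :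
  inner2 f (fun t => col_mx (g t) 0) = inner2 (fun t => usubmx (f t)) g.
Proof.
congr (cintegral _); apply/funext => t; rewrite big_split_ord /= [X in _ + X]big1.
  by rewrite addr0; apply: eq_bigr => i _; rewrite col_mxEu mxE.
by move=> i _; rewrite col_mxEd mxE rmorph0 mulr0.
Qed.

Lemma L2_colu (a b : nat) (g : R -> 'cV[C]_a) : L2 g ->
  L2 (fun t => col_mx (g t) (0 : 'cV[C]_b)).
Proof.
move=> Lg; apply/L2_col; split.
  by under eq_fun do rewrite col_mxKu.
by under eq_fun do rewrite col_mxKd; exact: L2_0.
Qed.

Definition minusQ (m1 m2 : nat) : set (R -> 'cV[C]_(m1 + m2)) :=
  [set r | exists2 g, H2 g & r = fun t => col_mx (g t) 0].
Definition plusQ (n1 n2 : nat) : set (R -> 'cV[C]_(n1 + n2)) :=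
  [set r | exists (i : 'I_n1) (p : int), p < 0 /\
     r = fun t => col_mx (zT t ^ p *: delta_mx i 0) 0].

Lemma minusQ_L2 m1 m2 r : @minusQ m1 m2 r -> L2 r.
Proof. by move=> [g [Lg _] ->]; exact: L2_colu. Qed.
Lemma plusQ_L2 n1 n2 r : @plusQ n1 n2 r -> L2 r.
Proof.
move=> [i [p [_ ->]]]; apply: L2_colu; apply/L2P => j.
have := sqintZ (((j == i)%:R : C)) (bdd_sqint (bdd_zTX R p)); congr (sqint _).
by apply/funext => t; rewrite !mxE eqxx andbT mulrC.
Qed.

Lemma H2minus_L2E m1 m2 : @H2minus_L2 R m1 m2 = perp (@minusQ m1 m2).
Proof.
apply/seteqP; split => f.
  move=> [[Lu hu] Ld]; split; first exact/L2_col.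
  by move=> _ [g Hg ->]; rewrite inner2_colu; exact: hu.
move=> [/L2_col[Lu Ld] h]; split => //; split => // g Hg.
by rewrite -(inner2_colu (b := m2)); apply: h; exists g.
Qed.

Lemma H2_L2E n1 n2 : @H2_L2 R n1 n2 = perp (@plusQ n1 n2).
Proof.
have key (f : R -> 'cV[C]_(n1 + n2)) (i : 'I_n1) p :
    inner2 f (fun t => col_mx (zT t ^ p *: delta_mx i 0) 0) =
    fcoef (fun t => usubmx (f t) i 0) p.
  rewrite inner2_colu; congr (cintegral _); apply/funext => t.
  rewrite (bigD1 i) //= big1 => [|j ji].
    rewrite !mxE !eqxx mulr1 addr0; congr (_ * _); case: p => k.
      by rewrite -exprnN -exprnP rmorphXn /= zT_conj exprVn.
    rewrite NegzE opprK -exprnP -exprnN rmorphV /= ?unitfE ?expf_neq0 ?zT_neq0 //.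
    by rewrite rmorphXn /= zT_conj exprVn invrK.
  by rewrite !mxE (negbTE ji) mulr0 rmorph0 mulr0.
apply/seteqP; split => f.
  move=> [[Lu hu] Ld]; split; first exact/L2_col.
  by move=> _ [i [p [p0 ->]]]; rewrite key; exact: hu.
move=> [/L2_col[Lu Ld] h]; split => //; split => // i j p p0.
by rewrite ord1 -key; apply: h; exists i, p.
Qed.

Lemma H2minus_L2_L2 m1 m2 f : @H2minus_L2 R m1 m2 f -> L2 f.
Proof. by rewrite H2minus_L2E => -[]. Qed.
Lemma H2_L2_L2 n1 n2 f : @H2_L2 R n1 n2 f -> L2 f.
Proof. by rewrite H2_L2E => -[]. Qed.
Lemma H2minus_L2_lin m1 m2 a f g : @H2minus_L2 R m1 m2 f -> H2minus_L2 g ->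
  H2minus_L2 (a *: f + g).
Proof. by rewrite H2minus_L2E; apply: perp_lin; exact: minusQ_L2. Qed.
Lemma H2_L2_lin n1 n2 a f g : @H2_L2 R n1 n2 f -> H2_L2 g -> H2_L2 (a *: f + g).
Proof. by rewrite H2_L2E; apply: perp_lin; exact: plusQ_L2. Qed.
Lemma H2minus_L2_0 m1 m2 : @H2minus_L2 R m1 m2 0.
Proof. by rewrite H2minus_L2E; apply: perp_0; exact: minusQ_L2. Qed.
Lemma H2_L2_0 n1 n2 : @H2_L2 R n1 n2 0.
Proof. by rewrite H2_L2E; apply: perp_0; exact: plusQ_L2. Qed.

Lemma rI_le_ae (u v : TR -> R) : rint u -> rint v ->
  (\forall t \ae mu, u t <= v t) -> rI u <= rI v.
Proof.
move=> iu iv uv; have id := rintB iv iu.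
rewrite -subr_ge0 -rI_B // (@rI_ae _ _ (fun t => `|v t - u t|)).
- by apply: rI_ge0 => t; exact: normr_ge0.
- exact: rint_meas.
- by apply: rint_meas; exact: rint_norm.
- by apply: filterS uv => t h; rewrite ger0_norm // subr_ge0.
Qed.

Definition bddmx k l (F : R -> 'M[C]_(k, l)) := forall i j, bdd (fun t => F t i j).

Lemma bddmx_mul_bound k l (F : R -> 'M[C]_(k, l)) : bddmx F ->
  exists2 B : R, 0 <= B & forall f, L2 f ->
    L2 (fun t => F t *m f t) /\ nr (fun t => F t *m f t) <= B * nr f.
Proof.
move=> bF.
have exm i j : exists m : R, 0 <= m /\ \forall t \ae mu, normc (F t i j) <= m.
  by have [_ [m m0 hm]] := bF i j; exists m.
pose m i j := sval (cid (exm i j)).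
have m0 i j : 0 <= m i j by rewrite /m; case: cid => ? [].
have mP i j : \forall t \ae mu, normc (F t i j) <= m i j by rewrite /m; case: cid => ? [].
pose M := \sum_i \sum_j m i j.
have M0 : 0 <= M by apply: sumr_ge0 => i _; apply: sumr_ge0 => j _.
have mM i j : m i j <= M.
  rewrite /M (bigD1 i) //= (bigD1 j) //= -addrA lerDl addr_ge0 //.
    exact: sumr_ge0.
  by apply: sumr_ge0 => ? _; exact: sumr_ge0.
have hM : \forall t \ae mu, forall i j, normc (F t i j) <= M.
  apply: ae_ord => i; apply: ae_ord => j; apply: filterS (mP i j) => t h.
  exact: le_trans h (mM i j).
(* Each entry of F f is at most l M |f| pointwise; the factor k+1 replaces sqrt k, as k <=
   (k+1)^2. *)
pose B := k.+1%:R * (l%:R * M).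
have B0 : 0 <= B by rewrite !mulr_ge0.
exists B => // f Lf.
have LFf : L2 (fun t => F t *m f t).
  apply/L2P => i; under eq_fun do rewrite mxE.
  apply: sqint_sum => j; apply: bdd_sqintM; first exact: bF.
  by move/L2P: Lf.
split => //; rewrite -ler_sqr ?nnegrE ?nrm_ge0 ?mulr_ge0 ?nrm_ge0 // exprMn.
rewrite !(nrmK (HS _)) // !sqnE -rI_Z; last exact: L2_rint.
apply: rI_le_ae; [exact: L2_rint|exact/rintZ/L2_rint|].
apply: filterS hM => t ht; rewrite vnorm2E.
apply: (@le_trans _ _ (\sum_(i < k) (l%:R * M * vnorm (f t)) ^+ 2)).
  apply: ler_sum => i _; rewrite ler_sqr ?nnegrE ?normc_ge0 ?mulr_ge0 ?vnorm_ge0 // mxE.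
  apply: (@le_trans _ _ (\sum_(j < l) normc (F t i j * f t j 0))).
    elim/big_rec2: _ => [|j x y _ IH]; first by rewrite Normc.normc0.
    by apply: le_trans (le_normcD _ _) _; rewrite lerD2l.
  apply: (@le_trans _ _ (\sum_(j < l) M * vnorm (f t))).
    apply: ler_sum => j _; rewrite Normc.normcM ler_pM ?normc_ge0 //.
    exact: normc_le_vnorm.
  by rewrite sumr_const card_ord -mulrA mulr_natl.
rewrite sumr_const card_ord -[_ *+ k]mulr_natl /B.
have -> : (k.+1%:R * (l%:R * M)) ^+ 2 * vnorm (f t) ^+ 2 =
    k.+1%:R ^+ 2 * (l%:R * M * vnorm (f t)) ^+ 2 by ring.
rewrite ler_wpM2r ?sqr_ge0 //.
by rewrite -natrX ler_nat (leq_trans (leqnSn k)) // -[leqLHS]muln1 leq_mul.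
Qed.

Lemma L2_mulmx k l (F : R -> 'M[C]_(k, l)) f : bddmx F -> L2 f -> L2 (fun t => F t *m f t).
Proof. by move=> /bddmx_mul_bound[B _ h] /h[]. Qed.

(** [oproj] selects some function meeting its specification, with default 0; as soon as one exists,
    the selected one meets it too. *)
Lemma oprojP n (S : set (R -> 'cV[C]_n)) f :
  (exists2 g, S g & forall k, S k -> inner2 (fun t => f t - g t) k = 0) ->
  S (oproj S f) /\ forall k, S k -> inner2 (fun t => f t - oproj S f t) k = 0.
Proof.
move=> [g Sg hg]; rewrite /oproj; set A := [set g | _].
by have := @xgetPex _ (fun=> 0) A (ex_intro _ g (conj Sg hg)).
Qed.

Variables (m1 m2 n1 n2 : nat) (Phi : R -> 'M[C]_(m1 + m2, n1 + n2)).
Hypothesis bPhi : bddmx Phi.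
Local Notation D := (@H2_L2 R n1 n2).
Local Notation E := (@H2minus_L2 R m1 m2).
Local Notation G := (Gamma Phi).
Local Notation mulPhi f := (fun t => Phi t *m f t).

Lemma GammaP f : L2 f -> E (G f) /\ forall k, E k -> inner2 (mulPhi f - G f) k = 0.
Proof.
move=> Lf; apply: oprojP.
have LP := L2_mulmx bPhi Lf.
have [y Py hy] := perp_projection (@minusQ_L2 m1 m2) LP.
by rewrite H2minus_L2E; exists y.
Qed.

Lemma L2_Gamma f : L2 f -> L2 (G f).
Proof. by move=> /GammaP[/H2minus_L2_L2]. Qed.

Lemma Gamma_inner f k : L2 f -> E k -> inner2 (G f) k = inner2 (mulPhi f) k.
Proof.
move=> Lf Ek; have := (GammaP Lf).2 k Ek; rewrite (ipBl (HS _)).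
- by move/eqP; rewrite subr_eq0 => /eqP.
- exact: L2_mulmx.
- exact: L2_Gamma.
- exact: H2minus_L2_L2.
Qed.

(** The squared norm of Gamma f is the pairing of Phi f with Gamma f, to which Cauchy-Schwarz
    applies. *)
Lemma nr_Gamma f : L2 f -> nr (G f) <= nr (mulPhi f).
Proof.
move=> Lf; have LG := L2_Gamma Lf; have LP := L2_mulmx bPhi Lf.
have [g0|g0] := eqVneq (nr (G f)) 0; first by rewrite g0 nrm_ge0.
have gp : 0 < nr (G f) by rewrite lt_neqAle eq_sym g0 nrm_ge0.
rewrite -(ler_pM2r gp) -expr2 (nrmK (HS _)) //.
apply: le_trans (CS (HS _) LP LG).
rewrite /sqn Gamma_inner //; last by have [] := GammaP Lf.
exact: le_trans (ler_norm _) (Re_le_normc _).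
Qed.

(** Only up to a null function, because [oproj] picks an arbitrary representative for each argument.
    The defect lies in the range space and is orthogonal to it. *)
Lemma Gamma_lin a f g : L2 f -> L2 g -> nr (G (a *: f + g) - (a *: G f + G g)) = 0.
Proof.
move=> Lf Lg; have Lfg : L2 (a *: f + g) by exact: L2_lin.
have LGfg := L2_Gamma Lfg; have LGf := L2_Gamma Lf; have LGg := L2_Gamma Lg.
have Pf := L2_mulmx bPhi Lf; have Pg := L2_mulmx bPhi Lg.
have E0 : mulPhi (a *: f + g) = a *: mulPhi f + mulPhi g.
  by apply/funext => t; rewrite !fctE mulmxDr -scalemxAr.
have key k : E k -> inner2 (G (a *: f + g) - (a *: G f + G g)) k = 0.
  move=> Ek; have Lk := H2minus_L2_L2 Ek.
  rewrite (ipBl (HS _) LGfg (L2_lin a LGf LGg) Lk) (sip_lin (HS _) a LGf LGg Lk).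
  have e1 := Gamma_inner Lf Ek; have e2 := Gamma_inner Lg Ek.
  have e3 := Gamma_inner Lfg Ek; rewrite E0 (sip_lin (HS _) a Pf Pg Lk) -e1 -e2 in e3.
  by apply/eqP; rewrite subr_eq0; apply/eqP; exact: e3.
rewrite /nrm /sqn key ?sqrtr0 // -scaleN1r addrC; apply: H2minus_L2_lin.
  by apply: H2minus_L2_lin; [case: (GammaP Lf)|case: (GammaP Lg)].
by case: (GammaP Lfg).
Qed.

Lemma Gamma_bounded : exists2 B : R, 0 <= B & forall f, L2 f -> nr (G f) <= B * nr f.
Proof.
have [B B0 hB] := bddmx_mul_bound bPhi; exists B => // f Lf.
by apply: le_trans (nr_Gamma Lf) _; case: (hB f Lf).
Qed.

End GammaOperator.

Lemma subrBB (V : zmodType) (p q x y : V) : p - q - (x - y) = p - x - (q - y).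
Proof. by rewrite !opprB addrACA [- q - x]addrC addrACA. Qed.

(** * Essential norm and subspaces of finite codimension *)

Section EssentialNorm.
Variable R : realType.
Local Notation C := R[i].
Local Notation mu := (circle R).
Local Notation TR := (measurableTypeR R).
Local Notation normc := (@Normc.normc R).
Local Notation N := (sqn (@inner2 R _)).
Local Notation nr := (nrm (@inner2 R _)).
Local Notation HS n := (@L2_semi_ip R n).

Lemma complex_bolzano_weierstrass (c : nat -> C) (B : R) : (forall k, normc (c k) <= B) ->
  exists s : nat -> nat, exists2 l : C, {homo s : i j / (i < j)%N} &
    forall e : R, 0 < e -> exists J : nat, forall j, (J <= j)%N -> normc (c (s j) - l) < e.
Proof.
move=> cB.
have bnd (u : nat -> R) : (forall k, `|u k| <= B) -> bounded_fun u.
  move=> h; exists B; split; first exact: num_real.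
  by move=> x Bx k _ /=; rewrite (le_trans (h k)) // ltW.
have [s1 i1 c1] := @bolzano_weierstrass R (fun k => complex.Re (c k))
  (bnd _ (fun k => le_trans (Re_le_normc _) (cB k))).
have [s2 i2 c2] := @bolzano_weierstrass R (fun k => complex.Im (c (s1 k)))
  (bnd _ (fun k => le_trans (Im_le_normc _) (cB (s1 k)))).
have hom (s : nat -> nat) : increasing_seq s -> {homo s : i j / (i < j)%N}.
  by move=> hs i j; rewrite !ltnNge; have := hs j i; rewrite -leEnat => ->.
exists (s1 \o s2), (Complex (limn ((fun k => complex.Re (c k)) \o s1))
                            (limn ((fun k => complex.Im (c (s1 k))) \o s2))).
  by move=> i j ij; apply: (hom _ i1); exact: (hom _ i2).
move=> e e0; have e2 : 0 < e / 2 by rewrite divr_gt0.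
have /cvgrPdist_lt /(_ _ e2) [J1 _ h1] := c1.
have /cvgrPdist_lt /(_ _ e2) [J2 _ h2] := c2.
exists (maxn J1 J2) => j; rewrite geq_max => /andP[j1 j2].
apply: le_lt_trans (normc_le_ReIm _) _; rewrite cReD cImD cReN cImN /=.
have {}h1 := h1 (s2 j) (leq_trans j1 (homo_ge_id (hom _ i2) j)).
have {}h2 := h2 j j2; rewrite distrC /= in h1; rewrite distrC /= in h2.
by rewrite (splitr e) ltrD.
Qed.

Lemma norm2_cvg0 n (u : nat -> R -> 'cV[C]_n) : (forall j, L2 (u j)) ->
  (norm2 (u j) @[j --> \oo] --> 0%E) <->
  (forall e : R, 0 < e -> exists J : nat, forall j, (J <= j)%N -> nr (u j) < e).
Proof.
move=> Lu.
have E : (fun j => norm2 (u j)) = (fun j => (nr (u j))%:E).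
  by apply/funext => j; rewrite norm2_nrm.
rewrite E; split => [/fine_cvgP[_ h] e e0|h].
  have /cvgrPdist_lt /(_ _ e0) [J _ hJ] := h.
  exists J => j /hJ /=; rewrite sub0r normrN ger0_norm //; exact: nrm_ge0.
apply/fine_cvgP; split; first exact: nearW.
apply/cvgrPdist_lt => e /h [J hJ]; exists J => // j /hJ /=.
by rewrite sub0r normrN ger0_norm //; exact: nrm_ge0.
Qed.

Section FiniteRank.
Variables (n m : nat) (D : set (R -> 'cV[C]_n)) (E : set (R -> 'cV[C]_m)).
Hypotheses (DL : forall f, D f -> L2 f) (EL : forall f, E f -> L2 f) (E0 : E 0)
  (Elin : forall a f g, E f -> E g -> E (a *: f + g)).
Variable T : (R -> 'cV[C]_n) -> (R -> 'cV[C]_m).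
Hypothesis TE : forall f, L2 f -> E (T f).

(** For orthonormal [e] and linear [T], this is [T] after the orthogonal projection onto the span of
    [e], so subtracting it from [T] leaves [T] on the orthogonal complement. *)
Definition finite_rank (e : seq (R -> 'cV[C]_n)) (f : R -> 'cV[C]_n) :=
  \sum_(a <- e) inner2 f a *: T a.

Lemma finite_rank_E e f : (forall a, a \in e -> L2 a) -> E (finite_rank e f).
Proof.
move=> eL; rewrite /finite_rank big_seq; apply: big_ind => //.
  by move=> x y Ex Ey; rewrite -[x]scale1r; exact: Elin.
by move=> a /eL La; rewrite -[_ *: _]addr0; apply: Elin => //; exact: TE.
Qed.

(** The Bolzano-Weierstrass theorem is applied to the bounded coefficients of one vector of [e]
    after another, refining the subsequence each time. *)
Lemma finite_rank_subseq e (f_ : nat -> R -> 'cV[C]_n) : (forall a, a \in e -> L2 a) ->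
  (forall j, L2 (f_ j) /\ nr (f_ j) <= 1) ->
  exists s : nat -> nat, exists2 g, E g & {homo s : i j / (i < j)%N} /\
    forall eps : R, 0 < eps -> exists J : nat, forall j, (J <= j)%N ->
      nr (finite_rank e (f_ (s j)) - g) < eps.
Proof.
move=> + hf; elim: e => [_|a e IH eL].
  exists id, 0 => //; split => // eps eps0; exists 0%N => j _.
  by rewrite /finite_rank big_nil subrr (nrm0 (HS _)).
have La : L2 a by apply: eL; rewrite mem_head.
have {}eL b : b \in e -> L2 b by move=> be; apply: eL; rewrite inE be orbT.
have [s [g Eg [hs cg]]] := IH eL.
have cB k : normc (inner2 (f_ (s k)) a) <= nr a.
  have [Lf f1] := hf (s k); apply: le_trans (CS (HS _) Lf La) _.
  by rewrite ler_piMl ?nrm_ge0.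
have [s' [l hs' cl]] := complex_bolzano_weierstrass cB.
have ETa := TE La; have LTa := EL ETa; have Lg := EL Eg.
exists (s \o s'), (l *: T a + g); first exact: Elin.
split; first by move=> i j ij; apply/hs/hs'.
move=> eps eps0; have e2 : 0 < eps / 2 by rewrite divr_gt0.
have d0 : 0 < eps / 2 / (nr (T a) + 1) by rewrite divr_gt0 // ltr_wpDl ?nrm_ge0.
have [J1 h1] := cg _ e2; have [J2 h2] := cl _ d0.
exists (maxn J1 J2) => j; rewrite geq_max => /andP[j1 j2] /=.
have Lr : L2 (finite_rank e (f_ (s (s' j)))) by apply: EL; exact: finite_rank_E.
rewrite {1}/finite_rank big_cons -/(finite_rank e _) opprD addrACA -scalerBl.
apply: le_lt_trans (nrmD (HS _) (sipZ (HS _) _ LTa) (sipB (HS _) Lr Lg)) _.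
rewrite (nrmZ (HS _)) // (splitr eps); apply: ler_ltD; last first.
  by apply: h1; exact: leq_trans j1 (homo_ge_id hs' j).
have {}h2 := ltW (h2 j j2).
apply: le_trans (ler_wpM2r (nrm_ge0 _ _) h2) _.
rewrite mulrAC ler_pdivrMr ?ltr_wpDl ?nrm_ge0 // ler_wpM2l ?(ltW e2) //.
by rewrite lerDl.
Qed.

Lemma finite_rank_compact e : (forall a, a \in e -> L2 a) ->
  compact_op D E (finite_rank e).
Proof.
move=> eL; split.
- by move=> f Df; exact: finite_rank_E.
- move=> a f g Df Dg; apply: nearW => t.
  suff -> : finite_rank e (a *: f + g) = a *: finite_rank e f + finite_rank e g by [].
  rewrite /finite_rank scaler_sumr -big_split /= big_seq [RHS]big_seq.
  apply: eq_bigr => b /eL Lb; rewrite (sip_lin (HS _)) //; [|exact: DL|exact: DL].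
  by rewrite scalerDl scalerA.
- move=> f_ hf.
  have hf' j : L2 (f_ j) /\ nr (f_ j) <= 1.
    have [Df f1] := hf j; have Lf := DL Df; split => //.
    by move: f1; rewrite norm2_nrm // lee_fin.
  have [s [g Eg [hs cg]]] := finite_rank_subseq eL hf'.
  exists s, g; split => //; apply/(@norm2_cvg0 _ (fun j => finite_rank e (f_ (s j)) - g)) => //.
  by move=> j; apply: (sipB (HS _)); apply: EL => //; exact: finite_rank_E.
Qed.

End FiniteRank.

Section GammaEss.
Variables (m1 m2 n1 n2 : nat) (Phi : R -> 'M[C]_(m1 + m2, n1 + n2)).
Hypothesis bPhi : bddmx Phi.
Local Notation D := (@H2_L2 R n1 n2).
Local Notation E := (@H2minus_L2 R m1 m2).
Local Notation G := (Gamma Phi).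

Lemma Gamma_comb (I : eqType) (r : seq I) (c : I -> C) (F : I -> R -> 'cV[C]_(n1 + n2)) :
  (forall a, a \in r -> L2 (F a)) ->
  nr (G (\sum_(a <- r) c a *: F a) - \sum_(a <- r) c a *: G (F a)) = 0.
Proof.
elim: r => [_|a e IH eL].
  have := Gamma_lin bPhi (-1) (L2_0 R _) (L2_0 R _).
  rewrite !big_nil scaler0 addr0 scaleN1r addNr !subr0 //.
have La : L2 (F a) by apply: eL; rewrite mem_head.
have {}eL b : b \in e -> L2 (F b) by move=> be; apply: eL; rewrite inE be orbT.
have Ls : L2 (\sum_(b <- e) c b *: F b).
  by rewrite big_seq; apply: (sip_sum (HS _)) => b /eL Lb; exact: (sipZ (HS _)).
have LG : L2 (\sum_(b <- e) c b *: G (F b)).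
  rewrite big_seq; apply: (sip_sum (HS _)) => b /eL Lb; apply: (sipZ (HS _)).
  exact: L2_Gamma.
have LGs := L2_Gamma bPhi Ls; have LGa := L2_Gamma bPhi La.
rewrite !big_cons; apply: (nrm_congr_trans (HS _) _ _ _ (Gamma_lin bPhi (c a) La Ls)).
- by apply: L2_Gamma => //; exact: L2_lin.
- exact: L2_lin.
- exact: L2_lin.
- by rewrite opprD addrACA subrr add0r; exact: IH.
Qed.

(** With P the projection onto a finite-dimensional subspace, Gamma P is compact, so Gamma - Gamma P
    still has norm above s; an almost extremal f in the unit ball yields x = f - P f. *)
Lemma essnorm_exceed (s : R) (Y : seq (R -> 'cV[C]_(n1 + n2))) :
  (s%:E < Gamma_essnorm Phi)%E -> (forall y, y \in Y -> L2 y) ->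
  exists x, [/\ D x, forall y, y \in Y -> inner2 x y = 0, nr x <= 1 & s < nr (G x)].
Proof.
move=> sess YL.
(* The vectors of [Y] need not lie in the domain. Their projections onto it have the same pairings
   with its elements, and P must map the domain into itself. *)
have exp y : exists py, L2 y -> D py /\ forall k, D k -> inner2 (y - py) k = 0.
  have [Ly|nLy] := pselect (L2 y); last by exists 0.
  have [py Dpy hpy] := perp_projection (@plusQ_L2 R n1 n2) Ly.
  by exists py => _; rewrite H2_L2E.
have [pj hpj] := choice exp.
pose Y' := map pj Y.
have Y'D y : y \in Y' -> D y.
  by move=> h; have [y' /YL/hpj[Dy _] ->] := elimT mapP h.
have [e [oe eD eY]] := gram_schmidt (HS (n1 + n2)) (@H2_L2_L2 R n1 n2) (@H2_L2_0 R n1 n2)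
  (fun a f g => @H2_L2_lin R n1 n2 a f g) Y'D.
have eL a : a \in e -> L2 a by move=> /eD /H2_L2_L2.
have cK := @finite_rank_compact _ _ D E (@H2_L2_L2 R n1 n2) (@H2minus_L2_L2 R m1 m2)
  (@H2minus_L2_0 R m1 m2) (fun a f g => @H2minus_L2_lin R m1 m2 a f g) G
  (fun f Lf => (GammaP bPhi Lf).1) e eL.
have : (s%:E < opnorm D (fun f t => G f t - finite_rank G e f t)%R)%E.
  apply: lt_le_trans sess _; apply: ereal_inf_lbound.
  by exists (finite_rank G e).
move=> /ereal_sup_gt [_ [f [Df f1] <-] sf].
have Lf := H2_L2_L2 Df.
have LK : L2 (finite_rank G e f).
  apply: H2minus_L2_L2.
  by case: cK => h _ _; exact: h.
have LGf := L2_Gamma bPhi Lf.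
pose x := f - fproj (@inner2 R _) e f.
have LP : L2 (fproj (@inner2 R _) e f) by exact: (fprojS (HS _)).
have Lx : L2 x by exact: (sipB (HS _)).
exists x; split.
- rewrite /x -scaleN1r addrC; apply: H2_L2_lin => //.
  rewrite /fproj big_seq; apply: big_ind; first exact: H2_L2_0.
    by move=> y z Dy Dz; rewrite -[y]scale1r; exact: H2_L2_lin.
  by move=> a /eD Da; rewrite -[_ *: _]addr0; apply: H2_L2_lin => //; exact: H2_L2_0.
- move=> y yY; have Ly := YL _ yY; have [Dpy hpy] := hpj _ Ly.
  have Lpy := H2_L2_L2 Dpy.
  have Dx : D x.
    rewrite /x -scaleN1r addrC; apply: H2_L2_lin => //.
    rewrite /fproj big_seq; apply: big_ind; first exact: H2_L2_0.
      by move=> u z Du Dz; rewrite -[u]scale1r; exact: H2_L2_lin.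
    by move=> a /eD Da; rewrite -[_ *: _]addr0; apply: H2_L2_lin => //; exact: H2_L2_0.
  have e1 : inner2 x (pj y) = 0.
    apply: eY => //; last exact: map_f.
    by move=> a ae; exact: (fproj_orth (HS _) oe Lf).
  have := hpy _ Dx; rewrite (ipBl (HS _)) // (sipC (HS _) Lx Ly) (sipC (HS _) Lx Lpy) e1.
  by rewrite rmorph0 subr0 => /eqP; rewrite conjC_eq0 => /eqP.
- apply: le_trans (_ : nr f <= 1); last by move: f1; rewrite norm2_nrm // lee_fin.
  rewrite /nrm ler_sqrt ?(sqn_ge0 (HS _)) //.
  exact: (sqn_fprojB (HS _) oe Lf).
- move: sf; rewrite (norm2_nrm (f := G f - finite_rank G e f)); last exact: (sipB (HS _)).
  rewrite lte_fin => /lt_le_trans; apply.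
  apply: lexx_eq; apply: (nrm_congr (HS _)); [exact: (sipB (HS _))|exact: L2_Gamma|].
  rewrite (nrm_distC (HS _)); [|exact: (sipB (HS _))|exact: L2_Gamma].
  have LGP := L2_Gamma bPhi LP; have LGx := L2_Gamma bPhi Lx.
  have h1 := Gamma_lin bPhi (-1) LP Lf.
  have h2 : nr (G (fproj (@inner2 R _) e f) - finite_rank G e f) = 0.
    by apply: (@Gamma_comb _ e (fun a => inner2 f a) id).
  apply: (nrm_congr_trans (HS _) LGx _ _ _ (y := -1 *: G (fproj (@inner2 R _) e f) + G f)).
  + exact: L2_lin.
  + exact: (sipB (HS _)).
  + have gen (P : R -> 'cV[C]_(n1 + n2)) : f - P = -1 *: P + f by rewrite scaleN1r addrC.
    by rewrite /x gen; exact: h1.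
  + have gen (a b c : R -> 'cV[C]_(m1 + m2)) : -1 *: a + b - (b - c) = - (a - c).
      by rewrite scaleN1r !opprB addrACA subrr addr0 addrC.
    by rewrite gen (nrmN (HS _)) //; exact: (sipB (HS _)).
Qed.

(** Take K compact with Gamma - K bounded by some r < s. Orthogonally to finitely many vectors K is
    bounded by s - r, and the two bounds add up to s. *)
Lemma essnorm_below (s : R) : (Gamma_essnorm Phi < s%:E)%E ->
  exists2 Y : seq (R -> 'cV[C]_(n1 + n2)), (forall y, y \in Y -> L2 y) &
    forall x, D x -> (forall y, y \in Y -> inner2 x y = 0) -> nr (G x) <= s * nr x.
Proof.
move=> /ereal_inf_lt [_ [K cK <-]] ops.
have [KE Klin Kseq] := cK.
have LK f : D f -> L2 (K f) by move=> /KE /H2minus_L2_L2.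
have LG f : D f -> L2 (G f) by move=> /H2_L2_L2; exact: L2_Gamma.
pose T f := G f - K f.
have LT f : D f -> L2 (T f) by move=> Df; apply: (sipB (HS _)); [exact: LG|exact: LK].
have oT f : D f -> nr f <= 1 -> ((nr (T f))%:E <= opnorm D (fun f t => G f t - K f t)%R)%E.
  move=> Df f1; apply: ereal_sup_ubound; exists f.
    by split => //; rewrite norm2_nrm ?lee_fin //; exact: H2_L2_L2.
  by rewrite -(norm2_nrm (LT f Df)).
(* The operator norm is an extended real; the bound by s and its value on the zero vector make it a
   nonnegative real. *)
have [r r0 [rs hr]] : exists2 r : R, 0 <= r & r < s /\ forall f, D f -> nr f <= 1 -> nr (T f) <= r.
  have o0 := oT 0 (H2_L2_0 _ _ _) _; move: ops oT o0; case: (opnorm _ _) => [r|//|].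
    rewrite lte_fin => rs oT o0; exists r; last by split => // f Df f1; rewrite -lee_fin oT.
    rewrite -lee_fin; apply: le_trans (o0 _); last by rewrite (nrm0 (HS _)).
    by rewrite lee_fin nrm_ge0.
  by move=> _ _ /(_ _); rewrite (nrm0 (HS _)) ler01 => /(_ isT); rewrite leeNy_eq.
have DZ a f : D f -> D (a *: f).
  by move=> Df; rewrite -[_ *: _]addr0; apply: H2_L2_lin => //; exact: H2_L2_0.
have Klin' a f g : D f -> D g -> nr (K (a *: f + g) - (a *: K f + K g)) = 0.
  move=> Df Dg; have Dfg := H2_L2_lin a Df Dg.
  have L1 := LK _ Dfg; have L3 : L2 (a *: K f + K g) by apply: L2_lin; exact: LK.
  have L4 : L2 (K (a *: f + g) - (a *: K f + K g)) by exact: (sipB (HS _)).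
  rewrite /nrm (sqn_ae L4 (L2_0 _ _)) ?(sqn0 (HS _)) ?sqrtr0 //.
  by apply: filterS (Klin a f g Df Dg) => t h; rewrite !fctE /= [X in X - _]h subrr.
have Tlin a f g : D f -> D g -> nr (T (a *: f + g) - (a *: T f + T g)) = 0.
  move=> Df Dg; have Dfg := H2_L2_lin a Df Dg.
  have h1 := Gamma_lin bPhi a (H2_L2_L2 Df) (H2_L2_L2 Dg); have h2 := Klin' a f g Df Dg.
  have LLG : L2 (a *: G f + G g) by apply: L2_lin; exact: LG.
  have LLK : L2 (a *: K f + K g) by apply: L2_lin; exact: LK.
  have -> : T (a *: f + g) - (a *: T f + T g) =
     (G (a *: f + g) - (a *: G f + G g)) - (K (a *: f + g) - (a *: K f + K g)).
    rewrite /T; move: (G (a *: f + g)) (G f) (G g) (K (a *: f + g)) (K f) (K g) => p b c q d l.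
    by rewrite -subrBB scalerBr addrACA -opprD.
  apply/eqP; rewrite eq_le nrm_ge0 andbT.
  apply: le_trans (nrmB (HS _) _ _) _; last by rewrite h1 h2 addr0.
  - by apply: (sipB (HS _)) => //; exact: LG.
  - by apply: (sipB (HS _)) => //; exact: LK.
have hT := K_scale (HS _) (HS _) (@H2_L2_L2 R n1 n2) (@H2_L2_0 R n1 n2)
  (fun a f g => @H2_L2_lin R n1 n2 a f g) LT Tlin r0 hr.
have cpt (x_ : nat -> R -> 'cV[C]_(n1 + n2)) : (forall j, D (x_ j) /\ nr (x_ j) <= 1) ->
  exists s : nat -> nat, exists2 g, L2 g & {homo s : i j / (i < j)%N} /\
   forall e : R, 0 < e -> exists J : nat, forall j, (J <= j)%N -> nr (K (x_ (s j)) - g) < e.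
  move=> hx; have [j|s' [g [hs Eg cg]]] := Kseq x_.
    have [Dx x1] := hx j; split => //; rewrite norm2_nrm ?lee_fin //; exact: H2_L2_L2.
  exists s', g; first exact: H2minus_L2_L2; split => //.
  apply: (@norm2_cvg0 _ (fun j => K (x_ (s' j)) - g) _).1 => //.
  move=> j; apply: (sipB (HS _)); last exact: H2minus_L2_L2.
  by apply: LK; case: (hx (s' j)).
have eps0 : 0 < s - r by rewrite subr_gt0.
have [Y YD hY] := compact_small (HS _) (HS _) (@H2_L2_L2 R n1 n2) (@H2_L2_0 R n1 n2)
  (fun a f g => @H2_L2_lin R n1 n2 a f g) LK Klin' cpt eps0.
exists Y; first by move=> y /YD /H2_L2_L2.
move=> x Dx xY; have := hY x Dx xY; have := hT x Dx.
have := nrm_lB (HS _) (LG _ Dx) (LK _ Dx); rewrite -/(T x); lra.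
Qed.

End GammaEss.
End EssentialNorm.

(** * Lifting through unitary completions *)

Section Lifting.
Variable R : realType.
Local Notation C := R[i].
Local Notation mu := (circle R).
Local Notation TR := (measurableTypeR R).
Local Notation rI := (Rintegral mu setT).
Local Notation normc := (@Normc.normc R).
Local Notation N := (sqn (@inner2 R _)).
Local Notation nr := (nrm (@inner2 R _)).
Local Notation HS n := (@L2_semi_ip R n).

Lemma H2_ae n (f g : R -> 'cV[C]_n) : mxmeasurable g -> H2 f ->
  (\forall t \ae mu, f t = g t) -> H2 g.
Proof.
move=> mg /H2P Hf fg; apply/H2P => i; apply: hh_ae (Hf i) _; first exact: mg.
by apply: filterS fg => t ->.
Qed.

Lemma unitary_bddmx n (B : R -> 'M[C]_n) : mxmeasurable B -> unitary_valued B -> bddmx B.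
Proof.
move=> mB uB i j; split; first exact: mB.
exists 1 => //; apply: filterS uB => t /unitarymxP /(congr1 (fun M : 'M[C]_n => M i i)).
rewrite !mxE eqxx => h.
have {}h : \sum_k normc (B t i k) ^+ 2 = 1.
  have : (\sum_k ((normc (B t i k) ^+ 2)%:C)%C) = 1 :> C.
    by rewrite -[RHS]h; apply: eq_bigr => k _; rewrite !mxE mulcconj.
  by rewrite -rmorph_sum /= => /(congr1 (@complex.Re R)).
rewrite -ler_sqr ?nnegrE ?normc_ge0 // expr1n -h (bigD1 j) //= lerDl.
by apply: sumr_ge0 => k _; exact: sqr_ge0.
Qed.

Lemma mul_col_11 k (u : 'cV[C]_k) (M : 'M[C]_1) : u *m M = M 0 0 *: u.
Proof.
by apply/matrixP => i j; rewrite !mxE big_ord1 (ord1 j) mulrC.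
Qed.

Variables (a b : nat) (x : R -> 'cV[C]_(a.+1 + b)) (xo : R -> C)
  (xi : R -> 'cV[C]_a.+1) (Xc : R -> 'M[C]_(a.+1, a)) (B : R -> 'M[C]_(a.+1 + b)).
Hypotheses (comp : column_completion (fun t => usubmx (x t)) xo xi Xc)
  (B_meas : mxmeasurable B) (B_unit : unitary_valued B) (B_form : completion_form x Xc B).

Let outer_xo : is_outer (scal xo). Proof. by case: comp => -[]. Qed.
Let hinf_xo : hinf xo.
Proof.
by case: outer_xo => /Hinfty_hinf /(_ 0 0); under eq_fun do rewrite scalE.
Qed.
Let hinf_xi i : hinf (fun t => xi t i 0).
Proof. by case: comp => -[_ [/Hinfty_hinf h _]] _ _ _; exact: h. Qed.
Let hinf_Xc i j : hinf (fun t => Xc t i j).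
Proof. by case: comp => _ _ [[/Hinfty_hinf h _] _] _; exact: h. Qed.

Let B' t : 'M[C]_(a.+1 + b, 1 + (a + b)) := B t.
(** The block is read off from [B] and not taken from the witnesses in [completion_form], which are
    not known to be measurable. *)
Let S1 t : 'M[C]_(a.+1, b) := rsubmx (rsubmx (usubmx (B' t))).

Let bdd_S1 : bddmx S1.
Proof.
move=> i j; have := unitary_bddmx B_meas B_unit (lshift b i) (rshift 1 (rshift a j)).
by congr bdd; apply/funext => t; rewrite !mxE.
Qed.

(** Unitarity of (xi, conj Xc) gives conj(Xc) Xc^T y = y - xi xi^* y. Orthogonality of the columns
    of [B] gives Xc^T S1 = 0, so the columns of S1 are pointwise multiples of xi. All that may fail
    to be analytic is thus collected in one scalar coefficient of xi, on which the first coordinate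
    acts through xo. *)
Lemma completion_ae : \forall t \ae mu, forall (xi0 : C) (y : 'cV[C]_a.+1) (F2 : 'cV[C]_b),
  usubmx (B' t *m col_mx xi0%:M (col_mx ((Xc t)^T *m y) F2)) =
  y + ((xo t * xi0) - (((xi t)^t*)%sesqui *m y) 0 0 + (((xi t)^t*)%sesqui *m S1 t *m F2) 0 0) *: xi t.
Proof.
have [S1' [S2 hB]] := B_form.
case: comp => -[_ [_ xi1]] xE [[_ Xc1] _] uni.
have h1 : \forall t \ae mu, B t \is unitarymx /\
    B t = block_mx (usubmx (x t)) (row_mx (map_mx Num.conj (Xc t)) (S1' t))
      (dsubmx (x t)) (row_mx 0 (S2 t)) :> 'M[C]_(a.+1 + b, 1 + (a + b)).
  by apply: filterS2 B_unit hB => t.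
have h2 : \forall t \ae mu, usubmx (x t) = xo t *: xi t /\
    (row_mx (xi t) (map_mx Num.conj (Xc t)) : 'M[C]_a.+1) \is unitarymx.
  by apply: filterS2 xE uni => t.
apply: filterS2 h1 h2 => t [uB Bt] [xt ut] xi0 y F2.
have S1E : S1 t = S1' t by rewrite /S1 /B' Bt block_mxEv col_mxKu row_mxKr row_mxKr.
have e1 : xi t *m ((xi t)^t*)%sesqui + map_mx Num.conj (Xc t) *m (Xc t)^T = 1%:M.
  pose U : 'M[C]_(a.+1, 1 + a) := row_mx (xi t) (map_mx Num.conj (Xc t)).
  have hU : U *m (U^t*)%sesqui = 1%:M by move/unitarymxP: ut.
  rewrite -hU /U tr_row_mx map_col_mx mul_row_col; congr (_ + _ *m _).
  by apply/matrixP => i j; rewrite !mxE conjCK.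
have e2 : (Xc t)^T *m S1' t = 0.
  pose C1 : 'cV[C]_(a.+1 + b) := col_mx (usubmx (x t)) (dsubmx (x t)).
  pose C2 : 'M[C]_(a.+1 + b, a) := col_mx (map_mx Num.conj (Xc t)) 0.
  pose C3 : 'M[C]_(a.+1 + b, b) := col_mx (S1' t) (S2 t).
  pose T : 'M[C]_(a.+1 + b, 1 + (a + b)) := row_mx C1 (row_mx C2 C3).
  have BT : B' t = T.
    by rewrite /B' Bt block_mxEh /T; congr row_mx; rewrite -block_mxEv block_mxEh.
  have : (T^t*)%sesqui *m T = 1%:M.
    by rewrite -BT; have /unitarymxP := uB; move/mulmx1C.
  rewrite {1}/T tr_row_mx map_col_mx mul_col_row scalar_mx_block => /eq_block_mx[_ _ _].
  rewrite tr_row_mx map_col_mx mul_col_row scalar_mx_block => /eq_block_mx[_ + _ _].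
  rewrite /C2 /C3 tr_col_mx map_row_mx mul_row_col trmx0 map_mx0 mul0mx addr0 => <-.
  by congr (_ *m _); apply/matrixP => i j; rewrite !mxE conjCK.
rewrite {1}/B' Bt block_mxEv mul_col_mx col_mxKu !mul_row_col S1E xt.
have f1 : map_mx Num.conj (Xc t) *m ((Xc t)^T *m y) = y - xi t *m (((xi t)^t*)%sesqui *m y).
  by apply/eqP; rewrite eq_sym subr_eq !mulmxA addrC -mulmxDl e1 mul1mx.
have f2 : S1' t *m F2 = xi t *m (((xi t)^t*)%sesqui *m S1' t *m F2).
  rewrite !mulmxA -[LHS]mul1mx -e1 mulmxDl -!mulmxA [(Xc t)^T *m _]mulmxA e2.
  by rewrite mul0mx mulmx0 addr0.
rewrite f1 f2 !(mul_col_11 (xi t)) mul_mx_scalar scalerA.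
by rewrite scalerDl scalerBl addrCA -!addrA [xi0 * _]mulrC; congr (_ + _); rewrite addrCA.
Qed.

Definition big_set (d : R) : set TR := [set t | d <= normc (xo t)].
Definition cutoff (d : R) (t : R) : C := (\1_(big_set d) t : R)%:C%C.
(** The factor xo, and the cutoff to the set where |xo| >= d, make it possible to divide the
    unwanted coefficient in [completion_ae] by xo. *)
Definition lift_base (d : R) (y : R -> 'cV[C]_a.+1) (F2 : R -> 'cV[C]_b) t : 'cV[C]_(a + b) :=
  col_mx ((Xc t)^T *m (xo t *: y t)) (cutoff d t *: F2 t).
(** The solution of the cancellation equation: with this first coordinate plus eta, the coefficient
    of xi in [completion_ae] reduces to xo eta, and the upper part becomes xo y + xo eta xi, which
    is in H^2. *)
Definition lift_coord (d : R) (y : R -> 'cV[C]_a.+1) (F2 : R -> 'cV[C]_b) t : C :=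
  (((xi t)^t*)%sesqui *m y t) 0 0 -
  (cutoff d t * (xo t)^-1) * (((xi t)^t*)%sesqui *m S1 t *m F2 t) 0 0.

Let meas_big d : measurable (big_set d).
Proof.
rewrite -[X in measurable X]setTI; apply: measurable_fun_le => //.
by apply: meas_normc; case: hinf_xo => -[].
Qed.

Lemma cutoffE d t : 0 < d -> xo t * (cutoff d t * (xo t)^-1) = cutoff d t.
Proof.
move=> d0; rewrite /cutoff indicE; have [/set_mem /= h|_] := boolP (t \in _); last by rewrite mul0r mulr0.
rewrite mul1r mulfV //; apply/eqP => x0; move: h; rewrite /big_set /= x0 Normc.normc0.
by rewrite leNgt d0.
Qed.

Lemma bdd_cutoff_inv d : 0 < d -> bdd (fun t => cutoff d t * (xo t)^-1).
Proof.
move=> d0; apply: (@bdd_le _ _ d^-1).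
  apply: cmeasM; first by apply: cmeas_indic; exact: meas_big.
  by apply: cmeas_inv; case: hinf_xo => -[].
move=> t; rewrite /cutoff indicE; have [/set_mem h|_] := boolP (t \in _).
  rewrite mul1r Normc.normcV lef_pV2 ?posrE //.
  exact: lt_le_trans d0 h.
by rewrite mul0r Normc.normc0 invr_ge0 ltW.
Qed.

Lemma hh_scale n (c : R -> C) (y : R -> 'cV[C]_n) : hinf c -> H2 y -> H2 (fun t => c t *: y t).
Proof.
move=> hc /H2P hy; apply/H2P => i; under eq_fun do rewrite mxE; exact: hinf_hhM.
Qed.

Lemma H2_lift_base d y F2 : H2 y -> H2 (fun t => usubmx (lift_base d y F2 t)).
Proof.
move=> hy; rewrite /lift_base; under eq_fun do rewrite col_mxKu.
have /H2P hy' := hh_scale hinf_xo hy.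
apply/H2P => i; under eq_fun do rewrite mxE.
apply: hh_sum => j; under eq_fun do rewrite mxE; exact: hinf_hhM.
Qed.

Lemma L2_cutoff d F2 : L2 F2 -> L2 (fun t => cutoff d t *: F2 t : 'cV[C]_b).
Proof.
move=> /L2P h; apply/L2P => i; under eq_fun do rewrite mxE.
by apply: bdd_sqintM => //; apply: bdd_indic; exact: meas_big.
Qed.

Lemma L2_lift_base d y F2 : H2 y -> L2 F2 -> L2 (lift_base d y F2).
Proof.
move=> hy hF; apply/L2_col; split; first by case: (H2_lift_base d F2 hy).
by rewrite /lift_base; under eq_fun do rewrite col_mxKd; exact: L2_cutoff.
Qed.

Let bdd_xiH : bddmx (fun t => ((xi t)^t*)%sesqui).
Proof.
move=> i j; have := bdd_conj (hinf_xi j).1; congr bdd; apply/funext => t.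
by rewrite !mxE (ord1 i).
Qed.

Lemma sqint_lift_coord d y F2 : 0 < d -> H2 y -> L2 F2 -> sqint (lift_coord d y F2).
Proof.
move=> d0 [Ly _] LF; apply: sqintB.
  by move/L2P: (L2_mulmx bdd_xiH Ly) => /(_ 0).
apply: bdd_sqintM; first exact: bdd_cutoff_inv.
under eq_fun do rewrite -mulmxA.
by move/L2P: (L2_mulmx bdd_xiH (L2_mulmx bdd_S1 LF)) => /(_ 0).
Qed.

Lemma L2_col_scal n (c : R -> C) (F : R -> 'cV[C]_n) : sqint c -> L2 F ->
  L2 (fun t => col_mx (c t)%:M (F t) : 'cV[C]_(1 + n)).
Proof.
move=> /L2_scal Lc LF; apply/L2_col; split.
  by under eq_fun do rewrite col_mxKu.
by under eq_fun do rewrite col_mxKd.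
Qed.

Lemma liftP d y F2 eta : 0 < d -> H2 y -> L2 F2 -> hh eta ->
  H2_L2 (fun t => B' t *m col_mx (lift_coord d y F2 t + eta t)%:M (lift_base d y F2 t)).
Proof.
move=> d0 hy hF he.
have LX : L2 (fun t => col_mx (lift_coord d y F2 t + eta t)%:M (lift_base d y F2 t) : 'cV[C]_(1 + (a + b))).
  apply: (L2_col_scal (c := fun t => lift_coord d y F2 t + eta t)); last exact: L2_lift_base.
  by apply: sqintD; [exact: sqint_lift_coord|case: he].
have LG : L2 (fun t => B' t *m col_mx (lift_coord d y F2 t + eta t)%:M (lift_base d y F2 t)).
  by apply: (L2_mulmx _ LX); exact: unitary_bddmx.
have [LGu LGd] := (L2_col _).1 LG; split => //.
apply: (@H2_ae _ (fun t => xo t *: y t + (xo t * eta t) *: xi t)); first exact: L2_meas.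
  apply/H2P => i; under eq_fun do rewrite !mxE -mulrA [eta _ * _]mulrC.
  apply: hhD; apply: hinf_hhM => //; first by move/H2P: hy.
  exact: hinf_hhM.
apply: filterS completion_ae => t ht; rewrite [RHS]ht; congr (_ + _ *: _).
rewrite /lift_coord -!scalemxAr !mxE mulrDr mulrBr mulrA cutoffE //.
set u := \sum_j _; set w := \sum_j _; ring.
Qed.

(** An outer function is nonzero almost everywhere, so at almost every point the cutoff equals 1
    once d is small; dominated convergence concludes. *)
Lemma cutoff_dense (F2 : R -> 'cV[C]_b) (e : R) : L2 F2 -> 0 < e ->
  exists2 d : R, 0 < d & nr (F2 - (fun t => cutoff d t *: F2 t)) < e.
Proof.
move=> LF e0; pose dk (k : nat) : R := k.+1%:R^-1.
have dk0 k : 0 < dk k by rewrite invr_gt0.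
pose D k := F2 - (fun t => cutoff (dk k) t *: F2 t).
have LD k : L2 (D k) by apply: (sipB (HS _)) => //; exact: L2_cutoff.
have DE k t : vnorm (D k t) ^+ 2 = (~~ (t \in big_set (dk k)))%:R * vnorm (F2 t) ^+ 2.
  rewrite !vnorm2E mulr_sumr; apply: eq_bigr => i _; rewrite !mxE /cutoff indicE.
  case: (t \in _); first by rewrite mul1r subrr Normc.normc0 expr0n mul0r.
  by rewrite mul0r subr0 mul1r.
have xo0 := outer_neq0 outer_xo.
have [] := @dominated_convergence _ TR R mu setT measurableT
   (fun k t => (vnorm (D k t) ^+ 2)%:E) (fun=> 0%E) (fun t => (vnorm (F2 t) ^+ 2)%:E) _ _ _ _ _.
- by move=> k; apply/measurable_EFinP; apply: meas_vnorm2; exact: L2_meas.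
- by [].
- apply: filterS xo0 => t xt _.
  have xp : 0 < normc (xo t).
    rewrite lt_neqAle normc_ge0 andbT eq_sym; apply: contra xt => /eqP /Normc.eq0_normc ->.
    by [].
  apply: cvg_near_cst; exists (Num.trunc (normc (xo t))^-1) => // k hk.
  rewrite DE mem_set ?mul0r // /big_set /= /dk.
  rewrite -[leRHS]invrK lef_pV2 ?posrE ?invr_gt0 ?ltr0Sn //.
  by apply/ltW/(lt_le_trans (truncnS_gt _)); rewrite ler_nat ltnS.
- exact: L2_rint.
- apply: nearW => t k _; rewrite DE; have h := sqr_ge0 (vnorm (F2 t)).
  by case: (~~ _); rewrite /= lee_fin ?mul1r ?mul0r ?normr0 // ger0_norm.
move=> _ _; rewrite integral0.
have E : (fun k => (\int[mu]_t (vnorm (D k t) ^+ 2)%:E)%E) = (fun k => (N (D k))%:E).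
  by apply/funext => k; rewrite sqnE EFin_rI //; exact: L2_rint.
rewrite E => /fine_cvgP[_ /cvgrPdist_lt /(_ _ (exprn_gt0 2 e0)) [k _ /(_ k (leqnn k))]] /=.
rewrite sub0r normrN => h; exists (dk k) => //.
rewrite -ltr_sqr ?nnegrE ?nrm_ge0 ?(ltW e0) // (nrmK (HS _)); last exact: LD.
exact: le_lt_trans (ler_norm _) h.
Qed.

Lemma sqn_comp n (f : R -> 'cV[C]_n) : L2 f -> N f = \sum_i N (scal (fun t => f t i 0)).
Proof.
move=> /L2P Lf; rewrite sqnE.
under eq_Rintegral do rewrite vnorm2E.
rewrite rI_sum; last by move=> i; case: (Lf i).
apply: eq_bigr => i _; rewrite sqnE; apply: eq_Rintegral => t _.
by rewrite vnorm2E big_ord1 scalE.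
Qed.

Lemma outer_dense_scalar (f : R -> C) (e : R) : hh f -> 0 < e ->
  exists2 g, hh g & nr (scal (fun t => f t - xo t * g t)) < e.
Proof.
move=> hf e0; have [_ dense] := outer_xo.
have [g /H2P/(_ 0) hg hge] := dense (scal f) ((H2_scal f).2 hf) e e0.
exists (fun t => g t 0 0) => //.
rewrite -lte_fin -norm2_nrm; last first.
  by apply/L2_scal/sqintB/hh_sqint/hinf_hhM => //; case: hf.
move: hge; congr (norm2 _ < _)%E; apply/funext => t.
by apply/matrixP => i j; rewrite !mxE !ord1 big_ord1 mxE eqxx !mulr1n.
Qed.

Lemma outer_dense_vector n (f : R -> 'cV[C]_n) (e : R) : H2 f -> 0 < e ->
  exists2 g, H2 g & nr (f - (fun t => xo t *: g t)) < e.
Proof.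
(* The n entries contribute n e'^2 < e^2; dividing by n + 1 also covers n = 0. *)
move=> /H2P hf e0; pose e' := e / n.+1%:R; have e'0 : 0 < e' by rewrite divr_gt0.
have ex i : exists g, hh g /\ nr (scal (fun t => f t i 0 - xo t * g t)) < e'.
  by have [g hg hge] := outer_dense_scalar (hf i) e'0; exists g.
pose gi i := sval (cid (ex i)).
have giP i : hh (gi i) /\ nr (scal (fun t => f t i 0 - xo t * gi i t)) < e'.
  by rewrite /gi; case: cid.
pose g t : 'cV[C]_n := \col_i gi i t.
have hg : H2 g.
  by apply/H2P => i; rewrite /g; under eq_fun do rewrite mxE; case: (giP i).
have Lf : L2 f by apply/L2P => i; case: (hf i).
have [Lxg _] := hh_scale hinf_xo hg.
have Ld : L2 (f - (fun t => xo t *: g t)) by exact: (sipB (HS _)).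
exists g => //; rewrite -ltr_sqr ?nnegrE ?nrm_ge0 ?(ltW e0) // (nrmK (HS _)) //.
rewrite sqn_comp //; apply: (@le_lt_trans _ _ (\sum_(i < n) e' ^+ 2)).
  apply: ler_sum => i _; have [hgi h] := giP i.
  rewrite (_ : (fun t => _) = fun t => f t i 0 - xo t * gi i t); last first.
    by apply/funext => t; rewrite !mxE.
  rewrite -(nrmK (HS _)); last first.
    by apply/L2_scal/sqintB/hh_sqint/hinf_hhM => //; case: (hf i).
  by rewrite ler_sqr ?nnegrE ?nrm_ge0 ?(ltW e'0) // ltW.
rewrite sumr_const card_ord -mulr_natl /e' exprMn.
have n0 : 0 < (n.+1%:R : R) by [].
have -> : n%:R * (e ^+ 2 * n.+1%:R^-1 ^+ 2) = e ^+ 2 * (n%:R / n.+1%:R ^+ 2).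
  by rewrite exprVn mulrCA.
rewrite gtr_pMr ?exprn_gt0 // ltr_pdivrMr ?exprn_gt0 // mul1r -natrX ltr_nat.
by rewrite expnS expn1 (leq_trans (ltnSn n)) // leq_pmulr.
Qed.

Lemma sqn_split (n k : nat) (f : R -> 'cV[C]_(n + k)) : L2 f ->
  N f = N (fun t => usubmx (f t)) + N (fun t => dsubmx (f t)).
Proof. by move=> Lf; rewrite {1}/sqn inner2_split // cReD. Qed.

Lemma nr_col_le (n k : nat) (f : R -> 'cV[C]_(n + k)) : L2 f ->
  nr f <= nr (fun t => usubmx (f t)) + nr (fun t => dsubmx (f t)).
Proof.
move=> Lf; have [Lu Ld] := (L2_col f).1 Lf.
rewrite -ler_sqr ?nnegrE ?nrm_ge0 ?addr_ge0 ?nrm_ge0 // sqrrD !(nrmK (HS _)) //.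
rewrite sqn_split //; set p := nr _; set q := nr _.
have h : 0 <= p * q *+ 2 by rewrite mulrn_wge0 // mulr_ge0 // nrm_ge0.
by lra.
Qed.

(** One third of the error for each approximation: the upper part of F by Xc^T y1 since Xc is
    co-outer, y1 by xo y since xo is outer, the lower part by its cutoff. *)
Lemma lift_base_dense (F : R -> 'cV[C]_(a + b)) (e : R) : H2_L2 F -> 0 < e ->
  exists d y F2, [/\ 0 < d, H2 y, L2 F2 & nr (lift_base d y F2 - F) < e].
Proof.
move=> [hF1 LF2] e0; have e3 : 0 < e / 3 by rewrite divr_gt0.
have [_ _ [_ [_ dense]] _] := comp.
have [y1 hy1 hye1] := dense _ hF1 _ e3.
have bX : bddmx (fun t => (Xc t)^T).
  by move=> i j; under eq_fun do rewrite mxE; case: (hinf_Xc j i).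
have [M M0 hM] := bddmx_mul_bound bX.
have eM : 0 < e / 3 / (M + 1) by rewrite divr_gt0 // ltr_wpDl.
have [y hy hye] := outer_dense_vector hy1 eM.
have [d d0 hd] := cutoff_dense LF2 e3.
exists d, y, (fun t => dsubmx (F t)); split => //.
have LF : L2 F by apply: H2_L2_L2.
have Lb := L2_lift_base d hy LF2.
have Lbf : L2 (lift_base d y (fun t => dsubmx (F t)) - F) by exact: (sipB (HS _)).
apply: le_lt_trans (nr_col_le Lbf) _.
have [Ly1 _] := hy1; have [LF1 _] := hF1.
have [Lxy _] := hh_scale hinf_xo hy.
have Ldy : L2 (y1 - (fun t => xo t *: y t)) by exact: (sipB (HS _)).
have [LX1 _] := hM _ Ly1; have [LX2 _] := hM _ Lxy; have [LX3 hX3] := hM _ Ldy.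
have h1 : nr (fun t => usubmx ((lift_base d y (fun t => dsubmx (F t)) - F) t)) < e / 3 + e / 3.
  rewrite (_ : (fun t => _) = (fun t => (Xc t)^T *m (xo t *: y t)) - (fun t => usubmx (F t))); last first.
    by apply/funext => t; rewrite !fctE linearB /= /lift_base col_mxKu.
  rewrite (nrm_distC (HS _)) //; apply: le_lt_trans (nrm_triB (HS _) LF1 LX1 LX2) _.
  apply: ltr_leD.
    by rewrite -lte_fin -norm2_nrm //; exact: (sipB (HS _)).
  rewrite (_ : _ - _ = fun t => (Xc t)^T *m (y1 - (fun t => xo t *: y t)) t); last first.
    by apply/funext => t; rewrite !fctE mulmxBr.
  apply: le_trans hX3 _; apply: le_trans (ler_wpM2l M0 (ltW hye)) _.
  rewrite mulrCA ler_piMr ?(ltW e3) // ler_pdivrMr ?mul1r ?lerDl // ltr_wpDl //.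
have h2 : nr (fun t => dsubmx ((lift_base d y (fun t => dsubmx (F t)) - F) t)) < e / 3.
  rewrite (_ : (fun t => _) = (fun t => cutoff d t *: dsubmx (F t)) - (fun t => dsubmx (F t))); last first.
    by apply/funext => t; rewrite !fctE linearB /= /lift_base col_mxKd.
  by rewrite (nrm_distC (HS _)) //; exact: L2_cutoff.
lra.
Qed.

(** F' and c do not depend on eta: adding eta in H^2 to the first coordinate keeps the lift in H^2
    (+) L^2. This freedom is what later matches the first coordinates of X and Y. *)
Lemma lift_exists (F : R -> 'cV[C]_(a + b)) (e : R) : H2_L2 F -> 0 < e ->
  exists F' c, [/\ H2_L2 F', sqint c, nr (F' - F) < e & forall eta, hh eta ->
    H2_L2 (fun t => (B t : 'M[C]_(a.+1 + b, 1 + (a + b))) *m col_mx (c t + eta t)%:M (F' t))].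
Proof.
move=> hF e0; have [d [y [F2 [d0 hy LF2 hd]]]] := lift_base_dense hF e0.
exists (lift_base d y F2), (lift_coord d y F2); split => //.
- split; first exact: H2_lift_base.
  by have [_ Ld] := (L2_col _).1 (L2_lift_base d hy LF2).
- exact: sqint_lift_coord.
- by move=> eta heta; exact: liftP.
Qed.

End Lifting.

(** * The reflection exchanging H^2 and its orthogonal complement *)

Section ConjugateReflection.
Variable R : realType.
Local Notation C := R[i].
Local Notation mu := (circle R).
Local Notation normc := (@Normc.normc R).
Local Notation N := (sqn (@inner2 R _)).
Local Notation nr := (nrm (@inner2 R _)).
Local Notation HS n := (@L2_semi_ip R n).

(** An antilinear norm-preserving involution exchanging H^2 (+) L^2 with H^2_- (+) L^2. It
    intertwines the transpose of W with the adjoint of W, so the lifting through W^t serves the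
    range side as well. *)
Definition conjz n (f : R -> 'cV[C]_n) (t : R) : 'cV[C]_n := \col_i (zT t * f t i 0)^*.

Lemma conjzK n (f : R -> 'cV[C]_n) : conjz (conjz f) = f.
Proof.
apply/funext => t; apply/matrixP => i j; rewrite !mxE (ord1 j) !rmorphM /= !conjCK.
by rewrite mulrA [_^* * _]mulrC zT_conjM mul1r.
Qed.

Lemma vnorm_conjz n (f : R -> 'cV[C]_n) t : vnorm (conjz f t) = vnorm (f t).
Proof.
congr Num.sqrt; apply: eq_bigr => i _.
by rewrite mxE normc_conj Normc.normcM normc_zT mul1r.
Qed.

Lemma conjzB n (f g : R -> 'cV[C]_n) : conjz f - conjz g = conjz (f - g).
Proof.
by apply/funext => t; apply/matrixP => i j; rewrite !mxE -rmorphB /= mulrBr.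
Qed.

Lemma sqn_conjz n (f : R -> 'cV[C]_n) : N (conjz f) = N f.
Proof. by rewrite !sqnE; apply: eq_Rintegral => t _; rewrite vnorm_conjz. Qed.

Lemma L2_conjz n (f : R -> 'cV[C]_n) : L2 f -> L2 (conjz f).
Proof.
move=> /L2P Lf; apply/L2P => i; rewrite /conjz; under eq_fun do rewrite mxE.
by apply: sqint_conj; apply: bdd_sqintM => //; exact: bdd_zT.
Qed.

Lemma usub_conjz a b (f : R -> 'cV[C]_(a + b)) :
  (fun t => usubmx (conjz f t)) = conjz (fun t => usubmx (f t)).
Proof. by apply/funext => t; apply/matrixP => i j; rewrite !mxE. Qed.
Lemma dsub_conjz a b (f : R -> 'cV[C]_(a + b)) :
  (fun t => dsubmx (conjz f t)) = conjz (fun t => dsubmx (f t)).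
Proof. by apply/funext => t; apply/matrixP => i j; rewrite !mxE. Qed.

Lemma conjz_H2_L2 a b (f : R -> 'cV[C]_(a + b)) : H2_L2 f -> H2minus_L2 (conjz f).
Proof.
move=> [hu Ld]; split; rewrite ?usub_conjz ?dsub_conjz; first exact: H2minus_conj.
exact: L2_conjz.
Qed.

Lemma conjz_H2minus_L2 a b (f : R -> 'cV[C]_(a + b)) : H2minus_L2 f -> H2_L2 (conjz f).
Proof.
move=> [hu Ld]; split; rewrite ?usub_conjz ?dsub_conjz; first exact: conj_H2minus.
exact: L2_conjz.
Qed.

Lemma mulmx_conjz n k (A : R -> 'M[C]_(n, k)) (f : R -> 'cV[C]_k) :
  conjz (fun t => A t *m f t) = fun t => map_mx Num.conj (A t) *m conjz f t.
Proof.
apply/funext => t; apply/matrixP => i j; rewrite !mxE mulr_sumr rmorph_sum.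
by apply: eq_bigr => l _; rewrite !mxE -rmorphM /= mulrCA.
Qed.

End ConjugateReflection.

(** * Pointwise unitary factors, adjoints and finite combinations *)

Section PointwiseUnitary.
Variable R : realType.
Local Notation C := R[i].
Local Notation mu := (circle R).
Local Notation N := (sqn (@inner2 R _)).
Local Notation HS n := (@L2_semi_ip R n).

Lemma dotE n (x y : 'cV[C]_n) : \sum_i x i 0 * (y i 0)^* = ((y^t*)%sesqui *m x) 0 0.
Proof. by rewrite mxE; apply: eq_bigr => i _; rewrite !mxE mulrC. Qed.

Lemma inner2_unitary n (U : R -> 'M[C]_n) (f g : R -> 'cV[C]_n) :
  (\forall t \ae mu, ((U t)^t*)%sesqui *m U t = 1%:M) -> bddmx U -> L2 f -> L2 g ->
  inner2 (fun t => U t *m f t) (fun t => U t *m g t) = inner2 f g.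
Proof.
move=> uU bU Lf Lg; apply: cI_ae.
- by apply/cint_meas/inner2_int; exact: L2_mulmx.
- exact/cint_meas/inner2_int.
- apply: filterS uU => t ht; rewrite !dotE trmx_mul map_mxM !mulmxA.
  by rewrite -[(_ *m ((U t)^t*)%sesqui) *m U t]mulmxA ht mulmx1.
Qed.

Lemma inner2_adjoint n k (A : R -> 'M[C]_(n, k)) (f : R -> 'cV[C]_k) (g : R -> 'cV[C]_n) :
  inner2 (fun t => A t *m f t) g = inner2 f (fun t => ((A t)^t*)%sesqui *m g t).
Proof.
congr (cintegral _); apply/funext => t.
have AE : ((((A t)^t*)%sesqui)^t*)%sesqui = A t.
  by apply/matrixP => i j; rewrite !mxE conjCK.
by rewrite !dotE trmx_mul map_mxM AE mulmxA.
Qed.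

Lemma bddmx_adjoint n k (A : R -> 'M[C]_(n, k)) : bddmx A -> bddmx (fun t => ((A t)^t*)%sesqui).
Proof.
move=> bA i j; have := bdd_conj (bA j i); congr bdd; apply/funext => t.
by rewrite !mxE.
Qed.

Lemma bddmx_mul n k l (A : R -> 'M[C]_(n, k)) (B : R -> 'M[C]_(k, l)) :
  bddmx A -> bddmx B -> bddmx (fun t => A t *m B t).
Proof.
move=> bA bB i j; under eq_fun do rewrite mxE.
by apply: bdd_sum => x; exact: bddM.
Qed.

Lemma mulmx_comb n k (A : R -> 'M[C]_(n, k)) (I : finType) (c : I -> C) (F : I -> R -> 'cV[C]_k) :
  (fun t => A t *m (\sum_i c i *: F i) t) = \sum_i c i *: (fun t => A t *m F i t).
Proof.
apply/funext => t; rewrite !fct_sumE mulmx_sumr; apply: eq_bigr => i _.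
by rewrite -scalemxAr.
Qed.

Lemma comb_closed (V : lmodType C) (P : V -> Prop) (I : finType) (c : I -> C) (F : I -> V) :
  P 0 -> (forall a x y, P x -> P y -> P (a *: x + y)) -> (forall i, P (F i)) ->
  P (\sum_i c i *: F i).
Proof.
move=> P0 Plin PF; apply: big_rec => // i x _ Px; exact: Plin.
Qed.

Lemma left_kernel m n (A : 'M[C]_(m, n)) : (n < m)%N ->
  exists c : 'I_m -> C, \sum_i Normc.normc (c i) ^+ 2 = 1 /\ forall j, \sum_i c i * A i j = 0.
Proof.
move=> nm; have k0 : kermx A != 0.
  by rewrite -mxrank_eq0 mxrank_ker subn_eq0 -ltnNge (leq_ltn_trans (rank_leq_col A)).
have /rowV0Pn[u uk u0] := k0; have uA : u *m A = 0 by apply/sub_kermxP.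
pose s := \sum_i Normc.normc (u 0 i) ^+ 2.
have s0 : 0 < s.
  rewrite lt_neqAle eq_sym sumr_ge0 ?andbT; last by move=> i _; exact: sqr_ge0.
  apply: contra u0; rewrite psumr_eq0; last by move=> i _; exact: sqr_ge0.
  move=> /allP h; apply/eqP/rowP => i; rewrite mxE; apply: Normc.eq0_normc.
  by apply/eqP; rewrite -sqrf_eq0; apply: h; rewrite mem_index_enum.
pose a : R := (Num.sqrt s)^-1.
exists (fun i => (a%:C)%C * u 0 i); split.
  rewrite (eq_bigr (fun i => a ^+ 2 * Normc.normc (u 0 i) ^+ 2)) => [|i _].
    by rewrite -mulr_sumr -/s /a exprVn sqr_sqrtr ?ltW // mulVf ?gt_eqF.
  have na : Normc.normc (a%:C)%C ^+ 2 = a ^+ 2 by rewrite normcE2 /= expr0n addr0.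
  by rewrite Normc.normcM exprMn na.
move=> j; have /rowP/(_ j) := uA; rewrite !mxE => h.
transitivity ((a%:C)%C * \sum_i u 0 i * A i j); last by rewrite h mulr0.
rewrite mulr_sumr; apply: eq_bigr => i _.
by rewrite mulrA.
Qed.

End PointwiseUnitary.

(** Here xi is the norm of the first coordinate of X, f' that of its lower part, g' that of the
    image of the lower part under Gamma_Phi1, dx that of [deflated] X, y that of Y, G that of
    Gamma_Phi V X, x that of X, and B a Lipschitz constant of Gamma_Phi1. With r = sqrt(xi^2 + 1),
    the hypotheses give x <= r + d and, since s < t0, s r <= dx + B d. Then dx - 2 d <= s0 x becomes
    (s - s0) r <= (s0 + B + 2) d, which is impossible since r >= 1. *)
Lemma essential_gap (R : realType) (xi f' g' G y dx x d B s0 s t0 : R) :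
  0 <= xi -> 0 <= f' -> 0 <= g' -> 0 <= dx -> 0 <= x -> 0 <= d -> 0 <= B ->
  0 <= s0 -> s0 < s -> s < t0 ->
  f' <= 1 + d -> s <= g' + B * d -> dx ^+ 2 = t0 ^+ 2 * xi ^+ 2 + g' ^+ 2 ->
  dx - d <= y -> y - d <= G -> G <= s0 * x -> x ^+ 2 = xi ^+ 2 + f' ^+ 2 ->
  (s0 + B + 2) * d < s - s0 -> False.
Proof.
move=> xi0 f0 g0 dx0 x0 d0 B0 s00 ss st hf hs hdx hy hG hGx hx hd.
pose r := Num.sqrt (xi ^+ 2 + 1).
have r2 : r ^+ 2 = xi ^+ 2 + 1 by rewrite sqr_sqrtr // addr_ge0 ?sqr_ge0.
have r0 : 0 <= r by exact: sqrtr_ge0.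
have r1 : 1 <= r.
  by rewrite -ler_sqr ?nnegrE // expr1n r2 lerDr sqr_ge0.
have xr : x <= r + d.
  rewrite -ler_sqr ?nnegrE ?addr_ge0 // hx sqrrD r2.
  have : f' ^+ 2 <= (1 + d) ^+ 2 by rewrite ler_sqr ?nnegrE ?addr_ge0.
  have hrd : d <= r * d by rewrite ler_peMl.
  rewrite sqrrD expr1n mul1r !mulr2n.
  move: (f' ^+ 2) (xi ^+ 2) (d ^+ 2) (r * d) hrd => u1 u2 u3 u4 h1 h2; clear - h1 h2; lra.
have Bd : 0 <= B * d by exact: mulr_ge0.
have s_ge0 : 0 <= s by apply: le_trans s00 (ltW ss).
have gdx : g' <= dx.
  by rewrite -ler_sqr ?nnegrE // hdx lerDr; apply: mulr_ge0; exact: sqr_ge0.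
have sr : s * r <= dx + B * d.
  rewrite -ler_sqr ?nnegrE; [|exact: mulr_ge0|exact: addr_ge0].
  rewrite exprMn r2 sqrrD hdx.
  have h1 : s ^+ 2 <= (g' + B * d) ^+ 2 by rewrite ler_sqr ?nnegrE ?addr_ge0.
  have h2 : s ^+ 2 * xi ^+ 2 <= t0 ^+ 2 * xi ^+ 2.
    by rewrite ler_wpM2r ?sqr_ge0 // ler_sqr ?nnegrE ?(ltW st) //; apply: le_trans s_ge0 (ltW st).
  have h3 : g' * (B * d) <= dx * (B * d) by rewrite ler_wpM2r.
  move: h1 h2 h3; rewrite sqrrD !mulr2n mulrDr mulr1.
  move: (s ^+ 2 * xi ^+ 2) (t0 ^+ 2 * xi ^+ 2) (s ^+ 2) (g' ^+ 2) (g' * (B * d)) (dx * (B * d))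
    ((B * d) ^+ 2) => u1 u2 u3 u4 u5 u6 u7 k1 k2 k3; clear - k1 k2 k3; lra.
have h4 : s0 * x <= s0 * (r + d) by rewrite ler_wpM2l.
have h5 : (s - s0) * 1 <= (s - s0) * r by rewrite ler_wpM2l // subr_ge0 ltW.
move: hd h4 h5; rewrite !mulrDl !mulrDr mulr1 !mulNr => hd h4 h5.
have h6 : dx - d - d <= s0 * x by apply: le_trans hGx; apply: le_trans hG; rewrite lerD2r.
clear - hd h4 h5 h6 sr; lra.
Qed.

(** * Norms of combinations, and orthogonal families with large images *)

Section Combinations.
Variable R : realType.
Local Notation C := R[i].
Local Notation mu := (circle R).
Local Notation normc := (@Normc.normc R).
Local Notation N := (sqn (@inner2 R _)).
Local Notation nr := (nrm (@inner2 R _)).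
Local Notation HS n := (@L2_semi_ip R n).

Lemma dsub_comb a b (I : finType) (c : I -> C) (F : I -> R -> 'cV[C]_(a + b)) :
  (fun t => dsubmx ((\sum_i c i *: F i) t)) = \sum_i c i *: (fun t => dsubmx (F i t)).
Proof.
apply/funext => t; rewrite !fct_sumE linear_sum; apply: eq_bigr => i _.
by rewrite !fctE linearZ.
Qed.

Lemma usub_comb a b (I : finType) (c : I -> C) (F : I -> R -> 'cV[C]_(a + b)) :
  (fun t => usubmx ((\sum_i c i *: F i) t)) = \sum_i c i *: (fun t => usubmx (F i t)).
Proof.
apply/funext => t; rewrite !fct_sumE linear_sum; apply: eq_bigr => i _.
by rewrite !fctE linearZ.
Qed.

Lemma comb_L2 n (I : finType) (c : I -> C) (F : I -> R -> 'cV[C]_n) :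
  (forall i, L2 (F i)) -> L2 (\sum_i c i *: F i).
Proof. by move=> LF; apply: (sip_sum (HS _)) => i _; exact: (sipZ (HS _)). Qed.

Lemma nr_comb_le n k (c : 'I_k -> C) (F : 'I_k -> R -> 'cV[C]_n) (e : R) :
  (forall i, L2 (F i)) -> (forall i, normc (c i) <= 1) -> (forall i, nr (F i) <= e) ->
  nr (\sum_i c i *: F i) <= k%:R * e.
Proof.
move=> LF c1 Fe; apply: le_trans (nrm_sum (HS _) (fun i => sipZ (HS _) (c i) (LF i))) _.
apply: le_trans (ler_sum _ (G := fun=> e) _) _; last by rewrite sumr_const card_ord mulr_natl.
move=> i _; rewrite (nrmZ (HS _)) //; apply: le_trans (Fe i).
by rewrite ler_piMl ?nrm_ge0.
Qed.

(** By the Pythagorean theorem the squared norm of the combination is an average of those of the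
    F_i, with weights |c_i|^2. *)
Lemma nr_comb_orth n k (c : 'I_k -> C) (F : 'I_k -> R -> 'cV[C]_n) :
  (forall i, L2 (F i)) -> (forall i j, i != j -> inner2 (F i) (F j) = 0) ->
  \sum_i normc (c i) ^+ 2 = 1 ->
  (forall b, (forall i, nr (F i) <= b) -> nr (\sum_i c i *: F i) <= b) /\
  (forall b, 0 <= b -> (forall i, b <= nr (F i)) -> b <= nr (\sum_i c i *: F i)).
Proof.
move=> LF oF c1; have NE := sqn_sum_orth (HS _) LF oF c; have LS := comb_L2 c LF.
have ex : exists i : 'I_k, True.
  case: k c F LF oF c1 NE LS => [c ? ? ? |k' *]; last by exists ord0.
  by rewrite big_ord0 => /eqP; rewrite eq_sym oner_eq0.
have bE (b : R) : b ^+ 2 = \sum_i normc (c i) ^+ 2 * b ^+ 2 by rewrite -mulr_suml c1 mul1r.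
split=> [b Fb|b b0 Fb].
  have b0 : 0 <= b by case: ex => i _; apply: le_trans (Fb i); exact: nrm_ge0.
  rewrite -ler_sqr ?nnegrE ?nrm_ge0 // (nrmK (HS _)) // NE bE; apply: ler_sum => i _.
  by rewrite ler_wpM2l ?sqr_ge0 // -(nrmK (HS _)) // ler_sqr ?nnegrE ?nrm_ge0.
rewrite -ler_sqr ?nnegrE ?nrm_ge0 // (nrmK (HS _)) // NE bE; apply: ler_sum => i _.
by rewrite ler_wpM2l ?sqr_ge0 // -(nrmK (HS _)) // ler_sqr ?nnegrE ?nrm_ge0.
Qed.

Lemma sqn_unimodular n (u : R -> C) (f : R -> 'cV[C]_n) : bdd u ->
  (\forall t \ae mu, u t * (u t)^* = 1) -> L2 f -> N (fun t => u t *: f t) = N f.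
Proof.
move=> bu u1 Lf; rewrite {1}/sqn.
have -> : (fun t => u t *: f t) = (fun t => (u t)%:M *m f t).
  by apply/funext => t; rewrite mul_scalar_mx.
rewrite (inner2_unitary (U := fun t => (u t)%:M)) //.
- apply: filterS u1 => t ut; rewrite tr_scalar_mx map_scalar_mx -scalar_mxM /=.
  by rewrite mulrC ut.
- move=> i j; under eq_fun do rewrite mxE.
  by case: (i == j); [under eq_fun do rewrite mulr1n|exact: bdd_cst].
Qed.

Variables (m1 m2 n1 n2 : nat) (Phi : R -> 'M[C]_(m1 + m2, n1 + n2)).
Hypothesis bPhi : bddmx Phi.
Local Notation G := (Gamma Phi).

Lemma Gamma_lipschitz : exists2 B : R, 0 <= B &
  forall f g, L2 f -> L2 g -> nr (G f - G g) <= B * nr (f - g).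
Proof.
have [B B0 hB] := Gamma_bounded bPhi; exists B => // f g Lf Lg.
have Lfg := sipB (HS _) Lf Lg.
apply: le_trans (hB _ Lfg).
have := Gamma_lin bPhi (-1) Lg Lf; rewrite !scaleN1r ![- _ + _]addrC => h.
rewrite le_eqVlt; apply/orP; left; apply/eqP; apply/esym.
have LG1 := L2_Gamma bPhi Lfg.
have LG2 := sipB (HS _) (L2_Gamma bPhi Lf) (L2_Gamma bPhi Lg).
exact: (nrm_congr (HS _) LG1 LG2 h).
Qed.

Lemma Gamma_essnorm_ge0 : (0 <= Gamma_essnorm Phi)%E.
Proof.
apply/ereal_infP => _ [K cK <-].
pose T t := Gamma Phi 0 t - K 0 t.
apply: (@le_trans _ _ (norm2 T)); first exact: Lnorm_ge0.
apply: ereal_sup_ubound; exists 0 => //; split; first exact: H2_L2_0.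
rewrite (norm2_nrm (L2_0 R _)) (nrm0 (HS _)) lee_fin //.
Qed.

(** As Gamma y lies in the range space, the pairing of Gamma x with Gamma y is that of x with the
    adjoint of Phi applied to Gamma y. Orthogonality of the images is thus again orthogonality of x
    to finitely many L^2 functions, and [essnorm_exceed] applies. *)
Lemma orthogonal_exceeding (s : R) : (s%:E < Gamma_essnorm Phi)%E ->
  exists F : nat -> R -> 'cV[C]_(n1 + n2),
  [/\ forall k, H2_L2 (F k), forall k, nr (F k) <= 1, forall k, s < nr (G (F k)),
      forall i j, i != j -> inner2 (F i) (F j) = 0 &
      forall i j, i != j -> inner2 (G (F i)) (G (F j)) = 0].
Proof.
move=> sess.
pose P (l : seq (R -> 'cV[C]_(n1 + n2))) x := (forall y, y \in l -> L2 y) ->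
  [/\ H2_L2 x, forall y, y \in l -> inner2 x y = 0,
      forall y, y \in l -> inner2 (G x) (G y) = 0, nr x <= 1 & s < nr (G x)].
have exP l : exists x, P l x.
  have [lL|nl] := pselect (forall y, y \in l -> L2 y); last by exists 0.
  pose aG y : R -> 'cV[C]_(n1 + n2) := fun t => ((Phi t)^t*)%sesqui *m G y t.
  have LaG y : y \in l -> L2 (aG y).
    by move=> /lL Ly; apply: L2_mulmx (L2_Gamma bPhi Ly); exact: bddmx_adjoint.
  have LY y : y \in l ++ map aG l -> L2 y.
    by rewrite mem_cat => /orP[/lL//|/mapP[z /LaG Lz ->]].
  have [x [Dx ox x1 sx]] := essnorm_exceed bPhi sess LY.
  exists x => _; split => // y yl; first by apply: ox; rewrite mem_cat yl.
  rewrite Gamma_inner //; [|exact: H2_L2_L2|by case: (GammaP bPhi (lL y yl))].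
  by rewrite inner2_adjoint; apply: (ox (aG y)); rewrite mem_cat map_f ?orbT.
have [F hF] := dependent_choice_seq exP; exists F.
have DF k : H2_L2 (F k).
  elim/ltn_ind: k => k IH; have [l lE /(_ _)[|//]] := hF k.
  by move=> y /lE[j jk ->]; apply: H2_L2_L2; exact: IH.
have LF k := H2_L2_L2 (DF k).
have hP k : [/\ nr (F k) <= 1, s < nr (G (F k)),
    forall j, (j < k)%N -> inner2 (F k) (F j) = 0 &
    forall j, (j < k)%N -> inner2 (G (F k)) (G (F j)) = 0].
  have [l lE Pl] := hF k; have [|_ o1 o2 x1 sx] := Pl; first by move=> y /lE[j _ ->].
  by split => // j jk; [apply: o1|apply: o2]; apply/lE; exists j.
split=> // [k|k|i j|i j]; [by case: (hP k)|by case: (hP k)| |];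
  rewrite neq_ltn => /orP[ij|ji].
- by rewrite (sipC (HS _)) //; case: (hP j) => _ _ -> //; rewrite rmorph0.
- by case: (hP i) => _ _ ->.
- rewrite (sipC (HS _)); [|exact: L2_Gamma|exact: L2_Gamma].
  by case: (hP j) => _ _ _ -> //; rewrite rmorph0.
- by case: (hP i) => _ _ _ ->.
Qed.

End Combinations.

(** * The deflated symbol *)

Lemma mul_block_diag (F : pzRingType) (a b c d : nat) (M : 'M[F]_(a, c)) (N : 'M[F]_(b, d))
    (x : 'cV[F]_(c + d)) :
  block_mx M 0 0 N *m x = col_mx (M *m usubmx x) (N *m dsubmx x).
Proof. by rewrite -{1}(vsubmxK x) mul_block_col !mul0mx addr0 add0r. Qed.

Section DeflatedSymbol.
Variable R : realType.
Local Notation C := R[i].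
Local Notation mu := (circle R).
Local Notation normc := (@Normc.normc R).
Local Notation N := (sqn (@inner2 R _)).
Local Notation nr := (nrm (@inner2 R _)).
Local Notation HS n := (@L2_semi_ip R n).

Variables (p q m2 n2 : nat)
  (Phi : R -> 'M[C]_(p.+1 + m2, q.+1 + n2))
  (h theta tau u0 : R -> C)
  (v : R -> 'cV[C]_(q.+1 + n2)) (w : R -> 'cV[C]_(p.+1 + m2))
  (vo wo : R -> C) (vi : R -> 'cV[C]_q.+1) (wi : R -> 'cV[C]_p.+1)
  (Vc : R -> 'M[C]_(q.+1, q)) (Wc : R -> 'M[C]_(p.+1, p))
  (V : R -> 'M[C]_(q.+1 + n2)) (W : R -> 'M[C]_(p.+1 + m2))
  (Q0 : R -> 'M[C]_(p.+1, q.+1))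
  (Phi1 : R -> 'M[C]_(p + m2, q + n2))
  (t0 : R).
Hypotheses (bPhi : bddmx Phi)
  (h_outer : is_outerH2 h)
  (theta_inner : is_inner (scal theta)) (tau_inner : is_inner (scal tau))
  (u0E : forall t, u0 t = (zT t)^* * (theta t)^* * (tau t)^* * (h t)^* / h t)
  (v_completion : column_completion (fun t => usubmx (v t)) vo vi Vc)
  (w_completion : column_completion (fun t => usubmx (w t)) wo wi Wc)
  (V_meas : mxmeasurable V) (V_unitary : unitary_valued V)
  (V_form : completion_form v Vc V)
  (W_meas : mxmeasurable W) (W_unitary : unitary_valued W)
  (W_form : completion_form w Wc (fun t => (W t)^T))
  (Q0_Hinfty : Hinfty Q0)
  (Phi1_meas : mxmeasurable Phi1)
  (Phi1E : \forall t \ae mu,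
     four_block_error Phi Q0 t =
       ((W t)^t*)%sesqui *m
       (block_mx ((t0%:C)%C * u0 t)%:M 0 0 (Phi1 t)
          : 'M[C]_(1 + (p + m2), 1 + (q + n2))) *m
       ((V t)^t*)%sesqui).

Let V' t : 'M[C]_(q.+1 + n2, 1 + (q + n2)) := V t.
Let W' t : 'M[C]_(p.+1 + m2, 1 + (p + m2)) := ((W t)^t*)%sesqui.
Let A t := four_block_error Phi Q0 t.

Let bV : bddmx V. Proof. exact: unitary_bddmx. Qed.
Let bW : bddmx W. Proof. exact: unitary_bddmx. Qed.
Let bWH : bddmx (fun t => ((W t)^t*)%sesqui). Proof. exact: bddmx_adjoint. Qed.

Lemma four_block_errorE t : A t = Phi t - block_mx (Q0 t) 0 0 0.
Proof.
rewrite /A /four_block_error.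
have e := submxK (Phi t); rewrite -[X in _ = X - _]e opp_block_mx add_block_mx.
by rewrite !oppr0 !addr0.
Qed.

Let hinf_Q0 i j : hinf (fun t => Q0 t i j). Proof. exact: Hinfty_hinf. Qed.

Lemma bddmx_A : bddmx A.
Proof.
move=> i j; rewrite (_ : (fun t => _) = fun t => Phi t i j + (-1) * (block_mx (Q0 t) 0 0 0 : 'M[C]_(p.+1 + m2, q.+1 + n2)) i j).
  apply: bddD => //; apply: bddM; first exact: bdd_cst.
  case: (split_ordP i) => i' ->; case: (split_ordP j) => j' ->.
  - by under eq_fun do rewrite block_mxEul; case: (hinf_Q0 i' j').
  - by under eq_fun do rewrite block_mxEur mxE; exact: bdd_cst.
  - by under eq_fun do rewrite block_mxEdl mxE; exact: bdd_cst.
  - by under eq_fun do rewrite block_mxEdr mxE; exact: bdd_cst.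
by apply/funext => t; rewrite four_block_errorE !mxE mulN1r.
Qed.

Lemma WAV_ae : \forall t \ae mu,
  W t *m A t *m V t = (block_mx ((t0%:C)%C * u0 t)%:M 0 0 (Phi1 t)
    : 'M[C]_(1 + (p + m2), 1 + (q + n2))).
Proof.
have uu : \forall t \ae mu, V t \is unitarymx /\ W t \is unitarymx.
  by apply: filterS2 V_unitary W_unitary => t.
apply: filterS2 uu Phi1E => t [/unitarymxP uV /unitarymxP uW] e; rewrite /A e.
have uV' := mulmx1C uV.
set M := (block_mx _ _ _ _ : 'M[C]_(1 + (p + m2), 1 + (q + n2))).
have e1 : W t *m (((W t)^t*)%sesqui *m M *m ((V t)^t*)%sesqui) *m V t =
   (W t *m ((W t)^t*)%sesqui) *m M *m (((V t)^t*)%sesqui *m V t).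
  by rewrite !mulmxA.
by rewrite e1 uW uV' mul1mx mulmx1.
Qed.

(** Phi1 is the lower right block of W A V, a product of bounded factors. *)
Lemma bddmx_Phi1 : bddmx Phi1.
Proof.
have bWAV : bddmx (fun t => W t *m A t *m V t).
  by apply: bddmx_mul => //; apply: bddmx_mul => //; exact: bddmx_A.
move=> i j; apply: bdd_ae (bWAV (rshift 1 i) (rshift 1 j)) _; first exact: Phi1_meas.
apply: filterS WAV_ae => t e.
transitivity ((block_mx ((t0%:C)%C * u0 t)%:M 0 0 (Phi1 t)
    : 'M[C]_(1 + (p + m2), 1 + (q + n2))) (rshift 1 i) (rshift 1 j)).
  by rewrite -e.
by rewrite block_mxEdr.
Qed.

(** Q0 maps the upper part of G into H^2, which is orthogonal to the upper part of K. *)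
Lemma inner2_four_block_error G K : H2_L2 G -> H2minus_L2 K ->
  inner2 (fun t => Phi t *m G t) K = inner2 (fun t => A t *m G t) K.
Proof.
move=> hG hK; have LG := H2_L2_L2 hG; have LK := H2minus_L2_L2 hK.
pose r t : 'cV[C]_(p.+1 + m2) := col_mx (Q0 t *m usubmx (G t)) 0.
have Qr : minusQ r.
  exists (fun t => Q0 t *m usubmx (G t)) => //; apply/H2P => i.
  under eq_fun do rewrite mxE; apply: hh_sum => j; apply: hinf_hhM => //.
  by case: hG => /H2P.
have Lr := minusQ_L2 Qr.
have LAG : L2 (fun t => A t *m G t) by apply: L2_mulmx => //; exact: bddmx_A.
rewrite (_ : (fun t => Phi t *m G t) = (fun t => A t *m G t) + r).
  rewrite (ipDl (HS _)) // (sipC (HS _) LK Lr).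
  by move: hK; rewrite H2minus_L2E => -[_ /(_ r Qr) ->]; rewrite rmorph0 addr0.
apply/funext => t; rewrite !fctE four_block_errorE mulmxBl /r.
by rewrite mul_block_diag mul0mx subrK.
Qed.

(** The operator t0 u0 (+) Gamma_Phi1: the projection acts on the lower part only, and the first
    coordinate is just multiplied by a function of modulus t0. *)
Definition deflated (X : R -> 'cV[C]_(1 + (q + n2))) (t : R) : 'cV[C]_(1 + (p + m2)) :=
  col_mx (((t0%:C)%C * u0 t) *: usubmx (X t)) (Gamma Phi1 (fun t => dsubmx (X t)) t).

Let bdd_u0 : bdd u0 /\ \forall t \ae mu, u0 t * (u0 t)^* = 1.
Proof.
(* Instantiated at the zero function for the measurability and unimodularity of u0 alone. *)
have [m1 u1 _] := toeplitz_dense h_outer theta_inner tau_inner u0E (sqint_cst (0 : C)) (@ltr01 R).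
by split => //; exact: bdd_norm1.
Qed.

Let L2_V X : L2 X -> L2 (fun t => V' t *m X t : 'cV[C]_(q.+1 + n2)).
Proof. by move=> LX; apply: (L2_mulmx bV LX). Qed.

Let L2_W Y : L2 Y -> L2 (fun t => W' t *m Y t : 'cV[C]_(p.+1 + m2)).
Proof. by move=> LY; apply: (L2_mulmx bWH LY). Qed.

Lemma sqn_V X : L2 X -> N (fun t => V' t *m X t : 'cV[C]_(q.+1 + n2)) = N X.
Proof.
move=> LX; rewrite {1}/sqn.
have -> : inner2 (fun t => V' t *m X t) (fun t => V' t *m X t) = inner2 X X.
  apply: (inner2_unitary (U := V) _ bV LX LX).
  by apply: filterS V_unitary => t /unitarymxP /mulmx1C.
by [].
Qed.

Let uW : \forall t \ae mu, ((((W t)^t*)%sesqui)^t*)%sesqui *m ((W t)^t*)%sesqui = 1%:M.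
Proof.
apply: filterS W_unitary => t /unitarymxP e; rewrite -[RHS]e; congr (_ *m _).
by apply/matrixP => i j; rewrite !mxE conjCK.
Qed.

Lemma sqn_W Y : L2 Y -> N (fun t => W' t *m Y t : 'cV[C]_(p.+1 + m2)) = N Y.
Proof.
move=> LY; rewrite {1}/sqn.
have -> : inner2 (fun t => W' t *m Y t) (fun t => W' t *m Y t) = inner2 Y Y.
  exact: (inner2_unitary (U := fun t => ((W t)^t*)%sesqui) uW bWH LY LY).
by [].
Qed.

Lemma L2_deflated X : L2 X -> L2 (deflated X).
Proof.
move=> /L2_col[Lu Ld]; apply/L2_col; split.
  rewrite /deflated; under eq_fun do rewrite col_mxKu.
  apply/L2P => i; under eq_fun do rewrite mxE.
  apply: bdd_sqintM; last by move/L2P: Lu.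
  by apply: bddM; [exact: bdd_cst|case: bdd_u0].
by rewrite /deflated; under eq_fun do rewrite col_mxKd; apply: L2_Gamma => //; exact: bddmx_Phi1.
Qed.

(** Membership of W^* Y in H^2_- (+) L^2 lets the four block error replace Gamma_Phi, and then V and
    W cancel; the same membership for the lower part of Y lets Gamma_Phi1 replace Phi1. *)
Lemma Gamma_pairing X Y : L2 X -> L2 Y ->
  H2_L2 (fun t => V' t *m X t : 'cV[C]_(q.+1 + n2)) ->
  H2minus_L2 (fun t => W' t *m Y t : 'cV[C]_(p.+1 + m2)) ->
  H2minus_L2 (fun t => dsubmx (Y t)) ->
  inner2 (Gamma Phi (fun t => V' t *m X t)) (fun t => W' t *m Y t) = inner2 (deflated X) Y.
Proof.
move=> LX LY hX hY hd; have LVX := L2_V LX; have LWY := L2_W LY.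
rewrite Gamma_inner // inner2_four_block_error //.
pose blk t : 'cV[C]_(1 + (p + m2)) :=
  col_mx (((t0%:C)%C * u0 t) *: usubmx (X t)) (Phi1 t *m dsubmx (X t)).
have [Lu Ld] := (L2_col X).1 LX.
have Lblk : L2 blk.
  apply/L2_col; split.
    rewrite /blk; under eq_fun do rewrite col_mxKu.
    by have [+ _] := (L2_col _).1 (L2_deflated LX); rewrite /deflated; under eq_fun do rewrite col_mxKu.
  by rewrite /blk; under eq_fun do rewrite col_mxKd; apply: L2_mulmx => //; exact: bddmx_Phi1.
have e1 : \forall t \ae mu, A t *m (V' t *m X t) = W' t *m blk t.
  have uu : \forall t \ae mu, V t \is unitarymx by exact: V_unitary.
  apply: filterS2 uu Phi1E => t /unitarymxP /mulmx1C uV e; rewrite /A e.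
  rewrite /V' -!mulmxA [((V t)^t*)%sesqui *m _]mulmxA uV mul1mx /W'; congr (_ *m _).
  etransitivity; first exact: (mul_block_diag ((t0%:C)%C * u0 t)%:M (Phi1 t) (X t)).
  by rewrite mul_scalar_mx.
have LWb := L2_W Lblk.
rewrite (inner2_ae _ LWY LWb LWY e1) //; last 2 first.
- by apply: L2_mulmx => //; exact: bddmx_A.
- exact: nearW.
transitivity (inner2 blk Y).
  exact: (inner2_unitary (U := fun t => ((W t)^t*)%sesqui) uW bWH Lblk LY).
rewrite (inner2_split Lblk LY) (inner2_split (L2_deflated LX) LY); congr (_ + _).
  by rewrite /blk /deflated; congr inner2; apply/funext => t; rewrite !col_mxKu.
rewrite (_ : (fun t => dsubmx (deflated X t)) = Gamma Phi1 (fun t => dsubmx (X t))).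
  rewrite (Gamma_inner bddmx_Phi1 Ld hd); congr inner2; apply/funext => t.
  by rewrite /blk col_mxKd.
by apply/funext => t; rewrite /deflated col_mxKd.
Qed.

Hypothesis t0_gt0 : 0 < t0.

Let real_conj (r : R) : ((r%:C)%C)^* = (r%:C)%C :> C.
Proof. by apply: complex_ext; rewrite ?cReconj ?cImconj //= oppr0. Qed.

Let normcR (r : R) : 0 <= r -> normc ((r%:C)%C) = r.
Proof. by move=> r0; rewrite /= expr0n addr0 sqrtr_sqr ger0_norm. Qed.

Let scalar_identity (z u b c eta eta2 : C) :
  (z * (b + - (t0%:C)%C * eta2))^* - (t0%:C)%C * u * (c + eta) =
  (t0%:C)%C * (((t0^-1)%:C)%C * (z * b)^* - u * c - (u * eta + (z * eta2)^*)).
Proof.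
have : (t0%:C)%C * ((t0^-1)%:C)%C = 1 :> C by rewrite -rmorphM /= mulfV ?gt_eqF.
have := real_conj t0; move: (t0%:C)%C ((t0^-1)%:C)%C => r r1 rr rr1.
have -> : (z * (b + - r * eta2))^* = z^* * (b^* - r * eta2^*).
  by rewrite rmorphM rmorphD rmorphM rmorphN /= rr mulNr.
by rewrite !rmorphM !mulrBr [_ * (r1 * _)]mulrA rr1 mul1r /=; ring.
Qed.

(** The lower parts are settled first: F is replaced by its liftable approximation F', then
    Gamma_Phi1 F' is approximated after reflection. The first coordinates are matched afterwards
    through the free functions eta and eta1. *)
Lemma pairing_lift F e : H2_L2 F -> 0 < e ->
  exists (X : R -> 'cV[C]_(1 + (q + n2))) (Y : R -> 'cV[C]_(1 + (p + m2))),
  [/\ L2 X, L2 Y, H2_L2 (fun t => V' t *m X t : 'cV[C]_(q.+1 + n2)) &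
      H2minus_L2 (fun t => W' t *m Y t : 'cV[C]_(p.+1 + m2))] /\
  [/\ H2minus_L2 (fun t => dsubmx (Y t)), nr ((fun t => dsubmx (X t)) - F) < e &
      nr (Y - deflated X) < e].
Proof.
move=> hF e0; have e2 : 0 < e / 2 by rewrite divr_gt0.
have [F' [c [hF' sc hFe Vlift]]] := lift_exists v_completion V_meas V_unitary V_form hF e0.
have LF' := H2_L2_L2 hF'; pose g := Gamma Phi1 F'.
have hg : H2minus_L2 g by case: (GammaP bddmx_Phi1 LF').
have hcg := conjz_H2minus_L2 hg; have Lg := H2minus_L2_L2 hg.
have WT_meas : mxmeasurable (fun t => (W t)^T).
  by move=> i j; under eq_fun do rewrite mxE; under [X in _ /\ measurable_fun _ X]eq_fun do rewrite mxE.
have WT_unitary : unitary_valued (fun t => (W t)^T).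
  by apply: filterS W_unitary => t; rewrite trmx_unitary.
have [L' [b [hL' sb hLe Wlift]]] := lift_exists w_completion WT_meas WT_unitary W_form hcg e2.
have LL' := H2_L2_L2 hL'; have Lcg := H2_L2_L2 hcg.
have e3 : 0 < t0^-1 * (e / 2) by rewrite mulr_gt0 // invr_gt0.
(* The first coordinates of Y and [deflated] X differ by conj(z (b + eta1)) - t0 u0 (c + eta).
   Dividing by t0 leaves this fixed part to be approximated, with tolerance e / (2 t0). *)
pose c0 t := ((t0^-1)%:C)%C * (zT t * b t)^* - u0 t * c t.
have sc0 : sqint c0.
  apply: sqintB; last by apply: bdd_sqintM => //; case: bdd_u0.
  by apply/sqintZ/sqint_conj; apply: bdd_sqintM => //; exact: bdd_zT.
have [_ _ [eta [eta2 [h1 h2 hd]]]] :=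
  toeplitz_dense h_outer theta_inner tau_inner u0E sc0 e3.
(* The factor -t0 makes that difference equal to t0 (c0 - (u0 eta + conj(z eta2))); as t0 is real,
   conjugation does not affect it. *)
pose eta1 t := (- (t0%:C)%C) * eta2 t.
have h1' : hh eta1 by exact: hhZ.
pose X t : 'cV[C]_(1 + (q + n2)) := col_mx (c t + eta t)%:M (F' t).
pose Y0 t : 'cV[C]_(1 + (p + m2)) := col_mx (b t + eta1 t)%:M (L' t).
have LX : L2 X by apply: (L2_col_scal (c := fun t => c t + eta t)) => //; apply: sqintD => //; case: h1.
have LY0 : L2 Y0 by apply: (L2_col_scal (c := fun t => b t + eta1 t)) => //; apply: sqintD => //; case: h1'.
have LY := L2_conjz LY0.
have dX : (fun t => dsubmx (X t)) = F' by apply/funext => t; rewrite /X col_mxKd.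
have dY : (fun t => dsubmx (conjz Y0 t)) = conjz L'.
  by rewrite dsub_conjz; congr conjz; apply/funext => t; rewrite /Y0 col_mxKd.
exists X, (conjz Y0); split; split => //.
- exact: Vlift.
- have := conjz_H2_L2 (Wlift eta1 h1').
  by rewrite (mulmx_conjz (fun t => ((W t)^T : 'M[C]_(p.+1 + m2, 1 + (p + m2))))).
- by rewrite dY; exact: conjz_H2_L2.
- by rewrite dX.
have LD : L2 (conjz Y0 - deflated X) by apply: (sipB (HS _)) => //; exact: L2_deflated.
apply: le_lt_trans (nr_col_le LD) _; rewrite [e in _ < e]splitr; apply: ltrD.
  have -> : (fun t => usubmx ((conjz Y0 - deflated X) t)) =
      (t0%:C)%C *: (scal c0 - scal (fun t => u0 t * eta t + (zT t * eta2 t)^*)).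
    have uY t : usubmx (conjz Y0 t) = ((zT t * (b t + eta1 t))^*)%:M.
      transitivity (conjz (fun t => usubmx (Y0 t)) t); first by rewrite -usub_conjz.
      by apply/matrixP => i j; rewrite /conjz /Y0 col_mxKu !mxE (ord1 i) (ord1 j) !eqxx !mulr1n.
    apply/funext => t; rewrite !fctE linearB /= uY /deflated /X !col_mxKu /scal.
    apply/matrixP => i j; rewrite !mxE (ord1 i) (ord1 j) !eqxx !mulr1n /c0 /eta1.
    exact: scalar_identity.
  have Ls : L2 (scal c0 - scal (fun t => u0 t * eta t + (zT t * eta2 t)^*)).
    apply: (sipB (HS _)); apply/L2_scal => //; apply: sqintD.
      by apply: bdd_sqintM; [case: bdd_u0|case: h1].
    by apply: sqint_conj; apply: bdd_sqintM; [exact: bdd_zT|case: h2].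
  rewrite (nrmZ (HS _)) // normcR ?ltW //.
  by rewrite mulrC -ltr_pdivlMr // mulrC.
have -> : (fun t => dsubmx ((conjz Y0 - deflated X) t)) = conjz L' - g.
  rewrite -dY /g -dX; apply/funext => t; rewrite !fctE /deflated.
  by rewrite linearB /= col_mxKd.
by rewrite -[g]conjzK conjzB /nrm sqn_conjz.
Qed.

Let dsub_deflated X : (fun t => dsubmx (deflated X t)) = Gamma Phi1 (fun t => dsubmx (X t)).
Proof. by apply/funext => t; rewrite /deflated col_mxKd. Qed.

Let usub_deflated X :
  (fun t => usubmx (deflated X t)) = (t0%:C)%C *: (fun t => u0 t *: usubmx (X t)).
Proof. by apply/funext => t; rewrite /deflated col_mxKu !fctE scalerA. Qed.

Lemma sqn_deflated X : L2 X ->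
  N (deflated X) = t0 ^+ 2 * N (fun t => usubmx (X t)) + N (Gamma Phi1 (fun t => dsubmx (X t))).
Proof.
move=> LX; have [Lu Ld] := (L2_col X).1 LX; have [bu u1] := bdd_u0.
rewrite (sqn_split (L2_deflated LX)) dsub_deflated usub_deflated; congr (_ + _).
have Luu : L2 (fun t => u0 t *: usubmx (X t)).
  by apply/L2P => i; under eq_fun do rewrite mxE; apply: bdd_sqintM => //; move/L2P: Lu.
rewrite (sqnZ (HS _)) // (sqn_unimodular bu u1) //; congr (_ ^+ 2 * _).
by rewrite /= expr0n addr0 sqrtr_sqr ger0_norm // ltW.
Qed.

(** The first coordinate is exactly linear; the defect comes from Gamma_Phi1, which is linear up to
    null functions. *)
Lemma deflated_comb k (c : 'I_k -> C) (X : 'I_k -> R -> 'cV[C]_(1 + (q + n2))) :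
  (forall i, L2 (X i)) -> nr (deflated (\sum_i c i *: X i) - \sum_i c i *: deflated (X i)) = 0.
Proof.
move=> LX; have LdX i : L2 (fun t => dsubmx (X i t)) by case: ((L2_col _).1 (LX i)).
have LS := comb_L2 c (fun i => L2_deflated (LX i)).
have LD := sipB (HS _) (L2_deflated (comb_L2 c LX)) LS.
apply/eqP; rewrite eq_le nrm_ge0 andbT; apply: le_trans (nr_col_le LD) _.
set dS := (\sum_i c i *: deflated (X i)) in LD *.
have -> : (fun t => usubmx ((deflated (\sum_i c i *: X i) - dS) t)) = 0.
  apply/funext => t; rewrite !fctE linearB /=.
  have -> : usubmx (deflated (\sum_i c i *: X i) t) =
      ((t0%:C)%C *: (fun t => u0 t *: (\sum_i c i *: (fun t => usubmx (X i t))) t)) t.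
    by rewrite -usub_comb -usub_deflated.
  have -> : usubmx (dS t) = (\sum_i c i *: (fun t => usubmx (deflated (X i) t))) t.
    by rewrite -usub_comb.
  apply/eqP; rewrite subr_eq0; apply/eqP.
  rewrite !fctE !fct_sumE !scaler_sumr; apply: eq_bigr => i _.
  by rewrite usub_deflated !fctE !scalerA [_ * c i]mulrC mulrA.
have -> : (fun t => dsubmx ((deflated (\sum_i c i *: X i) - dS) t)) =
    Gamma Phi1 (\sum_i c i *: (fun t => dsubmx (X i t)))
    - \sum_i c i *: Gamma Phi1 (fun t => dsubmx (X i t)).
  apply/funext => t; rewrite !fctE linearB /=; congr (_ - _).
    by rewrite -dsub_comb -dsub_deflated.
  transitivity ((\sum_i c i *: (fun t => dsubmx (deflated (X i) t))) t).
    by rewrite -dsub_comb.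
  rewrite !fct_sumE; apply: eq_bigr => i _; rewrite !fctE; congr (_ *: _).
  exact: (congr1 (@^~ t) (dsub_deflated (X i))).
by rewrite (nrm0 (HS _)) add0r (Gamma_comb bddmx_Phi1).
Qed.

Lemma essential_descent (s0 s : R) : 0 <= s0 -> s0 < s -> s < t0 ->
  (Gamma_essnorm Phi < s0%:E)%E -> (s%:E < Gamma_essnorm Phi1)%E -> False.
Proof.
move=> s00 s0s st0 hs0 hs; have s_ge0 : 0 <= s by rewrite (le_trans s00) // ltW.
have [Ys YsL hYs] := essnorm_below bPhi hs0.
have [F [DF F1 GF oF oGF]] := orthogonal_exceeding bddmx_Phi1 hs.
have [B B0 hB] := Gamma_lipschitz bddmx_Phi1.
(* One vector more than there are conditions, so that some normalized combination meets them all.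
   The denominator of d turns the bound required by [essential_gap] into (s - s0)/2 < s - s0. *)
pose k := (size Ys).+1; pose d := (s - s0) / (2 * (s0 + B + 2)).
have D0 : 0 < s0 + B + 2 by rewrite ltr_wpDl // addr_ge0.
have d0 : 0 < d by rewrite divr_gt0 ?subr_gt0 // mulr_gt0.
(* The coefficients have modulus at most 1, so the k individual errors add up to at most d. *)
pose e := d / k%:R; have e0 : 0 < e by rewrite divr_gt0.
have ke : k%:R * e = d by rewrite /e mulrC divfK // pnatr_eq0.
pose P (i : 'I_k) (XY : (R -> 'cV[C]_(1 + (q + n2))) * (R -> 'cV[C]_(1 + (p + m2)))) :=
  [/\ L2 XY.1, L2 XY.2, H2_L2 (fun t => V' t *m XY.1 t : 'cV[C]_(q.+1 + n2)) &
      H2minus_L2 (fun t => W' t *m XY.2 t : 'cV[C]_(p.+1 + m2))] /\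
  [/\ H2minus_L2 (fun t => dsubmx (XY.2 t)), nr ((fun t => dsubmx (XY.1 t)) - F i) < e &
      nr (XY.2 - deflated XY.1) < e].
have exP i : exists xy, P i xy.
  by have [X [Y hi]] := pairing_lift (DF i) e0; exists (X, Y).
have [XY hXY] := boolp.choice exP.
pose X i := (XY i).1; pose Y i := (XY i).2.
have LX i : L2 (X i) by case: (hXY i) => -[].
have LY i : L2 (Y i) by case: (hXY i) => -[].
have VX i : H2_L2 (fun t => V' t *m X i t : 'cV[C]_(q.+1 + n2)) by case: (hXY i) => -[].
have WY i : H2minus_L2 (fun t => W' t *m Y i t : 'cV[C]_(p.+1 + m2)) by case: (hXY i) => -[].
have dY i : H2minus_L2 (fun t => dsubmx (Y i t)) by case: (hXY i) => _ [].
have dXF i : nr ((fun t => dsubmx (X i t)) - F i) <= e by case: (hXY i) => _ [_ /ltW].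
have YX i : nr (Y i - deflated (X i)) <= e by case: (hXY i) => _ [_ _ /ltW].
have LF i := H2_L2_L2 (DF i).
have LdX i : L2 (fun t => dsubmx (X i t)) by case: ((L2_col _).1 (LX i)).
(* The conditions are imposed on the lifted vectors V X_i; a vector of the left kernel makes the
   combination orthogonal to all of [Ys]. *)
pose M : 'M[C]_(k, size Ys) :=
  \matrix_(i, j) inner2 (fun t => V' t *m X i t) (nth 0 Ys j).
have [c [c1 cA]] := left_kernel M (ltnSn _).
have cle i : normc (c i) <= 1.
  rewrite -ler_sqr ?nnegrE ?normc_ge0 // expr1n -c1 (bigD1 i) //= lerDl.
  by apply: sumr_ge0 => j _; exact: sqr_ge0.
pose Xc := \sum_i c i *: X i; pose Yc := \sum_i c i *: Y i.
pose Fc := \sum_i c i *: F i.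
have LXc : L2 Xc := comb_L2 c LX.
have LYc : L2 Yc := comb_L2 c LY.
have LFc : L2 Fc := comb_L2 c LF.
have VXc : H2_L2 (fun t => V' t *m Xc t : 'cV[C]_(q.+1 + n2)).
  rewrite mulmx_comb; apply: (@comb_closed R _ (@H2_L2 R q.+1 n2)) => //.
  - exact: H2_L2_0.
  - by move=> a x y; exact: H2_L2_lin.
have WYc : H2minus_L2 (fun t => W' t *m Yc t : 'cV[C]_(p.+1 + m2)).
  rewrite mulmx_comb; apply: (@comb_closed R _ (@H2minus_L2 R p.+1 m2)) => //.
  - exact: H2minus_L2_0.
  - by move=> a x y; exact: H2minus_L2_lin.
have dYc : H2minus_L2 (fun t => dsubmx (Yc t)).
  rewrite dsub_comb; apply: (@comb_closed R _ (@H2minus_L2 R p m2)) => //.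
  - exact: H2minus_L2_0.
  - by move=> a x y; exact: H2minus_L2_lin.
have perpY y : y \in Ys -> inner2 (fun t => V' t *m Xc t) y = 0.
  move=> yY; have Ly := YsL y yY.
  have jlt : (index y Ys < size Ys)%N by rewrite index_mem.
  rewrite mulmx_comb (ip_suml (HS _)) //; last first.
    by move=> i _; apply: (sipZ (HS _)); exact: L2_V.
  rewrite -[RHS](cA (Ordinal jlt)); apply: eq_bigr => i _.
  by rewrite (ipZl (HS _)) ?mxE ?nth_index //; exact: L2_V.
have hG := hYs _ VXc perpY.
have [Luc Ldc] := (L2_col Xc).1 LXc.
have dXc : nr ((fun t => dsubmx (Xc t)) - Fc) <= d.
  rewrite /Xc dsub_comb /Fc -sumrB.
  under eq_bigr do rewrite -scalerBr.
  rewrite -ke; apply: (nr_comb_le _ cle dXF) => i.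
  exact: (sipB (HS _) (LdX i) (LF i)).
have YXc : nr (Yc - deflated Xc) <= d.
  have LdS := comb_L2 c (fun i => L2_deflated (LX i)).
  have LdX' := L2_deflated LXc.
  apply: le_trans (nrm_triB (HS _) LYc LdS LdX') _.
  rewrite [X in _ + X](nrm_distC (HS _)) // (deflated_comb c LX) addr0.
  rewrite /Yc -sumrB; under eq_bigr do rewrite -scalerBr.
  rewrite -ke; apply: (nr_comb_le _ cle YX) => i.
  exact: (sipB (HS _) (LY i) (L2_deflated (LX i))).
have oFk (i j : 'I_k) : i != j -> inner2 (F i) (F j) = 0 by rewrite -val_eqE; exact: oF.
have oGFk (i j : 'I_k) : i != j -> inner2 (Gamma Phi1 (F i)) (Gamma Phi1 (F j)) = 0.
  by rewrite -val_eqE; exact: oGF.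
have LFk (i : 'I_k) : L2 (F i) by exact: LF.
have nF1 : nr Fc <= 1.
  by have [nle _] := nr_comb_orth LFk oFk c1; apply: nle => i; exact: F1.
have LGF (i : 'I_k) := L2_Gamma bddmx_Phi1 (LF i).
have nGF : s <= nr (Gamma Phi1 Fc).
  have [_ nge] := nr_comb_orth LGF oGFk c1.
  rewrite (nrm_congr (HS _) (L2_Gamma bddmx_Phi1 LFc) (comb_L2 c LGF)).
    by apply: nge => // i; exact/ltW.
  exact: (Gamma_comb bddmx_Phi1).
have LVX := L2_V LXc; have LWY := L2_W LYc.
have LG := L2_Gamma bPhi LVX; have Ldef := L2_deflated LXc.
(* The squared norm of Yc is the pairing of Gamma_Phi V Xc with W^* Yc plus that of Yc - [deflated]
   Xc with Yc; by Cauchy-Schwarz, both carry a factor equal to the norm of Yc, which cancels. *)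
have yG : nr Yc - d <= nr (Gamma Phi (fun t => V' t *m Xc t)).
  rewrite lerBlDr; have [->|y0] := eqVneq (nr Yc) 0.
    by rewrite addr_ge0 ?nrm_ge0 // ltW.
  have yp : 0 < nr Yc by rewrite lt_neqAle eq_sym y0 nrm_ge0.
  rewrite -(ler_pM2r yp) mulrDl -expr2 (nrmK (HS _)) // /sqn.
  have -> : inner2 Yc Yc = inner2 (Gamma Phi (fun t => V' t *m Xc t)) (fun t => W' t *m Yc t)
      + inner2 (Yc - deflated Xc) Yc.
    by rewrite Gamma_pairing // (ipBl (HS _)) // addrC subrK.
  rewrite cReD; apply: lerD.
    apply: le_trans (le_trans (ler_norm _) (Re_le_normc _)) _.
    apply: le_trans (CS (HS _) LG LWY) _; rewrite le_eqVlt; apply/orP; left; apply/eqP.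
    by congr (_ * _); rewrite /nrm sqn_W.
  apply: le_trans (le_trans (ler_norm _) (Re_le_normc _)) _.
  apply: le_trans (CS (HS _) (sipB (HS _) LYc Ldef) LYc) _.
  by rewrite ler_wpM2r ?nrm_ge0.
have h1 : nr (fun t => dsubmx (Xc t)) <= 1 + d.
  by apply: le_trans (nrm_lB (HS _) Ldc LFc) _; exact: lerD.
have h2 : s <= nr (Gamma Phi1 (fun t => dsubmx (Xc t))) + B * d.
  apply: le_trans nGF _.
  apply: le_trans (nrm_lB (HS _) (L2_Gamma bddmx_Phi1 LFc) (L2_Gamma bddmx_Phi1 Ldc)) _.
  rewrite lerD2l; apply: le_trans (hB _ _ LFc Ldc) _.
  by rewrite (nrm_distC (HS _) LFc Ldc); exact: ler_wpM2l.
have h3 : nr (deflated Xc) ^+ 2 = t0 ^+ 2 * nr (fun t => usubmx (Xc t)) ^+ 2 +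
    nr (Gamma Phi1 (fun t => dsubmx (Xc t))) ^+ 2.
  rewrite (nrmK (HS _) Ldef) (nrmK (HS _) Luc) (nrmK (HS _) (L2_Gamma bddmx_Phi1 Ldc)).
  exact: sqn_deflated.
have h4 : nr (deflated Xc) - d <= nr Yc.
  rewrite lerBlDr; apply: le_trans (nrm_lB (HS _) Ldef LYc) _.
  by rewrite lerD2l (nrm_distC (HS _) Ldef LYc).
have h5 : nr (Gamma Phi (fun t => V' t *m Xc t)) <= s0 * nr Xc.
  by move: hG; rewrite {2}/nrm (sqn_V LXc).
have h6 : nr Xc ^+ 2 = nr (fun t => usubmx (Xc t)) ^+ 2 + nr (fun t => dsubmx (Xc t)) ^+ 2.
  by rewrite (nrmK (HS _) LXc) (nrmK (HS _) Luc) (nrmK (HS _) Ldc) (sqn_split LXc).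
have h7 : (s0 + B + 2) * d < s - s0.
  have -> : (s0 + B + 2) * d = (s - s0) / 2 by rewrite /d; field; rewrite gt_eqF.
  by rewrite ltr_pdivrMr // ltr_pMr ?subr_gt0 // ltr1n.
exact: (essential_gap (nrm_ge0 _ _) (nrm_ge0 _ _) (nrm_ge0 _ _) (nrm_ge0 _ _) (nrm_ge0 _ _)
  (ltW d0) B0 s00 s0s st0 h1 h2 h3 h4 yG h5 h6 h7).
Qed.

Lemma deflated_essnorm_le :
  (Gamma_essnorm Phi < t0%:E)%E -> (Gamma_essnorm Phi1 <= Gamma_essnorm Phi)%E.
Proof.
move=> esst; rewrite leNgt; apply/negP => lt1.
have ess0 := Gamma_essnorm_ge0 Phi.
(* Staying below the minimum keeps s under t0, as the argument requires, and makes the bound finite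
   even if the essential norm of Gamma_Phi1 were infinite. *)
pose c := Order.min (Gamma_essnorm Phi1) t0%:E.
have ac : (Gamma_essnorm Phi < c)%E by rewrite lt_min lt1.
have ct : (c <= t0%:E)%E by rewrite ge_min lexx orbT.
have cb : (c <= Gamma_essnorm Phi1)%E by rewrite ge_min lexx.
move: (Gamma_essnorm Phi) c ess0 ac ct cb essential_descent => a c a0 ac ct cb descent.
have [c' cE] : exists c' : R, c = c'%:E.
  by exists (fine c); rewrite fineK // fin_numElt (lt_trans _ ac) ?(lt_le_trans _ a0) //=
    (le_lt_trans ct) ?ltry.
have [r aE] : exists r : R, a = r%:E.
  by exists (fine a); rewrite fineK // fin_numElt (lt_le_trans _ a0) //= (lt_trans ac) // cE ltry.
move: a0 ac ct cb descent; rewrite {}cE {}aE !lee_fin lte_fin => r0 rc ct cb descent.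
(* s0 and s cut the interval from the essential norm of Gamma_Phi to c' into thirds, which gives all
   the strict inequalities. *)
apply: (descent (r + (c' - r) / 3) (r + (c' - r) * 2 / 3)).
- lra.
- lra.
- lra.
- by rewrite lte_fin; lra.
- by apply: lt_le_trans cb; rewrite lte_fin; lra.
Qed.

End DeflatedSymbol.

Local Open Scope sesquilinear_scope.

(* m1 = p.+1 and n1 = q.+1: the existence of f_1 <> 0 and g_1 <> 0 forces
   m1, n1 >= 1, and Phi^(1)_11 has size (m1 - 1) x (n1 - 1) = p x q. *)
Theorem theorem6p3 (R : realType) (p q m2 n2 : nat)
  (Phi : R -> 'M[R[i]]_(p.+1 + m2, q.+1 + n2))
  (f : R -> 'cV[R[i]]_(q.+1 + n2)) (g : R -> 'cV[R[i]]_(p.+1 + m2))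
  (h theta tau u0 : R -> R[i])
  (v : R -> 'cV[R[i]]_(q.+1 + n2)) (w : R -> 'cV[R[i]]_(p.+1 + m2))
  (vo wo : R -> R[i]) (vi : R -> 'cV[R[i]]_q.+1) (wi : R -> 'cV[R[i]]_p.+1)
  (Vc : R -> 'M[R[i]]_(q.+1, q)) (Wc : R -> 'M[R[i]]_(p.+1, p))
  (V : R -> 'M[R[i]]_(q.+1 + n2)) (W : R -> 'M[R[i]]_(p.+1 + m2))
  (Q0 : R -> 'M[R[i]]_(p.+1, q.+1))
  (Phi1 : R -> 'M[R[i]]_(p + m2, q + n2))
  (t0 : R)
  (Phi_bounded : Linfty Phi)
  (ess_lt : (Gamma_essnorm Phi < Gamma_norm Phi)%E)
  (t0E : Gamma_norm Phi = t0%:E)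
  (f_max : maximizing_vector Phi f)
  (gE : forall t, g t = (t0^-1)%:C%C *: Gamma Phi f t)
  (h_outer : is_outerH2 h)
  (h_mod : \forall t \ae circle R, Normc.normc (h t) = vnorm (f t))
  (theta_gcd : is_gcid theta (fun t => usubmx (f t)))
  (tau_gcd : is_gcid tau (fun t => (zT t)^* *: map_mx Num.conj (usubmx (g t))))
  (vE : forall t, v t = ((theta t)^* / h t) *: f t)
  (wE : forall t, w t = ((zT t)^* * (tau t)^* / h t) *: map_mx Num.conj (g t))
  (u0E : forall t,
     u0 t = (zT t)^* * (theta t)^* * (tau t)^* * (h t)^* / h t)
  (v_completion : column_completion (fun t => usubmx (v t)) vo vi Vc)
  (w_completion : column_completion (fun t => usubmx (w t)) wo wi Wc)
  (V_meas : mxmeasurable V) (V_unitary : unitary_valued V)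
  (V_form : completion_form v Vc V)
  (W_meas : mxmeasurable W) (W_unitary : unitary_valued W)
  (W_form : completion_form w Wc (fun t => (W t)^T))
  (Q0_opt : optimal_solution Phi Q0)
  (Phi1_meas : mxmeasurable Phi1)
  (Phi1E : \forall t \ae circle R,
     four_block_error Phi Q0 t =
       (W t) ^t* *m
       (block_mx ((t0%:C)%C * u0 t)%:M 0 0 (Phi1 t)
          : 'M[R[i]]_(1 + (p + m2), 1 + (q + n2))) *m
       (V t) ^t*) :
  (Gamma_essnorm Phi1 <= Gamma_essnorm Phi)%E.
Proof.
(* An essential norm is nonnegative, and t0 lies strictly above that of Gamma_Phi. *)
have t0_gt0 : 0 < t0.
  by rewrite -lte_fin -t0E; apply: le_lt_trans ess_lt; exact: Gamma_essnorm_ge0.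
have [theta_inner _ _] := theta_gcd; have [tau_inner _ _] := tau_gcd.
have [Q0_Hinfty _] := Q0_opt.
apply: (deflated_essnorm_le (Linfty_bdd Phi_bounded) h_outer theta_inner tau_inner u0E
  v_completion w_completion V_meas V_unitary V_form W_meas W_unitary W_form Q0_Hinfty
  Phi1_meas Phi1E t0_gt0).
by rewrite -t0E.
Qed.
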